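(* Let $T>0$ and $\mathcal{M}=2\pi\,\mathbf{e}_1$, where $(\mathbf{e}_1,\mathbf{e}_2,\mathbf{e}_3)$ is the canonical basis of $\mathbb{R}^3$. Consider the unbounded operator $$\frac{\partial}{\partial\tau}+(\mathbf{v}\times\mathcal{M})\cdot\nabla_{\mathbf{v}}\;:\;L^{\infty}\big(0,T;L^{\infty}_{\#_1}(\mathbb{R}^+;L^2(\mathbb{R}^6))\big)\to L^{\infty}\big(0,T;L^{\infty}_{\#_1}(\mathbb{R}^+;L^2(\mathbb{R}^6))\big).$$ Then $$L^{\infty}\big(0,T;L^{\infty}_{\#_1}(\mathbb{R}^+;L^2(\mathbb{R}^6))\big)=\mathrm{Ker}\Big(\frac{\partial}{\partial\tau}+(\mathbf{v}\times\mathcal{M})\cdot\nabla_{\mathbf{v}}\Big)\oplus\mathrm{Im}\Big(\frac{\partial}{\partial\tau}+(\mathbf{v}\times\mathcal{M})\cdot\nabla_{\mathbf{v}}\Big).$$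
   Context: $L^{\infty}(0,T;L^{\infty}_{\#_1}(\mathbb{R}^+;L^2(\mathbb{R}^6)))$ is the space of (classes of) measurable real functions $f=f(t,\tau,\mathbf{x},\mathbf{v})$, with $t\in(0,T)$, $\tau\in\mathbb{R}^+$, $(\mathbf{x},\mathbf{v})\in\mathbb{R}^3\times\mathbb{R}^3$, which are $1$-periodic in $\tau$ and such that the essential supremum over $(t,\tau)$ of $\|f(t,\tau,\cdot,\cdot)\|_{L^2(\mathbb{R}^6)}$ is finite. The symbol $\times$ is the vector product of $\mathbb{R}^3$. The operator acts in the sense of distributions ($1$-periodically in $\tau$), with its natural domain: those $f$ in the space whose image under the operator is again in the space. $\mathrm{Ker}$ and $\mathrm{Im}$ denote its kernel and range; $\oplus$ means that every element of the space is uniquely the sum of an element of the kernel and an element of the range. *)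

(* Defs.v *)
From HB Require Import structures.
From mathcomp Require Import all_boot all_order all_algebra.
From mathcomp Require Import all_classical all_reals all_analysis.
From mathcomp Require Import ess_sup_inf.

Set Implicit Arguments.
Unset Strict Implicit.
Unset Printing Implicit Defensive.

Import Order.TTheory GRing.Theory Num.Theory.
Import numFieldNormedType.Exports.

Local Open Scope classical_set_scope.
Local Open Scope ring_scope.

(* Points of kspace are ((t, tau), (x, v)).  mR2, mR3, mR6 and mkspace are
   convertible to R * R, R3, R3 * R3 and kspace; they carry the product Borel
   sigma-algebras on which lebesgue_measure lives, whereas R3 and kspace carry
   the normed module structures used for derivatives. *)
Notation R3 R := (R * R * R)%type.
Notation kspace R := ((R * R) * ((R * R * R) * (R * R * R)))%type.
Notation mR2 R := (measurableTypeR R * measurableTypeR R)%type.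
Notation mR3 R := (mR2 R * measurableTypeR R)%type.
Notation mR6 R := (mR3 R * mR3 R)%type.
Notation mkspace R := (mR2 R * mR6 R)%type.

Section vector_calculus.
Context {R : realType}.

Definition vec1 : R3 R := (1, 0, 0).
Definition vec2 : R3 R := (0, 1, 0).
Definition vec3 : R3 R := (0, 0, 1).

Definition cross (a b : R3 R) : R3 R :=
  (a.1.2 * b.2 - a.2 * b.1.2,
   a.2 * b.1.1 - a.1.1 * b.2,
   a.1.1 * b.1.2 - a.1.2 * b.1.1).

(* C^oo: every iterated directional derivative of phi is Frechet
   differentiable everywhere. *)
Definition smooth {V : normedModType R} (phi : V -> R) : Prop :=
  forall (us : seq V) (p : V),
    differentiable (foldr (fun (u : V) (psi : V -> R) => 'D_u psi) phi us) p.

Definition d_tau (phi : kspace R -> R) : kspace R -> R :=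
  'D_(((0, 1), (0, 0)) : kspace R) phi.

Definition div_v (F : kspace R -> R3 R) : kspace R -> R := fun p =>
  'D_(((0, 0), (0, vec1)) : kspace R) (fun q => (F q).1.1) p
  + 'D_(((0, 0), (0, vec2)) : kspace R) (fun q => (F q).1.2) p
  + 'D_(((0, 0), (0, vec3)) : kspace R) (fun q => (F q).2) p.

End vector_calculus.

(* The library's sigma-finite instance for product measures is only found for
   products of subprobabilities. *)
Lemma product_measure1_sigma_finite d1 d2 (T1 : measurableType d1)
    (T2 : measurableType d2) (R : realType)
    (m1 : {sigma_finite_measure set T1 -> \bar R})
    (m2 : {sigma_finite_measure set T2 -> \bar R}) :
  sigma_finite setT (m1 \x m2)%E.
Proof.
have /sigma_finiteP[F [TF ndF Foo]] := sigma_finiteT m1.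
have /sigma_finiteP[G [TG ndG Goo]] := sigma_finiteT m2.
exists (fun n => F n `*` G n).
  rewrite -setXTT TF TG predeqE => -[x y]; split.
    move=> [/= [n _ Fnx] [k _ Gky]]; exists (maxn n k) => //; split.
    - by move: x Fnx; exact/subsetPset/ndF/leq_maxl.
    - by move: y Gky; exact/subsetPset/ndG/leq_maxr.
  by move=> [n _ []/= ? ?]; split; exists n.
move=> k; have [? ?] := Foo k; have [? ?] := Goo k.
split; first exact: measurableX.
by rewrite product_measure1E// lte_mul_pinfty// ge0_fin_numE.
Qed.

Section lebesgue_products.
Context {R : realType}.

Definition leb2 : set (mR2 R) -> \bar R :=
  (@lebesgue_measure R \x @lebesgue_measure R)%E.
HB.instance Definition _ := Measure.on leb2.
HB.instance Definition _ := Measure_isSigmaFinite.Build _ _ _ leb2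
  (product_measure1_sigma_finite _ _).

Definition leb3 : set (mR3 R) -> \bar R := (leb2 \x @lebesgue_measure R)%E.
HB.instance Definition _ := Measure.on leb3.
HB.instance Definition _ := Measure_isSigmaFinite.Build _ _ _ leb3
  (product_measure1_sigma_finite _ _).

Definition leb6 : set (mR6 R) -> \bar R := (leb3 \x leb3)%E.
HB.instance Definition _ := Measure.on leb6.
HB.instance Definition _ := Measure_isSigmaFinite.Build _ _ _ leb6
  (product_measure1_sigma_finite _ _).

Definition leb8 : set (mkspace R) -> \bar R := (leb2 \x leb6)%E.
HB.instance Definition _ := Measure.on leb8.
HB.instance Definition _ := Measure_isSigmaFinite.Build _ _ _ leb8
  (product_measure1_sigma_finite _ _).

End lebesgue_products.

Section function_space.
Context {R : realType}.
Implicit Types (T : R) (f g : mkspace R -> R).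

Definition time_dom T : set (mR2 R) := `]0, T[ `*` `]0, +oo[.

Definition kdom T : set (mkspace R) := time_dom T `*` setT.

Definition kdom_period T : set (mkspace R) := (`]0, T[ `*` `]0, 1[) `*` setT.

(* Functions are total but only matter on kdom T; elements of the function
   space are classes for this relation. *)
Definition same_class T f g : Prop := ae_eq leb8 (kdom T) f g.

Definition LinfLinfL2 T : set (mkspace R -> R) := [set f |
  [/\ measurable_fun (kdom T) f,
      (\forall p \ae leb8,
         kdom T p -> f ((p.1.1, p.1.2 + 1), p.2) = f p) &
      (ess_sup leb2
         ((fun s => 'N[leb6]_2%:E[EFin \o (fun z => f (s, z))]) \_ (time_dom T))
       < +oo)%E]].

(* Smooth functions on ]0, T[ x (R / Z) x R^6 with compact support. *)
Definition test_function T (phi : kspace R -> R) : Prop :=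
  [/\ smooth phi,
      (forall t tau z, phi ((t, tau + 1), z) = phi ((t, tau), z)) &
      exists K : set (R * (R3 R * R3 R)),
        [/\ compact K, K `<=` `]0, T[ `*` setT &
            forall t tau z, ~ K (t, z) -> phi ((t, tau), z) = 0]].

(* g = d f / d tau + (v x M) . grad_v f as 1-periodic distributions, paired
   with test functions by integrating over one period in tau: the smooth factor v x M multiplies the test function before the derivatives
   are transposed, which gives
   < g, phi > = - < f, d phi / d tau + div_v (phi (v x M)) >. *)
Definition transport_graph T (M : R3 R) f g : Prop :=
  forall phi, test_function T phi ->
    \int[leb8]_(p in kdom_period T) (g p * phi p) =
    - \int[leb8]_(p in kdom_period T)
        (f p * (d_tau phi p + div_v (fun q => phi q *: cross q.2.2 M) p)).

Definition transport_ker T (M : R3 R) : set (mkspace R -> R) :=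
  [set f | LinfLinfL2 T f /\ transport_graph T M f (cst 0)].

Definition transport_im T (M : R3 R) : set (mkspace R -> R) :=
  [set g | LinfLinfL2 T g /\
           exists2 f, LinfLinfL2 T f & transport_graph T M f g].

Definition direct_sum T (X A B : set (mkspace R -> R)) : Prop :=
  [/\ A `<=` X, B `<=` X &
  forall f, X f ->
    exists g h, [/\ A g, B h, same_class T f (g \+ h) &
      forall g' h', A g' -> B h' -> same_class T f (g' \+ h') ->
        same_class T g' g /\ same_class T h' h]].

End function_space.

(* Main.v *)
Require Import Defs.
From HB Require Import structures.
From mathcomp Require Import all_boot all_order all_algebra.
From mathcomp Require Import all_classical all_reals all_analysis.
From mathcomp Require Import ess_sup_inf measurable_realfun.
From mathcomp Require Import ring lra.
Set Implicit Arguments.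
Unset Strict Implicit.
Unset Printing Implicit Defensive.
Import Order.TTheory GRing.Theory Num.Theory.
Import numFieldNormedType.Exports.
Local Open Scope classical_set_scope.
Local Open Scope ring_scope.

(** The characteristics of the operator are v = larmor tau w, rotations about e1 of
    period 1 in tau because |M| = 2 pi.  In the coordinates (t, x, w, tau), which
    preserve Lebesgue measure, the operator is d/dtau.  The kernel part of f is its
    mean over one period at fixed (t, x, w); the remainder has mean zero, hence is the
    derivative of a 1-periodic primitive, given by a bounded kernel, so that
    Cauchy-Schwarz keeps both in the space.
    For uniqueness, let u lie in the kernel and in the range.  Testing the first
    property with E(tau) b(t, x, w), E smooth and 1-periodic, makes u orthogonal to
    E'(tau) b; testing the second with b alone makes u orthogonal to b.  Every smooth
    periodic function is a constant plus some E', so u is orthogonal to all products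
    e(tau) b(t, x, w), hence to indicators of boxes, hence to all measurable sets. *)

(** * Measure-preserving maps *)

(** Elements of the space are only measurable, so none of them is ever differentiated. Both
    existence identities are proved on one characteristic at a time with every derivative on the
    smooth test function: Fubini transposes the integral kernel, and the fundamental theorem of
    calculus evaluates it against the derivative of the test function. What makes the range large
    enough is that a mean-zero periodic function has a bounded periodic primitive. On a period of
    length 1, with a kernel bounded by 1, Cauchy-Schwarz bounds the primitive at each tau by the L2
    norm over the whole period; a bound that is square integrable in tau thus comes back uniform in
    tau, while t stays a spectator. For uniqueness, an element common to the kernel and the range
    has no regularity and cannot be tested against itself; it is shown to vanish only through
    orthogonality. The products E(tau) b(t, x, w) are admissible there because w, as a function of
    v, is itself 1-periodic in tau. *)

Definition mpres d1 d2 (X : measurableType d1) (Y : measurableType d2)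
    (R : realType) (mu : set X -> \bar R) (nu : set Y -> \bar R) (phi : X -> Y) :=
  measurable_fun setT phi /\
  forall A, measurable A -> mu (phi @^-1` A) = nu A.

Section mpres_integral.
Context d1 d2 (X : measurableType d1) (Y : measurableType d2) (R : realType).
Variables (mu : {measure set X -> \bar R}) (nu : {measure set Y -> \bar R}).
Variables (phi : X -> Y) (mp : mpres mu nu phi).

Lemma mpres_ge0_integral (f : Y -> \bar R) : measurable_fun setT f ->
  (forall y, 0 <= f y)%E -> (\int[nu]_y f y = \int[mu]_x f (phi x))%E.
Proof.
case: mp => mphi E mf f0.
rewrite -[RHS](ge0_integral_pushforward mphi mu measurableT mf)//.
by apply: eq_measure_integral => A mA _; rewrite -E.
Qed.

Lemma mpres_integral (f : Y -> \bar R) : measurable_fun setT f ->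
  (\int[nu]_y f y = \int[mu]_x f (phi x))%E.
Proof.
move=> mf; rewrite integralE [RHS]integralE.
congr (_ - _)%E; rewrite mpres_ge0_integral//.
- by apply: eq_integral => x _; rewrite -[LHS]/((f^\+ \o phi)%E x) -funepos_comp.
- exact: measurable_funepos.
- by apply: eq_integral => x _; rewrite -[LHS]/((f^\- \o phi)%E x) -funeneg_comp.
- exact: measurable_funeneg.
Qed.

Lemma mpres_integrable (f : Y -> \bar R) : measurable_fun setT f ->
  nu.-integrable setT f <-> mu.-integrable setT (f \o phi).
Proof.
case: (mp) => mphi _ mf.
split => /integrableP[_ foo]; apply/integrableP; split=> //.
- exact: measurableT_comp.
- by move: foo; rewrite mpres_ge0_integral//; exact: measurableT_comp.
- by rewrite mpres_ge0_integral//; exact: measurableT_comp.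
Qed.

End mpres_integral.

Section mpres_constructions.
Context d1 d2 d3 (X : measurableType d1) (Y : measurableType d2)
  (Z : measurableType d3) (R : realType).

Lemma mpres_comp (mu : set X -> \bar R) (nu : set Y -> \bar R) (la : set Z -> \bar R)
    (f : X -> Y) (g : Y -> Z) :
  mpres mu nu f -> mpres nu la g -> mpres mu la (g \o f).
Proof.
move=> [mf Ef] [mg Eg]; split; first exact: measurableT_comp.
move=> A mA; rewrite comp_preimage Ef ?Eg//.
by rewrite -[X in measurable X]setTI; exact: mg.
Qed.

(** The product measure integrates the measures of the sections, and each section of a preimage is
    the preimage of a section. Shears, rotations and the straightening all reduce to this case. *)
Lemma mpres_skew (m1 : {measure set X -> \bar R})
   (m2 : {sigma_finite_measure set Y -> \bar R})
   (m3 : {sigma_finite_measure set Z -> \bar R}) (phi : X * Y -> Z) :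
  measurable_fun setT phi -> (forall x, mpres m2 m3 (fun y => phi (x, y))) ->
  mpres (m1 \x m2)%E (m1 \x m3)%E (fun p => (p.1, phi p)).
Proof.
move=> mphi H; split; first exact: measurable_fun_pair.
move=> A mA; apply: eq_integral => x _ /=.
rewrite -(H x).2; last exact: measurable_xsection.
by congr (m2 _); apply/seteqP; split=> y /=; rewrite /xsection/= !inE.
Qed.

Lemma mpres_swap (m1 : {sigma_finite_measure set X -> \bar R})
   (m2 : {sigma_finite_measure set Y -> \bar R}) :
  mpres (m1 \x m2)%E (m2 \x m1)%E (fun p => (p.2, p.1)).
Proof.
split; first exact: measurable_fun_pair.
move=> A mA; apply/esym.
have mS : measurable_fun setT (fun p : X * Y => (p.2, p.1)) by exact: measurable_fun_pair.
apply: (@product_measure_unique _ _ _ _ _ m2 m1 (pushforward (m1 \x m2)%E (fun p => (p.2,p.1)))) => //.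
- move=> B C mB mC; rewrite /pushforward muleC -product_measure1E//.
  by congr (product_measure1 _ _ _); apply/seteqP; split=> -[x y] /= [? ?].
Qed.

(** The inner products enter as sigma-finite measures that equal products as set functions; this
    covers measures such as [leb2] and [leb7], whose sigma-finite structure is declared
    separately. *)
Lemma mpres_assoc (m1 : {sigma_finite_measure set X -> \bar R})
   (m2 : {sigma_finite_measure set Y -> \bar R})
   (m3 : {sigma_finite_measure set Z -> \bar R})
   (m12 : {sigma_finite_measure set (X * Y)%type -> \bar R})
   (m23 : {sigma_finite_measure set (Y * Z)%type -> \bar R}) :
   m12 = (m1 \x m2)%E :> (_ -> _) -> m23 = (m2 \x m3)%E :> (_ -> _) ->
  mpres (m12 \x m3)%E (m1 \x m23)%E (fun p => (p.1.1, (p.1.2, p.2))).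
Proof.
have mS : measurable_fun setT (fun p : X * Y * Z => (p.1.1, (p.1.2, p.2))).
  by apply: measurable_fun_pair => //; [apply: measurableT_comp|
    apply: measurable_fun_pair => //; apply: measurableT_comp].
move=> E12 E23; split=> // A mA.
rewrite /product_measure1 E12.
have mA' : measurable ((fun p : X * Y * Z => (p.1.1, (p.1.2, p.2))) @^-1` A).
  by rewrite -[X in measurable X]setTI; exact: mS.
rewrite fubini_tonelli1//; last exact: measurable_fun_xsection.
apply: eq_integral => x _; rewrite /fubini_F /= E23.
apply: eq_integral => y _ /=.
by apply: (congr1 m3); apply/seteqP; split=> z /=; rewrite /xsection/= !inE/= ?inE.
Qed.

End mpres_constructions.

Section rotation.
Context {R : realType}.
Local Notation leb := (@lebesgue_measure R).

Lemma mpres_shift (a : R) : mpres leb leb (fun x : measurableTypeR R => x + a).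
Proof.
have mS : measurable_fun setT (fun x : measurableTypeR R => x + a).
  exact: measurable_funD.
split=> // A mA; apply/esym.
pose S (x : measurableTypeR R) : measurableTypeR R := x + a.
have := @lebesgue_measure_unique R (pushforward leb S); apply => //.
move=> X /ocitvP[->|[[x y] /= xy ->]]; first by rewrite !measure0.
rewrite /pushforward.
rewrite (_ : _ @^-1` _ = `]x - a, y - a]%classic); last first.
  by apply/seteqP; split=> z /=; rewrite !in_itv /= ltrBlDr lerBrDr.
by rewrite !lebesgue_measure_itv/= !lte_fin ltrD2r; case: ifP => // _; rewrite -!EFinB opprD addrACA subrr addr0.
Qed.

Lemma mpres_inv d1 d2 (X : measurableType d1) (Y : measurableType d2)
    (mu : set X -> \bar R) (nu : set Y -> \bar R) (f : X -> Y) (g : Y -> X) :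
  mpres mu nu f -> measurable_fun setT g -> cancel f g -> mpres nu mu g.
Proof.
move=> [mf E] mg fK; split=> // A mA; rewrite -E.
  by congr mu; apply/seteqP; split=> x /=; rewrite fK.
by rewrite -[X in measurable X]setTI; exact: mg.
Qed.

Definition swap23 {X Y Z : Type} (p : X * Y * Z) : X * Z * Y := (p.1.1, p.2, p.1.2).

Lemma mpres_swap23 d1 d2 d3 (X : measurableType d1) (Y : measurableType d2)
  (Z : measurableType d3)
  (m1 : {sigma_finite_measure set X -> \bar R})
   (m2 : {sigma_finite_measure set Y -> \bar R})
   (m3 : {sigma_finite_measure set Z -> \bar R})
   (m12 : {sigma_finite_measure set (X * Y)%type -> \bar R})
   (m13 : {sigma_finite_measure set (X * Z)%type -> \bar R})
   (m23 : {sigma_finite_measure set (Y * Z)%type -> \bar R})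
   (m32 : {sigma_finite_measure set (Z * Y)%type -> \bar R}) :
   m12 = (m1 \x m2)%E :> (_ -> _) -> m13 = (m1 \x m3)%E :> (_ -> _) ->
   m23 = (m2 \x m3)%E :> (_ -> _) -> m32 = (m3 \x m2)%E :> (_ -> _) ->
  mpres (m12 \x m3)%E (m13 \x m2)%E (@swap23 X Y Z).
Proof.
move=> E12 E13 E23 E32.
have a1 := mpres_assoc E12 E23.
have a2 := mpres_assoc E13 E32.
have a3 : mpres (m1 \x m32)%E (m13 \x m2)%E (fun p => (p.1, p.2.1, p.2.2)).
  apply: (mpres_inv a2); last by case=> [[]].
  by apply: measurable_fun_pair => //; [apply: measurable_fun_pair => //|]; apply: measurableT_comp.
have a4 : mpres (m1 \x m23)%E (m1 \x m32)%E (fun p => (p.1, (p.2.2, p.2.1))).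
  apply: (@mpres_skew _ _ _ _ _ _ _ _ _ _ (fun p : X * (Y * Z) => (p.2.2, p.2.1))).
    by apply: measurable_fun_pair => //; apply: measurableT_comp.
  by move=> x; rewrite E23 E32; exact: mpres_swap.
exact: (mpres_comp a1 (mpres_comp a4 a3)).
Qed.

(** Clockwise in the plane (v2, v3), the orientation of v x e1 = (0, v3, -v2). Keeping a pair (c, s)
    in place of an angle makes composition and the factorization into shears algebraic
    identities. *)
Definition rot (c s : R) (v : R3 R) : R3 R :=
  (v.1.1, c * v.1.2 + s * v.2, c * v.2 - s * v.1.2).

(* A rotation is a product of shears, which preserve Lebesgue measure by Fubini. *)
Definition shear_lo (a : R) (v : R3 R) : R3 R := (v.1.1, v.1.2, v.2 + a * v.1.2).

Definition shear_up (b : R) (v : R3 R) : R3 R := (v.1.1, v.1.2 + b * v.2, v.2).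

Local Notation leb3 := (@leb3 R).

Lemma mpres_shear_lo a : mpres leb3 leb3 (shear_lo a : mR3 R -> mR3 R).
Proof.
have -> : shear_lo a = (fun p : mR3 R => (p.1, p.2 + a * p.1.2)).
  by apply/funext => -[[]].
apply: (@mpres_skew _ _ _ _ _ _ _ leb2 leb leb (fun p : mR3 R => p.2 + a * p.1.2 : measurableTypeR R)).
  apply: measurable_funD => //; apply: measurable_funM => //.
  exact: measurableT_comp.
by move=> x; exact: (mpres_shift (a * x.2)).
Qed.

Lemma mpres_shear_up b : mpres leb3 leb3 (shear_up b : mR3 R -> mR3 R).
Proof.
(* The upper shear is the lower one conjugated by the exchange of v2 and v3. *)
have sw : mpres leb3 leb3 (@swap23 (measurableTypeR R) (measurableTypeR R) (measurableTypeR R)).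
  by apply: (@mpres_swap23 _ _ _ _ _ _ leb leb leb leb2 leb2 leb2 leb2).
exact: (mpres_comp sw (mpres_comp (mpres_shear_lo b) sw)).
Qed.

(** The classical three-shear factorization: [s / (1 + c)] is the tangent of the half angle, which
    is infinite exactly for the half turn. *)
Lemma rot_shear c s : c ^+ 2 + s ^+ 2 = 1 -> c != -1 ->
  rot c s = shear_up (s / (1 + c)) \o shear_lo (- s) \o shear_up (s / (1 + c)).
Proof.
move=> cs c1; have c10 : 1 + c != 0 by rewrite addrC addr_eq0.
apply/funext => -[[v1 v2] v3]; rewrite /rot /shear_lo /shear_up /=.
have E : s * (s / (1 + c)) = 1 - c.
  by apply: (mulIf c10); rewrite -mulrA divfK// -expr2; lra.
have E' : s / (1 + c) * c = s - s / (1 + c).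
  by apply: (mulIf c10); rewrite mulrBl mulrAC divfK//; lra.
set b := s / (1 + c) in E E' *.
congr (_, _, _); last by rewrite mulrDr mulrA !mulNr E; ring.
transitivity (v2 + b * v3 + (b * v3 - (s * b) * (v2 + b * v3))); last by ring.
rewrite E; transitivity (c * v2 + (b * c + b) * v3); last by ring.
by rewrite E'; ring.
Qed.

Lemma rot_comp c s c' s' v :
  rot c s (rot c' s' v) = rot (c * c' - s * s') (c * s' + s * c') v.
Proof. by rewrite /rot /=; congr (_, _, _); ring. Qed.

Lemma rot10 v : rot 1 0 v = v.
Proof. by case: v => [[? ?] ?]; rewrite /rot /= !mul1r !mul0r addr0 subr0. Qed.

Lemma mpres_rot c s : c ^+ 2 + s ^+ 2 = 1 ->
  mpres leb3 leb3 (rot c s : mR3 R -> mR3 R).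
Proof.
have H : forall c s, c ^+ 2 + s ^+ 2 = 1 -> c != -1 ->
    mpres leb3 leb3 (rot c s : mR3 R -> mR3 R).
  move=> {}c {}s cs c1; rewrite rot_shear//.
  exact: (mpres_comp (mpres_shear_up _) (mpres_comp (mpres_shear_lo _) (mpres_shear_up _))).
move=> cs; have [c1|] := eqVneq c (-1); last exact: H.
have s0 : s = 0 by move: cs; rewrite c1 sqrrN expr1n => /eqP; rewrite -subr_eq0 addrAC subrr add0r sqrf_eq0 => /eqP.
(* The half turn has no such factorization, but it is the square of a quarter turn. *)
have -> : rot c s = rot 0 1 \o rot 0 1.
  by apply/funext => v; rewrite /= rot_comp c1 s0; congr rot; ring.
have e01 : (0 : R) ^+ 2 + 1 ^+ 2 = 1 by rewrite expr0n expr1n add0r.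
have mp01 : mpres leb3 leb3 (rot 0 1 : mR3 R -> mR3 R).
  by apply: (H _ _ e01); rewrite eq_sym oppr_eq0 oner_eq0.
exact: (mpres_comp mp01 mp01).
Qed.

End rotation.

(** * Straightening the characteristics *)

Section straightening.
Context {R : realType}.
Local Notation leb := (@lebesgue_measure R).
Local Notation mR := (measurableTypeR R).

Definition leb7 : set (mR * mR6 R) -> \bar R := (leb \x @leb6 R)%E.
HB.instance Definition _ := Measure.on leb7.
HB.instance Definition _ := Measure_isSigmaFinite.Build _ _ _ leb7
  (product_measure1_sigma_finite _ _).

Let leb7' : set (mR6 R * mR) -> \bar R := (@leb6 R \x leb)%E.
HB.instance Definition _ := Measure.on leb7'.
HB.instance Definition _ := Measure_isSigmaFinite.Build _ _ _ leb7'
  (product_measure1_sigma_finite _ _).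

Definition sleb : set (mR * mR6 R * mR) -> \bar R := (leb7 \x leb)%E.
HB.instance Definition _ := Measure.on sleb.
HB.instance Definition _ := Measure_isSigmaFinite.Build _ _ _ sleb
  (product_measure1_sigma_finite _ _).

Definition larmor (tau : R) (v : R3 R) : R3 R :=
  rot (cos (2 * pi * tau)) (sin (2 * pi * tau)) v.

Lemma larmorK tau : cancel (larmor tau) (larmor (- tau)).
Proof.
move=> v; rewrite /larmor rot_comp mulrN cosN sinN.
rewrite -[RHS]rot10; congr rot; last by ring.
by rewrite mulNr opprK -!expr2 cos2Dsin2.
Qed.

Lemma larmorNK tau : cancel (larmor (- tau)) (larmor tau).
Proof. by move=> v; have := larmorK (- tau) v; rewrite opprK. Qed.

Lemma larmor0 v : larmor 0 v = v.
Proof. by rewrite /larmor mulr0 cos0 sin0 rot10. Qed.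

Lemma larmorD1 tau : larmor (tau + 1) = larmor tau.
Proof.
apply/funext => v; rewrite /larmor mulrDr mulr1.
by rewrite (_ : 2 * pi = pi *+ 2) ?mulr_natl// cosD2pi sinD2pi.
Qed.

Lemma measurable_cos : measurable_fun setT (@cos R).
Proof. by apply: continuous_measurable_fun; exact: continuous_cos. Qed.

Lemma measurable_sin : measurable_fun setT (@sin R).
Proof. by apply: continuous_measurable_fun; exact: continuous_sin. Qed.

Lemma measurable_larmor d (X : measurableType d) (f : X -> mR) (g : X -> mR3 R) :
  measurable_fun setT f -> measurable_fun setT g ->
  measurable_fun setT (fun x => larmor (f x) (g x) : mR3 R).
Proof.
move=> mf mg.
have m2f : measurable_fun setT (fun x => 2 * pi * f x : R).
  by apply: measurable_funM.
have mc := measurableT_comp measurable_cos m2f.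
have ms := measurableT_comp measurable_sin m2f.
have m1 : measurable_fun setT (fun x => (g x).1.1).
  by do 2 apply: measurableT_comp => //.
have m2 : measurable_fun setT (fun x => (g x).1.2).
  by do 2 apply: measurableT_comp => //.
have m3 : measurable_fun setT (fun x => (g x).2).
  by apply: measurableT_comp => //.
apply: measurable_fun_pair; [apply: measurable_fun_pair => //|].
  by apply: measurable_funD; apply: measurable_funM.
by apply: measurable_funB; apply: measurable_funM.
Qed.

(* The characteristics are the lines of the last factor: the point ((t, (x, w)), tau)
   stands for the velocity v = larmor tau w at the time tau. *)
Definition straight (q : mR * mR6 R * mR) : mkspace R :=
  ((q.1.1, q.2), (q.1.2.1, larmor q.2 q.1.2.2)).

Definition unstraight (p : mkspace R) : mR * mR6 R * mR :=
  ((p.1.1, (p.2.1, larmor (- p.1.2) p.2.2)), p.1.2).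

Lemma straightK : cancel straight unstraight.
Proof. by move=> -[[t [x w]] tau]; rewrite /unstraight /straight/= larmorK. Qed.

Lemma unstraightK : cancel unstraight straight.
Proof. by move=> -[[t tau] [x w]]; rewrite /unstraight /straight/= larmorNK. Qed.

Lemma measurable_unstraight : measurable_fun setT unstraight.
Proof.
apply: measurable_fun_pair; last by apply: measurableT_comp.
apply: measurable_fun_pair; first by apply: measurableT_comp.
apply: measurable_fun_pair; first by apply: measurableT_comp.
apply: measurable_larmor; last by apply: measurableT_comp.
by apply: measurableT_comp => //; apply: measurableT_comp.
Qed.

Lemma mpres_larmor6 tau : mpres (@leb6 R) (@leb6 R)
  (fun z : mR6 R => (z.1, larmor tau z.2)).
Proof.
apply: (@mpres_skew _ _ _ _ _ _ _ leb3 leb3 leb3 (fun z : mR6 R => larmor tau z.2 : mR3 R)).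
  by apply: measurable_larmor.
by move=> x; apply: mpres_rot; exact: cos2Dsin2.
Qed.

(** A permutation of the coordinates brings tau next to t; what remains is a rotation of v depending
    on tau, a skew product over (t, tau). *)
Lemma mpres_straight : mpres sleb (@leb8 R) straight.
Proof.
have s1 : mpres sleb (@leb8 R) (@swap23 mR (mR6 R) mR).
  by apply: (@mpres_swap23 _ _ _ _ _ _ _ leb leb6 leb leb7 leb2 leb7' leb7).
have s2 : mpres (@leb8 R) (@leb8 R)
    (fun p => (p.1, (p.2.1, larmor p.1.2 p.2.2))).
  apply: (@mpres_skew _ _ _ _ _ _ _ leb2 leb6 leb6 (fun p : mkspace R => (p.2.1, larmor p.1.2 p.2.2) : mR6 R)).
    apply: measurable_fun_pair; first by apply: measurableT_comp.
    by apply: measurable_larmor; apply: measurableT_comp.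
  by move=> x; exact: (mpres_larmor6 x.2).
exact: (mpres_comp s1 s2).
Qed.

Lemma mpres_unstraight : mpres (@leb8 R) sleb unstraight.
Proof.
exact: mpres_inv mpres_straight measurable_unstraight straightK.
Qed.

End straightening.

(** * Integrals with a parameter and bounded kernels *)

Section Rintegral_parameter.
Context d1 d2 (X : measurableType d1) (Y : measurableType d2) (R : realType).
Variables (m1 : {sigma_finite_measure set X -> \bar R}).
Variables (m2 : {sigma_finite_measure set Y -> \bar R}).

(** The integrals of the positive and negative parts are measurable by Tonelli, hence so is [fine]
    of their difference. Sections where the integral diverges are covered, so averages along fibres
    are measurable everywhere, without an exceptional set. *)
Lemma measurable_fun_Rintegral (g : X * Y -> R) : measurable_fun setT g ->
  measurable_fun setT (fun x => \int[m2]_y g (x, y)).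
Proof.
move=> mg; have mG : measurable_fun setT (EFin \o g) by exact/measurable_EFinP.
apply: measurableT_comp => //; under eq_fun do rewrite integralE.
apply: emeasurable_funB.
- rewrite (_ : (fun x => _) = fubini_F m2 ((EFin \o g)^\+%E)); last first.
    by apply/funext => x; apply: eq_integral => y _; rewrite !funeposE.
  apply: measurable_fun_fubini_tonelli_F => //.
  exact: measurable_funepos.
- rewrite (_ : (fun x => _) = fubini_F m2 ((EFin \o g)^\-%E)); last first.
    by apply/funext => x; apply: eq_integral => y _; rewrite !funenegE.
  apply: measurable_fun_fubini_tonelli_F => //.
  exact: measurable_funeneg.
Qed.

Lemma EFin_Rintegral (f : Y -> R) : m2.-integrable setT (EFin \o f) ->
  ((\int[m2]_y f y)%:E = \int[m2]_y (f y)%:E)%E.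
Proof. by move=> fi; rewrite fineK//; exact: integrable_fin_num. Qed.

Lemma integrable_bounded_mul (C : R) (k f : Y -> R) : measurable_fun setT k ->
  (forall y, `|k y| <= C) -> m2.-integrable setT (EFin \o f) ->
  m2.-integrable setT (EFin \o (fun y => k y * f y)).
Proof.
move=> mk kC fi; have mf : measurable_fun setT f.
  by apply/measurable_EFinP; exact: measurable_int fi.
apply: (le_integrable measurableT _ _ (integrableZl measurableT C fi)).
  by apply/measurable_EFinP; exact: measurable_funM.
move=> y _ /=; rewrite lee_fin !normrM ler_wpM2r//.
by rewrite (le_trans (kC y))// ler_norm.
Qed.

End Rintegral_parameter.

Section fubini_kernel.
Context d1 d2 (X : measurableType d1) (Y : measurableType d2) (R : realType).
Variables (m1 : {sigma_finite_measure set X -> \bar R}).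
Variables (m2 : {sigma_finite_measure set Y -> \bar R}).

(** The integrand is dominated by C |f(y)| |g(x)|, whose double integral factorizes, so Fubini
    applies. This transposes a bounded kernel from f to g. *)
Lemma fubini_kernel (C : R) (k : X -> Y -> R) (f : Y -> R) (g : X -> R) :
  measurable_fun setT (fun p : X * Y => k p.1 p.2) ->
  0 <= C -> (forall x y, `|k x y| <= C) ->
  m2.-integrable setT (EFin \o f) -> m1.-integrable setT (EFin \o g) ->
  \int[m1]_x ((\int[m2]_y (k x y * f y)) * g x) =
  \int[m2]_y (f y * \int[m1]_x (k x y * g x)).
Proof.
move=> mk C0 kC fi gi.
have mf : measurable_fun setT f by apply/measurable_EFinP; exact: measurable_int fi.
have mg : measurable_fun setT g by apply/measurable_EFinP; exact: measurable_int gi.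
pose h (p : X * Y) := k p.1 p.2 * f p.2 * g p.1.
have mh : measurable_fun setT h.
  by apply: measurable_funM; [apply: measurable_funM => //|]; exact: measurableT_comp.
have mkx x : measurable_fun setT (k x).
  exact: (measurableT_comp mk (pair1_measurable x)).
have mky y : measurable_fun setT (k ^~ y).
  exact: (measurableT_comp mk (pair2_measurable y)).
have ix x : m2.-integrable setT (EFin \o (fun y => k x y * f y)).
  exact: (integrable_bounded_mul _ (kC x)).
have iy y : m1.-integrable setT (EFin \o (fun x => k x y * g x)).
  exact: (integrable_bounded_mul _ (kC ^~ y)).
have hi : (m1 \x m2)%E.-integrable setT (EFin \o h).
  apply/integrable12ltyP; first exact/measurable_EFinP.
  apply: (@le_lt_trans _ _ (\int[m1]_x ((C * fine (\int[m2]_y `|(f y)%:E|)) * `|g x|)%:E)%E); last first.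
    apply: integrable_lty => //.
    have W := (integrableZl measurableT (C * fine (\int[m2]_y `|(f y)%:E|)%E) (integrable_norm gi)). exact: W.
  apply: ge0_le_integral => //.
  - by move=> x _; exact: integral_ge0.
  - apply: (@measurable_fun_fubini_tonelli_F _ _ _ _ _ m2 (abse \o (EFin \o h))).
      by apply: measurableT_comp => //; exact/measurable_EFinP.
    by move=> p; rewrite abse_ge0.
  - by apply/measurable_EFinP; apply: measurable_funM => //; exact: measurableT_comp.
  move=> x _.
  have afi : m2.-integrable setT (fun y => `|(f y)%:E|)%E := integrable_abse fi.
  rewrite EFinM EFinM fineK; last exact: (integrable_fin_num measurableT afi).
  rewrite -(integralZl measurableT afi) muleC -(integralZl measurableT (integrableZl measurableT C afi)).
  apply: ge0_le_integral => //.
  - by apply/measurable_EFinP; do 2 apply: measurableT_comp => //; apply: measurableT_comp.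
  - by apply/measurable_EFinP; do ! apply: measurable_funM => //; exact: measurableT_comp.
  move=> y _; rewrite /= lee_fin /h/= !normrM mulrC ler_wpM2l// ler_wpM2r//.
have := Fubini hi => /= E.
rewrite /Rintegral; congr fine.
transitivity (\int[m1]_x \int[m2]_y (h (x, y))%:E)%E.
  apply: eq_integral => x _; rewrite EFinM EFin_Rintegral// -integralZr//; exact: ix.
rewrite E; apply: eq_integral => y _; rewrite EFinM EFin_Rintegral// -integralZl//; last exact: iy.
by apply: eq_integral => x _; rewrite /h/= -EFinM; congr EFin; ring.
Qed.

End fubini_kernel.

(** * Periodic primitives *)

Section period_kernel.
Context {R : realType}.
Local Notation leb := (@lebesgue_measure R).
Local Notation I := (`]0%R, 1%R[%classic : set R).

Definition fracpart (tau : R) : R := tau - (Num.floor tau)%:~R.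

(* [fun tau => \int[leb]_(s in `]0, 1[) kern tau s * F s] is the 1-periodic primitive of
   [F] minus its mean, vanishing at the integers. *)
Definition kern (tau s : R) : R := (s < fracpart tau)%R%:R - fracpart tau.

Lemma fracpart_ge0 tau : 0 <= fracpart tau.
Proof. by rewrite /fracpart subr_ge0 floor_le. Qed.

Lemma fracpart_lt1 tau : fracpart tau < 1.
Proof. by rewrite /fracpart ltrBlDr addrC -intrD1 floorD1_gt. Qed.

Lemma fracpartD1 tau : fracpart (tau + 1) = fracpart tau.
Proof. by rewrite /fracpart floorDrz// floor1 intrD opprD addrACA subrr addr0. Qed.

Lemma fracpart_id tau : I tau -> fracpart tau = tau.
Proof.
rewrite /= in_itv /= => /andP[t0 t1]; rewrite /fracpart.
by rewrite (@floor_def _ _ 0) ?subr0// ltW.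
Qed.

Lemma kern_le1 tau s : `|kern tau s| <= 1.
Proof.
have f0 := fracpart_ge0 tau; have f1 := fracpart_lt1 tau.
by rewrite /kern ler_norml; case: (s < _)%R; rewrite ?mulr1n ?mulr0n; lra.
Qed.

Lemma measurable_fracpart : measurable_fun setT fracpart.
Proof.
apply: measurable_funB => //.
apply: nondecreasing_measurable => // x y xy.
by rewrite ler_int; exact: Num.Theory.le_floor.
Qed.

Lemma measurable_kern :
  measurable_fun setT (fun p : measurableTypeR R * measurableTypeR R => kern p.1 p.2).
Proof.
have mf : measurable_fun setT (fun p : measurableTypeR R * measurableTypeR R => fracpart p.1).
  exact: (measurableT_comp measurable_fracpart).
apply: measurable_funB => //.
rewrite (_ : (fun _ => _) = (fun p => if p.2 < fracpart p.1 then 1 else 0)); last first.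
  by apply/funext => p; case: ifP.
apply: measurable_fun_ifT => //.
exact: measurable_fun_ltr.
Qed.

Lemma continuous_integrable_itv (f : R -> R) a b : continuous f ->
  leb.-integrable `[a, b] (EFin \o f).
Proof.
move=> cf; apply: continuous_compact_integrable; first exact: segment_compact.
exact: continuous_subspaceT.
Qed.

Lemma Rintegral_oo_cc (f : R -> R) a b : continuous f ->
  \int[leb]_(x in `]a, b[) f x = \int[leb]_(x in `[a, b]) f x.
Proof.
move=> cf.
rewrite Rintegral_itv_bndo_bndc; last first.
  by apply: (integrableS _ _ _ (continuous_integrable_itv a b cf)) => //; exact: subset_itv_oo_cc.
rewrite Rintegral_itv_obnd_cbnd//.
by apply: (integrableS _ _ _ (continuous_integrable_itv a b cf)) => //; exact: subset_itv_oc_cc.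
Qed.

Section ftc.
Variables (P P' : R -> R).
Hypothesis dP : forall x : R, is_derive x 1 P (P' x).
Hypothesis cP' : continuous P'.

Lemma continuous_primitive : continuous P.
Proof.
by move=> x; apply/differentiable_continuous/derivable1_diffP; exact: (@ex_derive _ _ _ _ _ _ _ (dP x)).
Qed.

Lemma Rintegral_derivative a b : a < b ->
  \int[leb]_(x in `]a, b[) P' x = P b - P a.
Proof.
move=> ab; rewrite Rintegral_oo_cc// /Rintegral (continuous_FTC2 (F := P))//.
- exact: continuous_subspaceT.
- split => //.
  + exact/cvg_at_right_filter/continuous_primitive.
  + exact/cvg_at_left_filter/continuous_primitive.
- by move=> x _; rewrite derive1E; exact: derive_val.
Qed.

End ftc.

(** On the period the kernel is the indicator of s < tau minus tau. The first term gives P 1 - P s;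
    the second, by parts, gives P 1 minus the mean of P. The two boundary values cancel. *)
Lemma Rintegral_kern (P P' : R -> R) (s : R) :
  (forall x : R, is_derive x 1 P (P' x)) -> continuous P' -> I s ->
  \int[leb]_tau (kern tau s * (P' tau * \1_I tau)) = \int[leb]_(x in I) P x - P s.
Proof.
move=> dP cP' Is.
have cP := continuous_primitive dP.
have icc (f : R -> R) : continuous f -> leb.-integrable I (EFin \o f).
  by move=> cf; apply: (integrableS _ _ _ (continuous_integrable_itv 0 1 cf)) => //; exact: subset_itv_oo_cc.
transitivity (\int[leb]_(tau in I) (P' tau * \1_`]s, +oo[ tau - tau * P' tau)).
  rewrite [RHS]Rintegral_mkcond; apply: eq_Rintegral => tau _.
  rewrite patchE indicE; case: (boolP (tau \in I)) => tI; last by rewrite !mulr0.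
  rewrite /kern fracpart_id; last by rewrite inE in tI.
  rewrite indicE (_ : (tau \in _) = (s < tau)) ?mulr1; last first.
    by apply/idP/idP; rewrite inE/= in_itv/= andbT.
  ring.
have ctP : continuous (fun tau : R => tau * P' tau) by move=> x; apply: cvgM => //; exact: cP'.
rewrite RintegralB//; [|apply: (le_integrable _ _ _ (icc _ cP'))|exact: icc] => //; first last.
- move=> x _; rewrite /= lee_fin normrM ler_piMr// indicE ger0_norm//.
  by case: (_ \in _).
- apply/measurable_EFinP/measurable_funTS/measurable_funM => //.
  exact: continuous_measurable_fun.
have -> : \int[leb]_(x in I) (P' x * \1_`]s, +oo[ x) = P 1 - P s.
  rewrite -(Rintegral_derivative dP cP'); last by move: Is; rewrite /= in_itv => /andP[].
  rewrite (_ : `]s, 1[%classic = I `&` `]s, +oo[); last first.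
    apply/seteqP; split => x /=; rewrite !in_itv/= ?andbT.
      by move: Is; rewrite /= in_itv/= => /andP[? ?] /andP[? ?]; split => //; apply/andP; split => //; lra.
    by move=> [/andP[_ ->] ->].
  rewrite Rintegral_mkcondr; apply: eq_Rintegral => x _.
  by rewrite patchE indicE; case: ifP => _; rewrite ?mulr1 ?mulr0.
have dtP : forall x : R, is_derive x 1 (fun x : R => x * P x) (P x + x * P' x).
  move=> x; have := is_deriveM (is_derive_id x 1) (dP x).
  by move=> h; apply: (is_derive_eq h); rewrite /GRing.scale/=; ring.
have cd : continuous (fun x : R => P x + x * P' x).
  by move=> x; apply: cvgD; [exact: cP|exact: ctP].
have := Rintegral_derivative dtP cd (@ltr01 R).
rewrite RintegralD//; [|exact: icc|exact: icc].
by rewrite mul1r mul0r subr0 => <-; ring.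
Qed.

(** This says weakly that the kernel integral of F has derivative F minus its mean. Fubini moves the
    kernel onto P', where [Rintegral_kern] evaluates it; the mean of P, multiplied by the integral
    of F, becomes the mean of F multiplied by the integral of P. *)
Lemma integral_kern_weak (F P P' : R -> R) :
  leb.-integrable setT (EFin \o F) -> (forall s, ~ I s -> F s = 0) ->
  (forall x : R, is_derive x 1 P (P' x)) -> continuous P' ->
  \int[leb]_tau ((\int[leb]_s (kern tau s * F s)) * (P' tau * \1_I tau)) =
  - \int[leb]_s ((F s - \1_I s * \int[leb]_x F x) * P s).
Proof.
move=> iF F0 dP cP'; have cP := continuous_primitive dP.
have icc (f : R -> R) : continuous f -> leb.-integrable I (EFin \o f).
  by move=> cf; apply: (integrableS _ _ _ (continuous_integrable_itv 0 1 cf)) => //; exact: subset_itv_oo_cc.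
have icc1 (f : R -> R) : continuous f -> leb.-integrable setT (EFin \o (fun x => f x * \1_I x)).
  move=> cf; have /integrable_mkcond := icc _ cf => /(_ (measurable_itv _)).
  apply: eq_integrable => // x _; rewrite /= patchE indicE.
  by case: ifP; rewrite ?mulr1 ?mulr0.
rewrite (fubini_kernel (C := 1) (m1 := leb) (m2 := leb) measurable_kern ler01 kern_le1)//; last exact: icc1.
have iFP : leb.-integrable setT (EFin \o (fun s => F s * P s)).
  (* P may be unbounded on the line, but F lives on the period, so the maximum of |P| on [0, 1] is
     enough. *)
  have cnP : {within `[0, 1], continuous (fun x => `|P x|)}.
    by apply: continuous_subspaceT => x; apply: cvg_norm; exact: cP.
  have [c _ Pc] := EVT_max (@ler01 R) cnP.
  have mP1 : measurable_fun setT (fun x => P x * \1_I x).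
    by apply: measurable_funM => //; exact: continuous_measurable_fun.
  have B x : `|P x * \1_I x| <= `|P c|.
    rewrite indicE; case: (boolP (x \in I)) => xI; last by rewrite mulr0 normr0.
    by rewrite mulr1; apply: Pc; rewrite inE in xI; exact: subset_itv_oo_cc.
  have W := integrable_bounded_mul (m2 := leb) mP1 B iF.
  apply: (eq_integrable measurableT _ _ _ W) => x _ /=.
  have [Ix|nIx] := pselect (I x); last by rewrite F0// mulr0 mul0r.
  by rewrite indicE mem_set// mulr1 mulrC.
transitivity (\int[leb]_s ((\int[leb]_(x in I) P x) * F s - F s * P s)).
  apply: eq_Rintegral => s _.
  case: (pselect (I s)) => [Is|nIs]; last by rewrite F0// !mul0r mulr0 subr0.
  by rewrite Rintegral_kern//; ring.
have -> : \int[leb]_s ((F s - \1_I s * \int[leb]_x F x) * P s) =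
   \int[leb]_s (F s * P s - (\int[leb]_x F x) * (P s * \1_I s)).
  by apply: eq_Rintegral => s _; ring.
rewrite RintegralB//; last exact: (integrableZl measurableT _ iF).
rewrite RintegralB//; last exact: (integrableZl measurableT _ (icc1 _ cP)).
rewrite !RintegralZl//; last exact: icc1.
rewrite [in LHS]Rintegral_mkcond.
have -> : (fun x => P x * \1_I x) = P \_ I.
  by apply/funext => x; rewrite patchE indicE; case: ifP; rewrite ?mulr1 ?mulr0.
ring.
Qed.

Lemma integral_mean_weak (c : R) (P P' : R -> R) :
  (forall x : R, is_derive x 1 P (P' x)) -> continuous P' -> P 1 = P 0 ->
  \int[leb]_tau (c * (P' tau * \1_I tau)) = 0.
Proof.
move=> dP cP' P10.
have icc : leb.-integrable I (EFin \o P').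
  by apply: (integrableS _ _ _ (continuous_integrable_itv 0 1 cP')) => //; exact: subset_itv_oo_cc.
transitivity (\int[leb]_(tau in I) (c * P' tau)).
  rewrite [RHS]Rintegral_mkcond; apply: eq_Rintegral => x _.
  by rewrite patchE indicE; case: ifP; rewrite ?mulr1 ?mulr0.
by rewrite RintegralZl// Rintegral_derivative// P10 subrr mulr0.
Qed.

End period_kernel.

(** * Square integrability and averages along the fibres *)

Section square_integrable.
Context d (X : measurableType d) (R : realType).
Variable mu : {measure set X -> \bar R}.

Lemma le_norm_sq (a : R) : `|a| <= 1 + a ^+ 2.
Proof. by rewrite -real_normK ?num_real//; have := sqr_ge0 (`|a| - 1); nra. Qed.

(** On a set of finite measure the bound |f| <= 1 + f^2 gives integrability. Pairings of elements of
    the space with test functions are integrable for this reason. *)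
Lemma square_integrable_mul (C : R) (A : set X) (f g : X -> R) :
  measurable A -> (mu A < +oo)%E ->
  measurable_fun setT f -> (\int[mu]_x (f x ^+ 2)%:E < +oo)%E ->
  measurable_fun setT g -> 0 <= C -> (forall x, `|g x| <= C * \1_A x) ->
  mu.-integrable setT (EFin \o (fun x => f x * g x)).
Proof.
move=> mA Aoo mf foo mg C0 gC.
have if2 : mu.-integrable setT (EFin \o (fun x => f x ^+ 2)).
  apply/integrableP; split; first by apply/measurable_EFinP; exact: measurable_funX.
  by under eq_integral do rewrite gee0_abs ?lee_fin ?sqr_ge0//.
have i1 : mu.-integrable setT (EFin \o \1_A).
  apply/integrableP; split; first by apply/measurable_EFinP.
  under eq_integral do rewrite gee0_abs ?lee_fin//.
  by rewrite integral_indic// setIT.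
apply: (le_integrable measurableT _ _ (integrableZl measurableT C (integrableD measurableT i1 if2))).
  by apply/measurable_EFinP; exact: measurable_funM.
move=> x _ /=; rewrite lee_fin normrM.
have h0 : 0 <= C * (\1_A x + f x ^+ 2) by rewrite mulr_ge0// addr_ge0// sqr_ge0.
rewrite (ger0_norm h0).
apply: (le_trans (ler_wpM2l (normr_ge0 _) (gC x))).
rewrite mulrCA ler_wpM2l//.
have := le_norm_sq (f x); rewrite indicE; case: (_ \in _) => /= h.
  by rewrite mulr1.
by rewrite mulr0 add0r sqr_ge0.
Qed.

End square_integrable.

Section period_average.
Context d (Y : measurableType d) (R : realType).
Variable m : {sigma_finite_measure set Y -> \bar R}.
Local Notation leb := (@lebesgue_measure R).
Local Notation mR := (measurableTypeR R).
Local Notation I := (`]0%R, 1%R[%classic : set R).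

Let leb_I : leb I = 1%E.
Proof. by rewrite lebesgue_measure_itv/= lte_fin ltr01 oppr0 adde0. Qed.

Lemma le_sq_Rintegral (k f : R -> R) : measurable_fun setT k ->
  measurable_fun setT f -> (forall s, `|k s| <= 1) -> (forall s, ~ I s -> f s = 0) ->
  (((\int[leb]_s (k s * f s)) ^+ 2)%:E <= \int[leb]_s (f s ^+ 2)%:E)%E.
Proof.
move=> mk mf k1 f0.
have [foo|] := ltP (\int[leb]_s (f s ^+ 2)%:E)%E +oo%E; last first.
  by rewrite leye_eq => /eqP ->; rewrite leey.
have if2 : leb.-integrable setT (EFin \o (fun x => f x ^+ 2)).
  apply/integrableP; split; first by apply/measurable_EFinP; exact: measurable_funX.
  by under eq_integral do rewrite gee0_abs ?lee_fin ?sqr_ge0//.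
have mI : measurable I by exact: measurable_itv.
have iI : leb.-integrable setT (EFin \o \1_I) by exact: integrable_indic_itv.
have ifn : leb.-integrable setT (EFin \o (fun x => f x * \1_I x)).
  have I1 (x : mR) : `|\1_I x : R| <= 1 * \1_I x by rewrite ger0_norm// mul1r.
  have Ioo : (leb I < +oo)%E by rewrite leb_I ltry.
  exact: (@square_integrable_mul _ mR R leb 1 I f \1_I mI Ioo mf foo _ ler01 I1).
have fI x : f x * \1_I x = f x.
  rewrite indicE; have [Ix|nIx] := pselect (I x); last by rewrite f0// mul0r.
  by rewrite mem_set// mulr1.
have if1 : leb.-integrable setT (EFin \o f).
  by apply: (eq_integrable measurableT _ _ _ ifn) => x _; rewrite /= fI.
have ikf : leb.-integrable setT (EFin \o (fun s => k s * f s)).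
  exact: (integrable_bounded_mul (m2 := leb) mk k1 if1).
set c := \int[leb]_s `|f s|.
have c0 : 0 <= c by apply: Rintegral_ge0.
have ck : `|\int[leb]_s (k s * f s)| <= c.
  apply: le_trans (le_normr_Rintegral measurableT ikf) _.
  apply: le_Rintegral => //.
  - exact: (integrable_norm ikf).
  - exact: (integrable_norm if1).
  by move=> x _; rewrite normrM ler_piMl.
apply: (@le_trans _ _ (c ^+ 2)%:E).
  by rewrite lee_fin -(@real_normK _ (\int[leb]_s (k s * f s))) ?num_real// lerXn2r// nnegrE.
rewrite -(@EFin_Rintegral _ _ _ leb)// lee_fin.
(* Cauchy-Schwarz on an interval of length 1: with c the integral of |f|, integrating 2 c |f| <= f^2
   + c^2 gives 2 c^2 <= (integral of f^2) + c^2. *)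
have : \int[leb]_s ((2 * c) * `|f s|) <= \int[leb]_s (f s ^+ 2 + c ^+ 2 * \1_I s).
  apply: le_Rintegral => //.
  - exact: (integrableZl measurableT (2 * c) (integrable_norm if1)).
  - exact: (integrableD measurableT if2 (integrableZl measurableT (c ^+ 2) iI)).
  move=> x _; rewrite indicE; have [Ix|nIx] := pselect (I x).
    rewrite mem_set// mulr1 -(@real_normK _ (f x)) ?num_real//.
    by have := sqr_ge0 (`|f x| - c); nra.
  by rewrite memNset// f0// normr0 mulr0 mulr0 addr0 sqr_ge0.
rewrite RintegralZl//; last exact: (integrable_norm if1).
rewrite RintegralD//; last exact: (integrableZl measurableT (c ^+ 2) iI).
rewrite RintegralZl// -/c.
have -> : \int[leb]_x \1_I x = 1.
  rewrite /Rintegral (integral_indic leb measurableT mI) setIT.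
  by rewrite [X in fine X]leb_I.
by lra.
Qed.

(** Carries identities proved on a single characteristic over to the whole strip. *)
Lemma Rintegral_prod_ae_eq (h1 h2 : Y * mR -> R) :
  (m \x leb)%E.-integrable setT (EFin \o h1) ->
  (m \x leb)%E.-integrable setT (EFin \o h2) ->
  (\forall y \ae m, \int[leb]_t h1 (y, t) = \int[leb]_t h2 (y, t)) ->
  \int[(m \x leb)%E]_q h1 q = \int[(m \x leb)%E]_q h2 q.
Proof.
move=> i1 i2 E; rewrite /Rintegral; congr fine.
rewrite -[LHS](integral12_prod_meas1 i1) -[RHS](integral12_prod_meas1 i2).
apply: ae_eq_integral ; [by []|exact: measurable_fubini_F i1|exact: measurable_fubini_F i2|].
have a1 := ae_integrable1 i1; have a2 := ae_integrable1 i2.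
apply: filterS3 a1 a2 E => y j1 j2 Ey _.
rewrite /fubini_F.
have := @EFin_Rintegral _ _ _ leb (fun t => h1 (y, t)) j1 => /= <-.
by have := @EFin_Rintegral _ _ _ leb (fun t => h2 (y, t)) j2 => /= <-; rewrite Ey.
Qed.

Lemma leb_strip (K : set Y) : measurable K -> (m K < +oo)%E ->
  measurable (K `*` I) /\ ((m \x leb) (K `*` I) < +oo)%E.
Proof.
move=> mK Koo; have mI : measurable (I : set mR) by exact: measurable_itv.
split; first exact: measurableX.
by rewrite product_measure1E// [X in (_ * X)%E]leb_I mule1.
Qed.

Lemma indic_strip (K : set Y) y (t : mR) :
  \1_(K `*` I) (y, t) = \1_K y * \1_I t :> R.
Proof. by rewrite !indicE in_setX /=; case: (_ \in _); case: (_ \in _); rewrite ?(mulr1, mulr0). Qed.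

Section weak_identities.
Variable F : Y * mR -> R.
Hypothesis mF : measurable_fun setT F.
Hypothesis F0 : forall y s, ~ I s -> F (y, s) = 0.
Hypothesis Foo : (\int[(m \x leb)%E]_q (F q ^+ 2)%:E < +oo)%E.

(** One operator for both halves of the decomposition: the constant kernel 1 gives the mean, [kern]
    gives the primitive. *)
Definition kavg (k : R -> R -> R) (q : Y * mR) : R :=
  \int[leb]_s (k q.2 s * F (q.1, s)).

Section kernel.
Variable k : R -> R -> R.
Hypothesis mk : measurable_fun setT (fun p : mR * mR => k p.1 p.2).
Hypothesis k1 : forall t s, `|k t s| <= 1.

Lemma measurable_kavg : measurable_fun setT (kavg k).
Proof.
apply: (@measurable_fun_Rintegral _ _ _ mR R leb (fun p : (Y * mR) * mR => k p.1.2 p.2 * F (p.1.1, p.2))).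
apply: measurable_funM.
  apply: (measurableT_comp mk (g := fun p : (Y * mR) * mR => (p.1.2, p.2))).
  by apply: measurable_fun_pair => //; apply: measurableT_comp.
apply: (measurableT_comp mF (g := fun p : (Y * mR) * mR => (p.1.1, p.2))).
by apply: measurable_fun_pair => //; apply: measurableT_comp.
Qed.

(** The right-hand side does not depend on t: an L2 bound over the period becomes a bound at every
    time, as the L-infinity norm in tau demands. *)
Lemma le_sq_kavg y t : ((kavg k (y, t) ^+ 2)%:E <= \int[leb]_s (F (y, s) ^+ 2)%:E)%E.
Proof.
apply: le_sq_Rintegral => //.
- exact: (measurableT_comp mk (pair1_measurable t)).
- exact: (measurableT_comp mF (pair1_measurable y)).
- by move=> s; exact: F0.
Qed.

Lemma kavg_sq_lty : (\int[(m \x leb)%E]_q ((kavg k q * \1_I q.2) ^+ 2)%:E < +oo)%E.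
Proof.
have mI : measurable (I : set mR) by exact: measurable_itv.
have mF2 : measurable_fun setT (fun q => (F q ^+ 2)%:E).
  by apply/measurable_EFinP; exact: measurable_funX.
apply: le_lt_trans Foo.
rewrite fubini_tonelli1//; last 2 first.
- apply/measurable_EFinP; apply: measurable_funX; apply: measurable_funM.
    exact: measurable_kavg.
  exact: (measurableT_comp (measurable_indic mI)).
- by move=> q; rewrite lee_fin sqr_ge0.
rewrite fubini_tonelli1//; last by move=> q; rewrite lee_fin sqr_ge0.
rewrite /fubini_F.
have mg : measurable_fun setT (fun y => \int[leb]_s (F (y, s) ^+ 2)%:E)%E.
  apply: (@measurable_fun_fubini_tonelli_F _ _ Y mR R leb (fun q => (F q ^+ 2)%:E)) => //.
  by move=> q; rewrite lee_fin sqr_ge0.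
apply: ge0_le_integral => //.
- by move=> y _; apply: integral_ge0 => t _; rewrite lee_fin sqr_ge0.
- apply: (@measurable_fun_fubini_tonelli_F _ _ Y mR R leb (fun q => ((kavg k q * \1_I q.2) ^+ 2)%:E)).
    apply/measurable_EFinP; apply: measurable_funX; apply: measurable_funM.
      exact: measurable_kavg.
    exact: (measurableT_comp (measurable_indic mI)).
  by move=> q; rewrite lee_fin sqr_ge0.
move=> y _; set c := (X in (_ <= X)%E).
have c0 : (0 <= c)%E by apply: integral_ge0 => s _; rewrite lee_fin sqr_ge0.
apply: (@le_trans _ _ (\int[leb]_t (c * (\1_I t)%:E))%E).
  apply: ge0_le_integral => //.
  - by move=> t _; rewrite lee_fin sqr_ge0.
  - apply/measurable_EFinP; apply: measurable_funX; apply: measurable_funM.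
      exact: (measurableT_comp measurable_kavg (pair1_measurable y)).
    exact: measurable_indic.
  - by apply: emeasurable_funM => //; apply/measurable_EFinP; exact: measurable_indic.
  move=> t _ /=; rewrite exprMn EFinM.
  have -> : \1_I t ^+ 2 = \1_I t :> R by rewrite indicE; case: (_ \in _); rewrite ?expr1n ?expr0n.
  by apply: lee_wpmul2r; [rewrite lee_fin|exact: le_sq_kavg].
rewrite ge0_integralZl//; first by rewrite (integral_indic leb measurableT mI) setIT [X in (_ * X)%E]leb_I mule1.
by apply/measurable_EFinP; exact: measurable_indic.
Qed.

End kernel.

Variables (P P' : Y * mR -> R) (K : set Y) (C : R).
Hypothesis mP : measurable_fun setT P.
Hypothesis mP' : measurable_fun setT P'.
Hypothesis dP : forall y (t : R), is_derive t (1:R) (fun t : R => P (y, t)) (P' (y, t)).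
Hypothesis cP' : forall y, continuous (fun t : R => P' (y, t)).
Hypothesis mK : measurable K.
Hypothesis Koo : (m K < +oo)%E.
Hypothesis C0 : 0 <= C.
Hypothesis PC : forall y t, I t -> `|P (y, t)| <= C * \1_K y.
Hypothesis P'C : forall y t, I t -> `|P' (y, t)| <= C * \1_K y.

Lemma strip_integrable (f g : Y * mR -> R) :
  measurable_fun setT f -> measurable_fun setT g ->
  (\int[(m \x leb)%E]_q ((f q * \1_I q.2) ^+ 2)%:E < +oo)%E ->
  (forall y t, I t -> `|g (y, t)| <= C * \1_K y) ->
  (m \x leb)%E.-integrable setT (EFin \o (fun q => f q * (g q * \1_I q.2))).
Proof.
move=> mf mg f2 gC.
have mI : measurable (I : set mR) by exact: measurable_itv.
have mI2 : measurable_fun setT (fun q : Y * mR => \1_I q.2 : R).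
  exact: (measurableT_comp (measurable_indic mI)).
have [mKI KIoo] := leb_strip mK Koo.
have B q : `|g q * \1_I q.2| <= C * \1_(K `*` I) q.
  case: q => y t; rewrite indic_strip normrM mulrA /= (@ger0_norm _ (\1_I t))//.
  rewrite indicE; have [It|nIt] := pselect (I t); last by rewrite memNset// !mulr0.
  by rewrite ler_wpM2r//; exact: gC.
have := square_integrable_mul (mu := (m \x leb)%E) mKI KIoo (measurable_funM mf mI2) f2 (measurable_funM mg mI2) C0 B.
apply: eq_integrable => // q _ /=; congr EFin.
have -> : \1_I q.2 = \1_I q.2 * \1_I q.2 :> R by rewrite indicE; case: (_ \in _); rewrite ?mulr1 ?mulr0.
by rewrite indicE; case: (_ \in _); rewrite ?(mulr1, mulr0, mul0r).
Qed.

Let aeF : \forall y \ae m, leb.-integrable setT (fun s => (F (y, s))%:E).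
Proof.
have iF2 : (m \x leb)%E.-integrable setT (fun q => (F q ^+ 2)%:E).
  apply/integrableP; split; first by apply/measurable_EFinP; exact: measurable_funX.
  by under eq_integral do rewrite gee0_abs ?lee_fin ?sqr_ge0//.
have := ae_integrable1 iF2; apply: filterS => y iy.
have mI : measurable (I : set mR) by exact: measurable_itv.
have I1 (x : mR) : `|\1_I x : R| <= 1 * \1_I x by rewrite ger0_norm// mul1r.
have Ioo : (leb I < +oo)%E by rewrite leb_I ltry.
have mFy : measurable_fun setT (fun s => F (y, s)).
  exact: (measurableT_comp mF (pair1_measurable y)).
have yoo : (\int[leb]_s (F (y, s) ^+ 2)%:E < +oo)%E by exact: integrable_lty iy.
have := @square_integrable_mul _ mR R leb 1 I _ \1_I mI Ioo mFy yoo (measurable_indic mI) ler01 I1.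
apply: eq_integrable => // s _ /=; rewrite indicE.
have [Is|nIs] := pselect (I s); last by rewrite F0// mul0r.
by rewrite mem_set// mulr1.
Qed.

Let sq_FI : (\int[(m \x leb)%E]_q ((F q * \1_I q.2) ^+ 2)%:E < +oo)%E.
Proof.
rewrite (eq_integral (fun q => (F q ^+ 2)%:E))// => -[y s] _ /=.
rewrite indicE; have [Is|nIs] := pselect (I s); last by rewrite F0// mul0r.
by rewrite mem_set// mulr1.
Qed.

Let cst1_le1 (t s : R) : `|1 : R| <= 1.
Proof. by rewrite normr1. Qed.

(** The one-dimensional identity is applied on almost every fibre: F is square integrable there,
    hence integrable, since it is supported in an interval of length 1. *)
Lemma kavg_kern_weak :
  \int[(m \x leb)%E]_q (kavg kern q * (P' q * \1_I q.2)) =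
  - \int[(m \x leb)%E]_q ((F q - kavg (fun _ _ => 1) q) * (P q * \1_I q.2)).
Proof.
have iU : (m \x leb)%E.-integrable setT (EFin \o (fun q => kavg kern q * (P' q * \1_I q.2))).
  apply: strip_integrable => //; first exact: measurable_kavg (@measurable_kern R).
  exact: kavg_sq_lty (@measurable_kern R) (@kern_le1 R).
have iF : (m \x leb)%E.-integrable setT (EFin \o (fun q => F q * (P q * \1_I q.2))).
  exact: strip_integrable.
have iG : (m \x leb)%E.-integrable setT (EFin \o (fun q => kavg (fun _ _ => 1) q * (P q * \1_I q.2))).
  apply: strip_integrable => //; first exact: measurable_kavg.
  exact: kavg_sq_lty.
have iFG : (m \x leb)%E.-integrable setT (EFin \o (fun q => (F q - kavg (fun _ _ => 1) q) * (P q * \1_I q.2))).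
  have := integrableB measurableT iF iG.
  by apply: eq_integrable => // q _ /=; rewrite -EFinB -mulrBl.
rewrite -mulN1r -RintegralZl//.
apply: Rintegral_prod_ae_eq => //; first exact: (integrableZl measurableT (-1) iFG).
apply: filterS2 aeF (ae_integrable1 iFG) => y iFy iFGy.
rewrite (RintegralZl (-1) measurableT iFGy) mulN1r.
have := @integral_kern_weak _ (fun s => F (y, s)) (fun s => P (y, s)) (fun s => P' (y, s)) iFy (@F0 y) (@dP y) (@cP' y).
rewrite /kavg /= => ->; congr (- _); apply: eq_Rintegral => s _ /=.
rewrite mulrA mulrAC; congr (_ * _).
rewrite mulrBl [in RHS]mulrC; congr (_ - _); last first.
  by rewrite mulrC; congr (_ * _); apply: eq_Rintegral => x _; rewrite mul1r.
rewrite indicE; have [Is|nIs] := pselect (I s); last by rewrite F0// mulr0.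
by rewrite mem_set// mul1r.
Qed.

(** The mean is constant along a fibre, and the derivative of P integrates to P 1 - P 0 = 0
    there. *)
Lemma kavg_mean_weak : (forall y, P (y, 1) = P (y, 0)) ->
  \int[(m \x leb)%E]_q (kavg (fun _ _ => 1) q * (P' q * \1_I q.2)) = 0.
Proof.
move=> P10.
have iG : (m \x leb)%E.-integrable setT (EFin \o (fun q => kavg (fun _ _ => 1) q * (P' q * \1_I q.2))).
  apply: strip_integrable => //; first exact: measurable_kavg.
  exact: kavg_sq_lty.
transitivity (\int[(m \x leb)%E]_(q in setT) (0 : R)); last by rewrite Rintegral_cst// mul0r.
apply: Rintegral_prod_ae_eq => //; first exact: integrable0.
apply: aeW => y; transitivity (0 : R); last by rewrite Rintegral_cst// mul0r.
rewrite /kavg /=.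
exact: (@integral_mean_weak _ _ (fun s => P (y, s)) (fun s => P' (y, s)) (@dP y) (@cP' y) (P10 y)).
Qed.

End weak_identities.
End period_average.

Section ae_product.
Context d1 d2 (X : measurableType d1) (Y : measurableType d2) (R : realType).
Variables (m1 : {sigma_finite_measure set X -> \bar R}).
Variables (m2 : {sigma_finite_measure set Y -> \bar R}).

Lemma ae_prod_fst (P : X -> Prop) :
  (\forall x \ae m1, P x) -> \forall p \ae (m1 \x m2)%E, P p.1.
Proof.
move=> [A [mA A0 PA]]; exists (A `*` setT); split.
- exact: measurableX.
- apply: (etrans (product_measure1E m1 m2 mA (@measurableT _ Y))).
  by rewrite [X in (X * _)%E]A0 mul0e.
- by move=> p Pp; split => //; exact: PA.
Qed.

Lemma ae_prod_sections (P : X * Y -> Prop) :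
  (\forall p \ae (m1 \x m2)%E, P p) -> \forall x \ae m1, \forall y \ae m2, P (x, y).
Proof.
move=> [A [mA A0 PA]].
have mx := measurable_fun_xsection m2 mA.
have /ae_eq_integral_abs : (\int[m1]_x `|(m2 \o xsection A) x| = 0)%E.
  by rewrite -[RHS]A0; apply: eq_integral => x _; rewrite gee0_abs.
move=> /(_ measurableT mx); apply: filterS => x /(_ Logic.I) /= x0.
exists (xsection A x); split => //; first exact: measurable_xsection.
by move=> y Pxy; rewrite /xsection/= inE; exact: PA.
Qed.

End ae_product.

(** * The function space *)

Section function_space_theory.
Context {R : realType}.
Variable T : R.
Hypothesis T_gt0 : 0 < T.
Local Notation leb := (@lebesgue_measure R).
Local Notation mR := (measurableTypeR R).
Local Notation I := (`]0%R, 1%R[%classic : set R).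
Local Notation leb2 := (@leb2 R).
Local Notation leb6 := (@leb6 R).
Local Notation leb8 := (@leb8 R).
Local Notation sleb := (@sleb R).

Lemma measurable_time_dom : measurable (time_dom T).
Proof. by apply: measurableX. Qed.

Lemma measurable_kdom : measurable (kdom T).
Proof. by apply: measurableX => //; exact: measurable_time_dom. Qed.

Lemma measurable_kdom_period : measurable (kdom_period T).
Proof. by apply: measurableX => //; apply: measurableX. Qed.

Lemma kdom_period_sub : kdom_period T `<=` kdom T.
Proof.
move=> [[t tau] z] [[/= tT tau1] _]; split=> //; split=> //=.
by move: tau1; rewrite !in_itv/= andbT => /andP[].
Qed.

Lemma sq_Lnorm2 (g : mR6 R -> R) :
  (('N[leb6]_2%:E[EFin \o g]) `^ 2 = \int[leb6]_z (g z ^+ 2)%:E)%E.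
Proof.
rewrite poweR_Lnorm//; apply: eq_integral => z _ /=.
by rewrite powR_mulrn// real_normK// num_real.
Qed.

(** Turns membership in the space into a bound on integrals of squares, so that the later estimates
    involve neither norms nor roots. *)
Lemma ess_sup_L2P (f : mkspace R -> R) :
  (ess_sup leb2
     ((fun s => 'N[leb6]_2%:E[EFin \o (fun z => f (s, z))]) \_ (time_dom T)) < +oo)%E
  <-> exists C : R, 0 <= C /\ \forall s \ae leb2, time_dom T s ->
        (\int[leb6]_z (f (s, z) ^+ 2)%:E <= C%:E)%E.
Proof.
split.
  set e := (X in (X < _)%E) => eoo.
  have [c [c0 ec]] : exists c : R, 0 <= c /\ (e <= c%:E)%E.
    case: e eoo => [r _|//|_]; last by exists 0; rewrite leNye.
    by exists `|r|; split => //; rewrite lee_fin ler_norm.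
  exists (c `^ 2); split; first exact: powR_ge0.
  have := ess_sup_ge leb2 ((fun s => 'N[leb6]_2%:E[EFin \o (fun z => f (s, z))]%E) \_ (time_dom T)).
  apply: filterS => s + Ts; rewrite patchE mem_set// => /le_trans /(_ ec) Nc.
  rewrite -sq_Lnorm2 -poweR_EFin.
  apply: gt0_ler_poweR => //.
  - by rewrite in_itv/= Lnorm_ge0 leey.
  - by rewrite in_itv/= lee_fin c0 leey.
move=> [C [C0 H]].
apply: (@le_lt_trans _ _ (C `^ 2^-1)%:E); last exact: ltry.
apply/ess_supP; apply: filterS H => s H.
rewrite patchE; case: ifPn => [/set_mem /H {}H|_]; last by rewrite lee_fin powR_ge0.
rewrite -poweR_EFin.
have -> : ('N[leb6]_2%:E[EFin \o (fun z => f (s, z))] =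
    ('N[leb6]_2%:E[EFin \o (fun z => f (s, z))] `^ 2) `^ 2^-1)%E.
  by rewrite -poweRrM divff// poweRe1// Lnorm_ge0.
rewrite sq_Lnorm2; apply: gt0_ler_poweR => //.
- by rewrite in_itv/= leey andbT; apply: integral_ge0 => z _; rewrite lee_fin sqr_ge0.
- by rewrite in_itv/= lee_fin C0 leey.
Qed.

Lemma kdom_section (f : mkspace R -> R) s : measurable_fun (kdom T) f ->
  time_dom T s -> measurable_fun setT (fun z => f (s, z)).
Proof.
move=> mf Ts.
have mfr : measurable_fun setT (f \_ (kdom T)).
  by apply/(measurable_restrictT _ _).1 => //; exact: measurable_kdom.
have := measurableT_comp mfr (pair1_measurable s).
by apply: eq_measurable_fun => z _ /=; rewrite patchE mem_set.
Qed.

Lemma LinfLinfL2B f g : LinfLinfL2 T f -> LinfLinfL2 T g -> LinfLinfL2 T (f \- g).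
Proof.
move=> [mf pf /ess_sup_L2P[C [C0 fC]]] [mg pg /ess_sup_L2P[D [D0 gD]]]; split.
- exact: measurable_funB.
- by apply: filterS2 pf pg => p pfp pgp Tp; rewrite /= pfp// pgp.
apply/ess_sup_L2P; exists (2 * C + 2 * D); split; first by rewrite addr_ge0// mulr_ge0.
apply: filterS2 fC gD => s fC gD Ts; have {}fC := fC Ts; have {}gD := gD Ts.
have m2f := kdom_section mf Ts; have m2g := kdom_section mg Ts.
have mE (h : mR6 R -> R) : measurable_fun setT h -> measurable_fun setT (fun z => (h z ^+ 2)%:E).
  by move=> mh; apply/measurable_EFinP; exact: measurable_funX.
apply: (@le_trans _ _ (\int[leb6]_z (2%:E * (f (s, z) ^+ 2)%:E + 2%:E * (g (s, z) ^+ 2)%:E))%E).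
  apply: ge0_le_integral => //.
  - by move=> z _; rewrite lee_fin sqr_ge0.
  - by apply: (mE (fun z => f (s, z) - g (s, z))); exact: measurable_funB.
  - by apply: emeasurable_funD; apply: measurable_funeM; exact: mE.
  move=> z _ /=; rewrite -!EFinM -EFinD lee_fin.
  by have := sqr_ge0 (f (s, z) + g (s, z)); lra.
rewrite ge0_integralD//; first last.
- by apply: measurable_funeM; exact: mE.
- by move=> z _; rewrite mule_ge0// lee_fin sqr_ge0.
- by apply: measurable_funeM; exact: mE.
- by move=> z _; rewrite mule_ge0// lee_fin sqr_ge0.
have sq0 (h : mR6 R -> R) z : setT z -> (0 <= (h z ^+ 2)%:E)%E by rewrite lee_fin sqr_ge0.
rewrite (ge0_integralZl _ measurableT (mE _ m2f))//; last exact: sq0.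
rewrite (ge0_integralZl _ measurableT (mE _ m2g))//; last exact: sq0.
apply: (@le_trans _ _ (2%:E * C%:E + 2%:E * D%:E)%E); last by rewrite -!EFinM -EFinD.
by apply: leeD; rewrite lee_pmul2l.
Qed.

Section slab.
Variable f : mkspace R -> R.
Hypothesis fL : LinfLinfL2 T f.

(** One period of f in straightened coordinates, extended by zero: a measurable function on a full
    product, to which Fubini and Tonelli apply without domains. *)
Definition slab : mR * mR6 R * mR -> R := (f \_ (kdom_period T)) \o straight.

Let mfr : measurable_fun setT (f \_ (kdom_period T)).
Proof.
case: fL => mf _ _; apply/(measurable_restrictT _ _).1; first exact: measurable_kdom_period.
exact: (measurable_funS measurable_kdom kdom_period_sub).
Qed.

Lemma measurable_slab : measurable_fun setT slab.
Proof. exact: (measurableT_comp mfr (@mpres_straight R).1). Qed.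

Lemma slab_eq0 y s : ~ I s -> slab (y, s) = 0.
Proof.
move=> nIs; rewrite /slab/= patchE memNset// => -[[_ Is] _].
exact: nIs.
Qed.

Lemma slabE y s : `]0, T[%classic y.1 -> I s -> slab (y, s) = f (straight (y, s)).
Proof. by move=> yT Is; rewrite /slab/= patchE mem_set. Qed.

(** For almost every t the essential bound holds for almost every s; the rotation at time s
    preserves the integral over z, and integrating over a period of length 1 leaves the constant
    unchanged. *)
Lemma slab_sq_sections : exists C : R, 0 <= C /\ \forall t \ae leb,
  (\int[leb]_s \int[leb6]_z (slab ((t, z), s) ^+ 2)%:E <= C%:E)%E.
Proof.
have [mf pf /ess_sup_L2P[C [C0 fC]]] := fL; exists C; split=> //.
have mI : measurable (I : set mR) by exact: measurable_itv.
have := ae_prod_sections fC; apply: filterS => t tC.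
apply: (@le_trans _ _ (\int[leb]_s (C%:E * (\1_I s)%:E))%E); last first.
  rewrite ge0_integralZl//; first by rewrite (integral_indic leb measurableT mI) setIT [X in (_ * X)%E]lebesgue_measure_itv/= lte_fin ltr01 oppr0 adde0 mule1.
  by apply/measurable_EFinP; exact: measurable_indic.
have sq0 z s : (0 <= (slab ((t, z), s) ^+ 2)%:E)%E by rewrite lee_fin sqr_ge0.
have mts : measurable_fun setT (fun p : mR * mR6 R => slab ((t, p.2), p.1)).
  apply: (measurableT_comp measurable_slab (g := fun p : mR * mR6 R => ((t, p.2), p.1))).
  by apply: measurable_fun_pair => //; exact: measurable_fun_pair.
apply: ae_ge0_le_integral => //.
- by move=> s _; apply: integral_ge0 => z _; exact: sq0.
- apply: (@measurable_fun_fubini_tonelli_F _ _ mR (mR6 R) R leb6 (fun p => (slab ((t, p.2), p.1) ^+ 2)%:E)) => //.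
  by apply/measurable_EFinP; exact: measurable_funX.
- by move=> s _; rewrite mule_ge0// lee_fin.
- by apply: measurable_funeM; apply/measurable_EFinP; exact: measurable_indic.
apply: filterS tC => s sC _.
have [Is|nIs] := pselect (I s); last first.
  rewrite integral0_eq ?mule_ge0 ?lee_fin// => z _.
  by rewrite slab_eq0// expr0n.
have [tT|ntT] := pselect (`]0%R, T[%classic t); last first.
  rewrite integral0_eq ?mule_ge0 ?lee_fin// => z _.
  by rewrite /slab/= patchE memNset ?expr0n// => -[[/ntT]].
have Tts : time_dom T (t, s).
  by split=> //=; move: Is; rewrite /= !in_itv/= andbT => /andP[].
rewrite indicE mem_set// mule1; apply: le_trans (sC Tts).
rewrite [leRHS](mpres_ge0_integral (mpres_larmor6 s)); last 2 first.
- by apply/measurable_EFinP; apply: measurable_funX; exact: (kdom_section mf Tts).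
- by move=> z; rewrite lee_fin sqr_ge0.
rewrite [leLHS](eq_integral (fun z : mR6 R => (f (t, s, (z.1, larmor s z.2)) ^+ 2)%:E))// => z _.
by rewrite slabE.
Qed.

Lemma slab_sq_swap t :
  (\int[leb6]_z \int[leb]_s (slab ((t, z), s) ^+ 2)%:E =
   \int[leb]_s \int[leb6]_z (slab ((t, z), s) ^+ 2)%:E)%E.
Proof.
apply: (@fubini_tonelli _ _ (mR6 R) mR R leb6 leb (fun p => (slab ((t, p.1), p.2) ^+ 2)%:E)).
  apply/measurable_EFinP; apply: measurable_funX.
  apply: (measurableT_comp measurable_slab (g := fun p : mR6 R * mR => ((t, p.1), p.2))).
  by apply: measurable_fun_pair => //; exact: measurable_fun_pair.
by move=> p; rewrite lee_fin sqr_ge0.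
Qed.

(** The bound of [slab_sq_sections] is uniform in t, and the time interval has finite length T. *)
Lemma slab_sq_lty : (\int[sleb]_q (slab q ^+ 2)%:E < +oo)%E.
Proof.
have [C [C0 H]] := slab_sq_sections.
have mI : measurable (`]0, T[ : set mR) by exact: measurable_itv.
have sq0 q : (0 <= (slab q ^+ 2)%:E)%E by rewrite lee_fin sqr_ge0.
have msq : measurable_fun setT (fun q => (slab q ^+ 2)%:E).
  by apply/measurable_EFinP/measurable_funX; exact: measurable_slab.
rewrite /sleb fubini_tonelli1//.
rewrite /leb7 fubini_tonelli1//; last 2 first.
- exact: measurable_fun_fubini_tonelli_F.
- by move=> y; apply: integral_ge0 => s _.
apply: (@le_lt_trans _ _ (\int[leb]_t (C%:E * (\1_`]0%R, T[ t)%:E))%E); last first.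
  rewrite ge0_integralZl//.
    rewrite (integral_indic leb measurableT mI) setIT [X in (_ * X)%E]lebesgue_measure_itv/= lte_fin T_gt0 -EFinD -EFinM.
    exact: ltry.
  by apply/measurable_EFinP; exact: measurable_indic.
have mFF : measurable_fun setT (fubini_F leb (fun q => (slab q ^+ 2)%:E)).
  exact: measurable_fun_fubini_tonelli_F.
apply: ae_ge0_le_integral => //.
- by move=> t _; do 2 apply: integral_ge0 => // ? _.
- apply: measurable_fun_fubini_tonelli_F => // y.
  by apply: integral_ge0 => s _.
- by move=> s _; rewrite mule_ge0// lee_fin.
- by apply: measurable_funeM; apply/measurable_EFinP; exact: measurable_indic.
apply: filterS H => t tC _; rewrite [leLHS]slab_sq_swap.
have [tT|ntT] := pselect (`]0%R, T[%classic t); first by rewrite indicE mem_set// mule1.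
rewrite integral0_eq ?mule_ge0 ?lee_fin// => s _.
rewrite integral0_eq// => z _.
by rewrite /slab/= patchE memNset ?expr0n// => -[[/ntT]].
Qed.

Section slab_average.
Variable k : R -> R -> R.
Hypothesis mk : measurable_fun setT (fun p : mR * mR => k p.1 p.2).
Hypothesis k1 : forall t s, `|k t s| <= 1.
Hypothesis k_per : forall t s, k (t + 1) s = k t s.

(** Undoing the rotation preserves the integral over z, and [le_sq_kavg] bounds the average at each
    tau by the integral over a period, so the constant of [slab_sq_sections] serves again. *)
Lemma kavg_slab_LinfLinfL2 : LinfLinfL2 T (kavg slab k \o unstraight).
Proof.
have mka := measurable_kavg measurable_slab mk.
have mun := @measurable_unstraight R.
split.
- by apply: measurable_funTS; exact: (measurableT_comp mka mun).
- apply: aeW => -[[t tau] z] _ /=.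
  (* Since -(tau + 1) + 1 = -tau, the rotation from v back to w is unchanged when tau increases by
     1. *)
  rewrite /unstraight/= -(larmorD1 (- (tau + 1))) opprD subrK /kavg /=.
  by apply: eq_Rintegral => s _; rewrite k_per.
apply/ess_sup_L2P; have [C [C0 H]] := slab_sq_sections; exists C; split=> //.
apply: filterS (ae_prod_fst leb H) => -[t tau] /= tC _.
apply: le_trans tC.
have mkat : measurable_fun setT (fun z => ((kavg slab k ((t, z), tau)) ^+ 2)%:E).
  apply/measurable_EFinP; apply: measurable_funX.
  apply: (measurableT_comp mka (g := fun z : mR6 R => ((t, z), tau))).
  by apply: measurable_fun_pair => //; exact: measurable_fun_pair.
have -> : (\int[leb6]_z (((kavg slab k \o unstraight) (t, tau, z)) ^+ 2)%:E =
    \int[leb6]_z (kavg slab k ((t, z), tau) ^+ 2)%:E)%E.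
  rewrite [RHS](mpres_ge0_integral (mpres_larmor6 (- tau)))//.
  by move=> z; rewrite lee_fin sqr_ge0.
rewrite -slab_sq_swap; apply: ge0_le_integral => //.
- by move=> z _; rewrite lee_fin sqr_ge0.
- apply: (@measurable_fun_fubini_tonelli_F _ _ (mR6 R) mR R leb (fun p => (slab ((t, p.1), p.2) ^+ 2)%:E)).
    apply/measurable_EFinP; apply: measurable_funX.
    apply: (measurableT_comp measurable_slab (g := fun p : mR6 R * mR => ((t, p.1), p.2))).
    by apply: measurable_fun_pair => //; exact: measurable_fun_pair.
  by move=> p; rewrite lee_fin sqr_ge0.
by move=> z _; apply: le_sq_kavg => //; [exact: measurable_slab|exact: slab_eq0].
Qed.

End slab_average.
End slab.
End function_space_theory.

(** * Test functions along the characteristics *)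

Section test_function_calculus.
Context {R : realType}.
Local Notation V := (kspace R).

Lemma is_derive_linear (U : normedModType R) (L : U -> R) (x u : U) :
  linear L -> continuous L -> is_derive x u (L : U -> R^o) (L u).
Proof.
move=> lL cL.
pose LM := GRing.isLinear.Build _ _ _ _ L lL.
pose LL : {linear U -> R^o} := HB.pack (L : U -> R^o) LM.
have dL : differentiable (LL : U -> R^o) x by exact: linear_differentiable.
apply: DeriveDef; first exact: diff_derivable.
by rewrite deriveE// (@diff_lin _ _ _ LL).
Qed.

Definition v2 (p : V) : R := p.2.2.1.2.
Definition v3 (p : V) : R := p.2.2.2.

Lemma continuous_v2 : continuous v2.
Proof.
move=> p; apply: (@continuous_comp _ _ _ (fun q : V => q.2.2.1) snd); last exact: cvg_snd.
apply: (@continuous_comp _ _ _ (fun q : V => q.2.2) fst); last exact: cvg_fst.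
by apply: (@continuous_comp _ _ _ snd snd); exact: cvg_snd.
Qed.

Lemma continuous_v3 : continuous v3.
Proof.
move=> p; apply: (@continuous_comp _ _ _ (fun q : V => q.2.2) snd); last exact: cvg_snd.
by apply: (@continuous_comp _ _ _ snd snd); exact: cvg_snd.
Qed.

Definition e_tau : V := ((0, 1), (0, 0)).
Definition e_v1 : V := ((0, 0), (0, vec1)).
Definition e_v2 : V := ((0, 0), (0, vec2)).
Definition e_v3 : V := ((0, 0), (0, vec3)).

Definition transport (phi : V -> R) (p : V) : R :=
  'D_e_tau phi p + 2 * pi * (v3 p * 'D_e_v2 phi p - v2 p * 'D_e_v3 phi p).

(** The field v x M is divergence free: its second component involves only v3 and its third only v2.
    The transposed operator is therefore minus the operator itself. *)
Lemma d_tau_div_v (phi : V -> R) p : differentiable phi p ->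
  d_tau phi p + div_v (fun q => phi q *: cross q.2.2 ((2 * pi) *: vec1)) p =
  transport phi p.
Proof.
move=> dphi; rewrite /transport /d_tau /div_v -/e_tau -/e_v1 -/e_v2 -/e_v3.
congr (_ + _).
have -> : (fun q : V => (phi q *: cross q.2.2 ((2 * pi) *: vec1)).1.1) = cst 0.
  by apply/funext => q; rewrite /cross /vec1 /= /GRing.scale/= !mulr0 subrr mulr0.
have -> : (fun q : V => (phi q *: cross q.2.2 ((2 * pi) *: vec1)).1.2) =
    (phi * (fun q => 2 * pi * v3 q))%R.
  apply/funext => q; transitivity (phi q * (2 * pi * q.2.2.2)) => //.
  by rewrite /cross /vec1 /= /GRing.scale/=; ring.
have -> : (fun q : V => (phi q *: cross q.2.2 ((2 * pi) *: vec1)).2) =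
    (phi * (fun q => - (2 * pi) * v2 q))%R.
  apply/funext => q; transitivity (phi q * (- (2 * pi) * q.2.2.1.2)) => //.
  by rewrite /cross /vec1 /= /GRing.scale/=; ring.
have d3 : is_derive p e_v2 (fun q : V => 2 * pi * v3 q : R^o) (2 * pi * v3 e_v2).
  apply: (@is_derive_linear _ (fun q => 2 * pi * v3 q)).
    by move=> a x y; rewrite /v3 /= /GRing.scale/=; ring.
  by move=> x; apply: cvgM; [exact: cvg_cst|exact: continuous_v3].
have d2 : is_derive p e_v3 (fun q : V => - (2 * pi) * v2 q : R^o) (- (2 * pi) * v2 e_v3).
  apply: (@is_derive_linear _ (fun q => - (2 * pi) * v2 q)).
    by move=> a x y; rewrite /v2 /= /GRing.scale/=; ring.
  by move=> x; apply: cvgM; [exact: cvg_cst|exact: continuous_v2].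
have dp u : is_derive p u phi ('D_u phi p) by apply: DeriveDef => //; exact: diff_derivable.
have D2 := is_deriveM (dp e_v2) d3; have D3 := is_deriveM (dp e_v3) d2.
rewrite derive_cst (@derive_val _ _ _ _ _ _ _ D2) (@derive_val _ _ _ _ _ _ _ D3).
have -> : v3 e_v2 = 0 by [].
have -> : v2 e_v3 = 0 by [].
move: ('D_e_v2 phi p) ('D_e_v3 phi p) (v2 p) (v3 p) (phi p) => a b c e f.
rewrite /GRing.scale /=; ring.
Qed.

(** The map [straight] read as a curve in tau with values in the normed space [kspace], where it can
    be differentiated. *)
Definition orbit_point (y : R * (R3 R * R3 R)) (tau : R) : V :=
  ((y.1, tau), (y.2.1, larmor tau y.2.2)).

Lemma kspace_ext (p q : V) :
  p.1.1 = q.1.1 -> p.1.2 = q.1.2 -> p.2.1.1.1 = q.2.1.1.1 ->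
  p.2.1.1.2 = q.2.1.1.2 -> p.2.1.2 = q.2.1.2 -> p.2.2.1.1 = q.2.2.1.1 ->
  p.2.2.1.2 = q.2.2.1.2 -> p.2.2.2 = q.2.2.2 -> p = q.
Proof.
by move: p q => [[? ?] [[[? ?] ?] [[? ?] ?]]] [[? ?] [[[? ?] ?] [[? ?] ?]]] /= -> -> -> -> -> -> -> ->.
Qed.

Lemma diff_orbit y (tau : R) : differentiable (orbit_point y) tau /\
  'd (orbit_point y) tau 1 = e_tau + (2 * pi * v3 (orbit_point y tau)) *: e_v2 -
    (2 * pi * v2 (orbit_point y tau)) *: e_v3.
Proof.
pose th (t : R) : R := 2 * pi * t.
have dth (t : R) : is_derive t 1 th (2 * pi).
  have := is_deriveM (is_derive_cst (2 * pi : R^o) t 1) (is_derive_id t 1).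
  by move=> h; apply: (is_derive_eq h); rewrite /GRing.scale/= mulr1 mulr0 addr0.
have dc (t : R) : is_derive t 1 (cos \o th) (- sin (th t) * (2 * pi)).
  exact: is_derive1_comp.
have ds (t : R) : is_derive t 1 (sin \o th) (cos (th t) * (2 * pi)).
  exact: is_derive1_comp.
pose w := y.2.2.
pose c2 (t : R) : R := cos (th t) * w.1.2 + sin (th t) * w.2.
pose c3 (t : R) : R := cos (th t) * w.2 - sin (th t) * w.1.2.
have d2 (t : R) : is_derive t 1 c2 (2 * pi * c3 t).
  have h := is_deriveD (is_deriveM (dc t) (is_derive_cst (w.1.2 : R^o) t 1))
     (is_deriveM (ds t) (is_derive_cst (w.2 : R^o) t 1)).
  apply: (is_derive_eq h); rewrite /c3 /= /GRing.scale/= /cst; ring.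
have d3 (t : R) : is_derive t 1 c3 (- (2 * pi * c2 t)).
  have h := is_deriveB (is_deriveM (dc t) (is_derive_cst (w.2 : R^o) t 1))
     (is_deriveM (ds t) (is_derive_cst (w.1.2 : R^o) t 1)).
  apply: (is_derive_eq h); rewrite /c2 /= /GRing.scale/= /cst; ring.
have f2 : differentiable c2 tau by apply/derivable1_diffP; exact: ex_derive.
have f3 : differentiable c3 tau by apply/derivable1_diffP; exact: ex_derive.
pose u : V := ((0, 1), (0, ((0, 2 * pi * c3 tau), - (2 * pi * c2 tau)))).
have i2 : is_diff tau c2 (fun h => h *: (2 * pi * c3 tau)).
  apply: DiffDef => //; rewrite diff1E//; apply/funext => h.
  by rewrite derive1E (@derive_val _ _ _ _ _ _ _ (d2 tau)).
have i3 : is_diff tau c3 (fun h => h *: (- (2 * pi * c2 tau))).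
  apply: DiffDef => //; rewrite diff1E//; apply/funext => h.
  by rewrite derive1E (@derive_val _ _ _ _ _ _ _ (d3 tau)).
have j1 := is_diff_pair (is_diff_cst (y.1 : R) tau) (is_diff_id tau).
have j2 := is_diff_pair (is_diff_pair (is_diff_cst (w.1.1 : R) tau) i2) i3.
have j3 := is_diff_pair j1 (is_diff_pair (is_diff_cst (y.2.1 : R3 R) tau) j2).
have j4 : is_diff tau (orbit_point y)
    (fun h : R => ((0, h), (0, ((0, h *: (2 * pi * c3 tau)), h *: (- (2 * pi * c2 tau))))) : V).
  exact: j3.
have dgam : differentiable (orbit_point y) tau by exact: ex_diff.
have gu : 'd (orbit_point y) tau 1 = u by rewrite diff_val /u !scale1r.
split; first exact: dgam.
rewrite gu.
have -> : v3 (orbit_point y tau) = c3 tau by [].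
have -> : v2 (orbit_point y tau) = c2 tau by [].
rewrite /u; move: (2 * pi * c3 tau) (2 * pi * c2 tau) => a b.
by apply: kspace_ext; rewrite /= /GRing.scale/= ?(mulr0, mulr1, addr0, add0r, subr0, sub0r) // oppr0.
Qed.

Lemma continuous_orbit y : continuous (orbit_point y).
Proof. by move=> t; exact/differentiable_continuous/(diff_orbit y t).1. Qed.

(** By the chain rule, as the velocity of the orbit is the transport field. This reduces the
    operator to an ordinary derivative on each fibre. *)
Lemma is_derive_orbit (phi : V -> R) y (tau : R) :
  differentiable phi (orbit_point y tau) ->
  is_derive tau (1 : R) (phi \o orbit_point y) (transport phi (orbit_point y tau)).
Proof.
move=> dphi; have [dgam gu] := diff_orbit y tau.
apply: DeriveDef.
  by apply: diff_derivable; apply: differentiable_comp.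
rewrite deriveE; last by apply: differentiable_comp.
rewrite diff_comp//= gu.
rewrite linearB linearD !linearZ /= -!deriveE// /transport.
move: ('D_e_tau phi (orbit_point y tau)) ('D_e_v2 phi (orbit_point y tau)) ('D_e_v3 phi (orbit_point y tau)) (v3 (orbit_point y tau)) (v2 (orbit_point y tau)) => a b c e f.
rewrite /GRing.scale/=; ring.
Qed.

End test_function_calculus.

(** * Borel measurability of continuous functions on the phase space *)

Section countable_base.

(* A countable family of measurable sets containing arbitrarily small neighbourhoods of
   each point makes open sets measurable; the property is stable under products. *)
Definition has_measurable_base d (X : measurableType d) (nb : X -> set (set X)) :=
  exists (I : countType) (B : I -> set X),
    (forall i, measurable (B i)) /\
    forall x U, nb x U -> exists2 i, B i x & B i `<=` U.

Lemma measurable_base_open d (X : measurableType d) (nb : X -> set (set X)) (U : set X) :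
  has_measurable_base nb -> (forall x, U x -> nb x U) -> measurable U.
Proof.
move=> [I [B [mB HB]]] oU.
have -> : U = \bigcup_(i in [set i | B i `<=` U]) B i.
  apply/seteqP; split=> [x Ux|x [i /= iU Bx]]; last exact: iU.
  by have [i Bx iU] := HB x U (oU x Ux); exists i.
rewrite bigcup_mkcond; apply: countable_bigcupT_measurable; first exact: countableP.
by move=> i; case: ifP.
Qed.

Lemma measurable_base_prod d1 d2 (X : measurableType d1) (Y : measurableType d2)
    (nx : X -> set (set X)) (ny : Y -> set (set Y)) (nxy : X * Y -> set (set (X * Y))) :
  (forall p U, nxy p U -> exists A B, [/\ nx p.1 A, ny p.2 B & A `*` B `<=` U]) ->
  has_measurable_base nx -> has_measurable_base ny ->
  has_measurable_base nxy.
Proof.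
move=> Hn [I [B [mB HB]]] [J [C [mC HC]]].
exists (I * J)%type, (fun ij => B ij.1 `*` C ij.2); split.
  by move=> ij; exact: measurableX.
move=> [x y] U /Hn[A [D [/= xA yD ADU]]].
have [i Bx BA] := HB _ _ xA; have [j Cy CD] := HC _ _ yD.
exists (i, j) => //= -[a b] [/= Ba Cb]; apply: ADU; split => /=; [exact: BA|exact: CD].
Qed.

End countable_base.

Section measurable_continuous.
Context {R : realType}.
Local Notation mR := (measurableTypeR R).

Lemma measurable_base_R : @has_measurable_base _ mR (fun x => nbhs (x : R)).
Proof.
exists (rat * rat)%type, (fun ab => `]ratr ab.1, ratr ab.2[%classic); split.
  by move=> ab; exact: measurable_itv.
move=> x U /nbhs_ballP[e /= e0 eU].
have xm : x - e < x by lra.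
have xp : x < x + e by lra.
have /rat_in_itvoo[a /itvP xa] := xm; have /rat_in_itvoo[b /itvP xb] := xp.
exists (a, b); first by rewrite /= in_itv/= xa xb.
move=> y /=; rewrite in_itv/= => /andP[ay yb]; apply: eU.
rewrite /ball /= ltr_distlC; apply/andP; split.
  by apply: lt_trans ay; rewrite xa.
by apply: lt_trans yb _; rewrite xb.
Qed.

Let nbhs_pair (U W : topologicalType) (p : U * W) A : nbhs p A ->
  exists B C, [/\ nbhs p.1 B, nbhs p.2 C & B `*` C `<=` A].
Proof. by move=> [[B C] /= [Bx Cy] BCA]; exists B, C. Qed.

Lemma measurable_base_kspace :
  @has_measurable_base _ (mkspace R) (fun p => nbhs (p : kspace R)).
Proof.
have b2 : @has_measurable_base _ (mR2 R) (fun p => nbhs (p : R * R)).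
  apply: (measurable_base_prod _ measurable_base_R measurable_base_R) => p U.
  exact: nbhs_pair.
have b3 : @has_measurable_base _ (mR3 R) (fun p => nbhs (p : R * R * R)).
  by apply: (measurable_base_prod _ b2 measurable_base_R) => p U; exact: nbhs_pair.
have b6 : @has_measurable_base _ (mR6 R) (fun p => nbhs (p : R3 R * R3 R)).
  by apply: (measurable_base_prod _ b3 b3) => p U; exact: nbhs_pair.
by apply: (measurable_base_prod _ b2 b6) => p U; exact: nbhs_pair.
Qed.

(** The bridge between the topology of [kspace], in which test functions are smooth, and the product
    sigma-algebra of [mkspace], in which they are integrated. *)
Lemma continuous_measurable_kspace (f : kspace R -> R) :
  continuous f -> measurable_fun setT (f : mkspace R -> R).
Proof.
move=> cf; apply: (measurability (@RGenOInfty.G R)) => [|/= _ [_] [r] -> <-].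
  exact: RGenOInfty.measurableE.
rewrite setTI; apply: (measurable_base_open measurable_base_kspace) => x fx.
apply: (@cf x); apply: open_nbhs_nbhs; split => //.
Qed.

End measurable_continuous.

(** * Support and size of test functions in straightened coordinates *)

Section test_function_strip.
Context {R : realType}.
Variable T : R.
Local Notation leb := (@lebesgue_measure R).
Local Notation mR := (measurableTypeR R).
Local Notation V := (kspace R).
Local Notation I := (`]0%R, 1%R[%classic : set R).

Variable phi : V -> R.
Hypothesis tphi : test_function T phi.

Lemma test_differentiable p : differentiable phi p.
Proof. by case: tphi => /(_ [::] p). Qed.

Lemma test_derive_differentiable u p : differentiable ('D_u phi) p.
Proof. by case: tphi => /(_ [:: u] p). Qed.

Lemma test_continuous : continuous phi.
Proof. by move=> p; exact/differentiable_continuous/test_differentiable. Qed.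

Lemma transport_continuous : continuous (transport phi).
Proof.
have cD u : continuous ('D_u phi : V -> R).
  by move=> p; exact/differentiable_continuous/test_derive_differentiable.
move=> p; apply: cvgD; first exact: cD.
apply: cvgM; first exact: cvg_cst.
by apply: cvgB; apply: cvgM; [exact: continuous_v3|exact: cD|exact: continuous_v2|exact: cD].
Qed.

Definition cube3 (N : R) : set (mR3 R) := (`[- N, N] `*` `[- N, N]) `*` `[- N, N].

Definition cube7 (N : R) : set (mR * mR6 R) := `[- N, N] `*` (cube3 N `*` cube3 N).

Lemma measurable_cube7 N : measurable (cube7 N).
Proof. by do ! apply: measurableX. Qed.

Lemma leb7_cube7 N : (leb7 (cube7 N) < +oo)%E.
Proof.
have l1 : (leb `[(- N)%R, N]%classic < +oo)%E.
  by rewrite lebesgue_measure_itv/=; case: ifP => _; rewrite ?ltry// -EFinD ltry.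
have l2 : (leb2 (`[(- N)%R, N] `*` `[(- N)%R, N]) < +oo)%E.
  rewrite /leb2 product_measure1E//.
  by apply: lte_mul_pinfty => //; rewrite ge0_fin_numE.
have l3 : (leb3 (cube3 N) < +oo)%E.
  rewrite /leb3 product_measure1E//; last exact: measurableX.
  by apply: lte_mul_pinfty => //; rewrite ge0_fin_numE.
have m3 : measurable (cube3 N) by do ! apply: measurableX.
have l6 : (leb6 (cube3 N `*` cube3 N) < +oo)%E.
  rewrite /leb6 product_measure1E//.
  by apply: lte_mul_pinfty => //; rewrite ge0_fin_numE.
rewrite /leb7 product_measure1E//; last exact: measurableX.
by apply: lte_mul_pinfty => //; rewrite ge0_fin_numE.
Qed.

Lemma cube3P N (v : mR3 R) :
  cube3 N v <-> [/\ `|v.1.1| <= N, `|v.1.2| <= N & `|v.2| <= N].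
Proof.
rewrite /cube3; split => [[[/=]]|[h1 h2 h3]]; rewrite ?in_itv /=.
  by rewrite -!ler_norml.
by split; [split|]; rewrite /= in_itv/= -ler_norml.
Qed.

(** Cubes are not invariant under rotation; the factor 2 comes from |c v2 + s v3| <= |v2| + |v3|. *)
Lemma larmor_cube3 N tau w : cube3 N w -> cube3 (2 * N) (larmor tau w).
Proof.
move=> /cube3P[h1 h2 h3]; apply/cube3P.
have N0 : 0 <= N by apply: le_trans h1.
have c1 : `|cos (2 * pi * tau)| <= 1 by rewrite ler_norml cos_geN1 cos_le1.
have s1 : `|sin (2 * pi * tau)| <= 1 by rewrite ler_norml sin_geN1 sin_le1.
have K (a b : R) : `|a| <= 1 -> `|b| <= N -> `|a * b| <= N.
  by move=> a1 bN; rewrite normrM; apply: le_trans bN; rewrite ler_piMl.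
split => /=.
- by apply: le_trans h1 _; lra.
- by apply: le_trans (ler_normD _ _) _; have := K _ _ c1 h2; have := K _ _ s1 h3; lra.
- by apply: le_trans (ler_normB _ _) _; have := K _ _ c1 h3; have := K _ _ s1 h2; lra.
Qed.

(** A support bounded in v is bounded in w uniformly in tau, because w is a rotation of v. *)
Lemma test_support : exists2 N : R, 0 <= N &
  forall y tau, ~ cube7 N y -> phi (orbit_point y tau) = 0.
Proof.
have [_ _ [K [cK _ K0]]] := tphi.
have [M [_ HM]] := compact_bounded cK.
(* The bound given by [compact_bounded] is valid for every real above M; this one is also
   nonnegative. *)
pose N := `|M| + 1.
have N0 : 0 <= N by rewrite addr_ge0.
have KN p : K p -> `|p| <= N.
  by apply: HM; rewrite (le_lt_trans (ler_norm M))// ltrDl.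
exists (2 * N); first by rewrite mulr_ge0.
move=> [t [x w]] tau nY; apply: K0 => /KN Kp; apply: nY.
move: Kp; rewrite prod_normE ge_max => /andP[/= tN].
rewrite prod_normE ge_max => /andP[/= xN vN].
have nb (v : R3 R) : `|v| <= N -> cube3 N v.
  move=> vN'; apply/cube3P; move: vN'.
  rewrite prod_normE ge_max => /andP[].
  by rewrite prod_normE ge_max => /andP[].
have {}xN := nb _ xN; have {}vN := nb _ vN.
split => /=; first by rewrite in_itv/= -ler_norml (le_trans tN)//; lra.
split => /=.
  by move: xN => /cube3P[h1 h2 h3]; apply/cube3P; split; lra.
by rewrite -(larmorK tau w); exact: larmor_cube3.
Qed.

Lemma test_bounded (psi : V -> R) (N : R) : continuous psi -> exists2 C : R, 0 <= C &
  forall y tau, cube7 N y -> I tau -> `|psi (orbit_point y tau)| <= C.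
Proof.
move=> cpsi.
pose B : set R := `[- (2 * `|N|), 2 * `|N|]%classic.
pose B3 : set (R3 R) := (B `*` B) `*` B.
have cB : compact B by exact: segment_compact.
have cB3 : compact B3 by do 2 apply: compact_setX => //.
have cD : compact (((B `*` (`[0, 1]%classic : set R)) `*` (B3 `*` B3)) : set V).
  by apply: compact_setX; apply: compact_setX => //; exact: segment_compact.
have := continuous_compact (continuous_subspaceT cpsi) cD.
move=> /compact_bounded[M [_ HM]].
exists (`|M| + 1); first by rewrite addr_ge0.
move=> [t [x w]] tau [/= tN [/= xN wN]] I01.
apply: HM; first by rewrite (le_lt_trans (ler_norm M))// ltrDl.
have NN : N <= `|N| by exact: ler_norm.
exists (orbit_point (t, (x, w)) tau) => //.
have cB3' (v : R3 R) : cube3 (2 * N) v -> B3 v.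
  move=> /cube3P[h1 h2 h3].
  by split; [split|]; rewrite /B/= in_itv/= -ler_norml; lra.
split; first split => /=.
- by move: tN; rewrite /B/= !in_itv/= -!ler_norml; have := normr_ge0 N; lra.
- exact: subset_itv_oo_cc.
split => /=; apply: cB3'; last exact: larmor_cube3.
by rewrite -(larmor0 x); exact: larmor_cube3.
Qed.

Lemma test_strip : exists C N : R, [/\ 0 <= C,
  forall y tau, I tau -> `|phi (orbit_point y tau)| <= C * \1_(cube7 N) y &
  forall y tau, I tau -> `|transport phi (orbit_point y tau)| <= C * \1_(cube7 N) y].
Proof.
have [N N0 S] := test_support.
have [C C0 HC] := test_bounded N test_continuous.
have [D D0 HD] := test_bounded N transport_continuous.
(* Outside the cube phi vanishes on the whole orbit of y and not merely at one point, so its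
   derivative along the orbit vanishes too. *)
have S' y tau : ~ cube7 N y -> transport phi (orbit_point y tau) = 0.
  move=> nY.
  have d := is_derive_orbit (test_differentiable (orbit_point y tau)).
  rewrite -(@derive_val _ _ _ _ _ _ _ d).
  have -> : phi \o orbit_point y = cst 0 by apply/funext => s; exact: S.
  exact: derive_cst.
exists (C + D), N; split; first exact: addr_ge0.
- move=> y tau It; rewrite indicE; have [Yy|nY] := pselect (cube7 N y).
    by rewrite mem_set// mulr1 (le_trans (HC _ _ Yy It))// lerDl.
  by rewrite memNset// mulr0 S// normr0.
- move=> y tau It; rewrite indicE; have [Yy|nY] := pselect (cube7 N y).
    by rewrite mem_set// mulr1 (le_trans (HD _ _ Yy It))// lerDr.
  by rewrite memNset// mulr0 S'// normr0.
Qed.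

End test_function_strip.

(** * Existence of the decomposition *)

Section decomposition.
Context {R : realType}.
Variable T : R.
Hypothesis T_gt0 : 0 < T.
Local Notation leb := (@lebesgue_measure R).
Local Notation mR := (measurableTypeR R).
Local Notation V := (kspace R).
Local Notation I := (`]0%R, 1%R[%classic : set R).
Local Notation strip := (mR * mR6 R * mR)%type.
Local Notation leb8 := (@leb8 R).
Local Notation sleb := (@sleb R).
Local Notation M := ((2 * pi) *: vec1 : R3 R).

(** Both constraints of [kdom_period] are absorbed on the right: the one on tau becomes an
    indicator, the one on t is enforced by the vanishing of psi. *)
Lemma Rintegral_straight (g psi : mkspace R -> R) (G : strip -> R) :
  measurable_fun (kdom_period T) g -> measurable_fun setT psi ->
  (forall q, kdom_period T (straight q) -> g (straight q) = G q) ->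
  (forall y tau, ~ `]0, T[%classic y.1 -> psi (orbit_point y tau) = 0) ->
  \int[leb8]_(p in kdom_period T) (g p * psi p) =
  \int[sleb]_q (G q * (psi (straight q) * \1_I q.2)).
Proof.
move=> mg mpsi gG psi0; rewrite Rintegral_mkcond /Rintegral; congr fine.
rewrite (mpres_integral (@mpres_straight R)); last first.
  apply/measurable_EFinP; apply/(measurable_restrictT _ _).1; first exact: measurable_kdom_period.
  by apply: measurable_funM => //; exact: measurable_funTS.
apply: eq_integral => -[y s] _ /=; congr EFin; rewrite patchE.
have [k|nk] := pselect (kdom_period T (straight (y, s))).
  rewrite mem_set// gG// indicE mem_set ?mulr1//.
  by case: k => -[].
rewrite memNset//.
have [sI|nsI] := pselect (I s); last by rewrite indicE memNset ?mulr0.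
suff -> : psi (straight (y, s)) = 0 by rewrite mul0r mulr0.
by apply: psi0 => yT; apply: nk.
Qed.

Section pairing.
Variable phi : V -> R.
Hypothesis tphi : test_function T phi.

Lemma test_time y tau : ~ `]0, T[%classic y.1 -> phi (orbit_point y tau) = 0.
Proof.
case: tphi => _ _ [K [_ KT K0]] nT; apply: K0 => /KT[/= yT _].
exact: nT.
Qed.

Lemma transport_time y tau : ~ `]0, T[%classic y.1 -> transport phi (orbit_point y tau) = 0.
Proof.
move=> nT.
have d := is_derive_orbit (test_differentiable tphi (orbit_point y tau)).
rewrite -(@derive_val _ _ _ _ _ _ _ d).
have -> : phi \o orbit_point y = cst 0 by apply/funext => s; exact: test_time.
exact: derive_cst.
Qed.

(** The orbit returns to the same velocity after one period, and phi is 1-periodic in tau. *)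
Lemma test_orbit_period y : phi (orbit_point y 1) = phi (orbit_point y 0).
Proof.
case: tphi => _ per _; rewrite /orbit_point -(per y.1 0).
by rewrite -[in RHS](larmorD1 0) add0r.
Qed.

Lemma measurable_test : measurable_fun setT (phi : mkspace R -> R).
Proof. exact: continuous_measurable_kspace (test_continuous tphi). Qed.

Lemma measurable_transport : measurable_fun setT (transport phi : mkspace R -> R).
Proof. exact: continuous_measurable_kspace (transport_continuous tphi). Qed.

Lemma continuous_transport_orbit y : continuous (fun t : R => transport phi (orbit_point y t)).
Proof.
move=> t; apply: (@continuous_comp _ _ _ (orbit_point y) (transport phi)).
  exact: continuous_orbit.
exact: transport_continuous tphi _.
Qed.

Lemma is_derive_test (y : mR * mR6 R) (t : R) :
  is_derive t (1 : R) (fun t => (phi \o straight) (y, t)) ((transport phi \o straight) (y, t)).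
Proof. exact: is_derive_orbit (test_differentiable tphi (orbit_point y t)). Qed.

Lemma Rintegral_transport (f : mkspace R -> R) :
  \int[leb8]_(p in kdom_period T)
     (f p * (d_tau phi p + div_v (fun q => phi q *: cross q.2.2 M) p)) =
  \int[leb8]_(p in kdom_period T) (f p * transport phi p).
Proof.
apply: eq_Rintegral => p _; rewrite d_tau_div_v//.
exact: test_differentiable tphi _.
Qed.

End pairing.

Variable f : mkspace R -> R.
Hypothesis fL : LinfLinfL2 T f.

Definition mean_part : mkspace R -> R := kavg (slab T f) (fun _ _ => 1) \o unstraight.
Definition potential : mkspace R -> R := kavg (slab T f) kern \o unstraight.

Let m1 : measurable_fun setT (fun p : mR * mR => 1 : R).
Proof. exact: measurable_cst. Qed.

Let le11 (t s : R) : `|1 : R| <= 1.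
Proof. by rewrite normr1. Qed.

Lemma mean_part_LinfLinfL2 : LinfLinfL2 T mean_part.
Proof. exact: (kavg_slab_LinfLinfL2 fL m1 le11). Qed.

Lemma potential_LinfLinfL2 : LinfLinfL2 T potential.
Proof.
apply: (kavg_slab_LinfLinfL2 fL (@measurable_kern R) (@kern_le1 R)).
by move=> t s; rewrite /kern fracpartD1.
Qed.

Let mfp (g : mkspace R -> R) : LinfLinfL2 T g -> measurable_fun (kdom_period T) g.
Proof. by case=> mg _ _; apply: measurable_funS mg; [exact: measurable_kdom|exact: kdom_period_sub]. Qed.

Lemma mean_part_ker : transport_ker T M mean_part.
Proof.
split; first exact: mean_part_LinfLinfL2.
move=> phi tphi; rewrite Rintegral_transport//.
rewrite (@Rintegral_straight _ _ (kavg (slab T f) (fun _ _ => 1)) (mfp mean_part_LinfLinfL2) (measurable_transport tphi)); last 2 first.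
- by move=> q _; rewrite /mean_part /= straightK.
- by move=> y tau; exact: transport_time.
have [C [N [C0 _ HN]]] := test_strip tphi.
have mst := (@mpres_straight R).1.
rewrite (@kavg_mean_weak _ _ _ leb7 _ (measurable_slab fL) (@slab_eq0 _ T f) (slab_sq_lty T_gt0 fL)
  (phi \o straight) (transport phi \o straight) (cube7 N) C _ (is_derive_test tphi)).
- rewrite oppr0; under eq_Rintegral do rewrite /cst mul0r.
  by rewrite Rintegral_cst ?mul0r//; exact: measurable_kdom_period.
- exact: (measurableT_comp (measurable_transport tphi) mst).
- exact: continuous_transport_orbit.
- exact: measurable_cube7.
- exact: leb7_cube7.
- exact: C0.
- exact: HN.
- exact: test_orbit_period.
Qed.

Lemma remainder_im : transport_im T M (f \- mean_part).
Proof.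
split; first exact: LinfLinfL2B fL mean_part_LinfLinfL2.
exists potential; first exact: potential_LinfLinfL2.
move=> phi tphi; rewrite Rintegral_transport//.
rewrite (@Rintegral_straight potential (transport phi) (kavg (slab T f) kern) (mfp potential_LinfLinfL2) (measurable_transport tphi)); last 2 first.
- by move=> q _; rewrite /potential /= straightK.
- by move=> y tau; exact: transport_time.
rewrite (@Rintegral_straight (f \- mean_part) phi (slab T f \- kavg (slab T f) (fun _ _ => 1)) _ (measurable_test tphi)); first last.
- by move=> y tau; exact: test_time.
- move=> [y s] kq; rewrite /mean_part /= straightK slabE//; by case: kq => -[].
- by apply: mfp; exact: LinfLinfL2B fL mean_part_LinfLinfL2.
have [C [N [C0 HN HN']]] := test_strip tphi.
have mst := (@mpres_straight R).1.
rewrite (@kavg_kern_weak _ _ _ leb7 _ (measurable_slab fL) (@slab_eq0 _ T f) (slab_sq_lty T_gt0 fL)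
  (phi \o straight) (transport phi \o straight) (cube7 N) C _ _ (is_derive_test tphi)) ?opprK//.
- exact: (measurableT_comp (measurable_test tphi) mst).
- exact: (measurableT_comp (measurable_transport tphi) mst).
- exact: continuous_transport_orbit.
- exact: measurable_cube7.
- exact: leb7_cube7.
Qed.

End decomposition.

(** * Smooth bump functions *)

Section flat_function.
Context {R : realType}.

(* The derivatives of [exp (- 1 / x)] are of the form [P (1 / x) exp (- 1 / x)]. *)
Fixpoint flat_poly (n : nat) : {poly R} :=
  if n is m.+1 then (flat_poly m - (flat_poly m)^`()) * 'X^2 else 1.

Definition flat_of (P : {poly R}) (x : R) : R :=
  if 0 < x then P.[x^-1] * expR (- x^-1) else 0.

Definition flat (n : nat) : R -> R := flat_of (flat_poly n).

Lemma poly_bound (P : {poly R}) : exists C : R, 0 <= C /\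
  forall y, 1 <= y -> `|P.[y]| <= C * y ^+ size P.
Proof.
elim/poly_ind: P => [|P c [C [C0 IH]]].
  by exists 0; split => // y _; rewrite horner0 normr0 mul0r.
have [->|P0] := eqVneq P 0.
  exists `|c|; split => // y y1; rewrite mul0r add0r hornerC size_polyC.
  by rewrite ler_peMr// exprn_ege1.
exists (C + `|c|); split; first exact: addr_ge0.
move=> y y1; rewrite hornerMXaddC size_MXaddC (negbTE P0)/= mulrDl.
apply: (le_trans (ler_normD _ _)); apply: lerD.
  rewrite normrM (@ger0_norm _ y) ?exprSr ?mulrA; last by lra.
  by rewrite ler_wpM2r//; [lra|exact: IH].
by rewrite ler_peMr// exprn_ege1.
Qed.

(** The exponential beats a polynomial of size d with two powers to spare. Those two powers make
    every [flat n] differentiable at 0 with derivative 0. *)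
Lemma flat_of_quadratic (P : {poly R}) : exists C : R, 0 <= C /\
  forall x, x <= 1 -> `|flat_of P x| <= C * x ^+ 2.
Proof.
have [C [C0 HC]] := poly_bound P; set d := size P in HC.
exists (C * (d.+2)`!%:R); split; first by rewrite mulr_ge0.
move=> x x1; rewrite /flat_of; case: ifPn => [x0|_]; last first.
  by rewrite normr0 mulr_ge0 ?sqr_ge0// mulr_ge0.
have y1 : 1 <= x^-1 by rewrite -invr1 lef_pV2 ?posrE.
have y0 : 0 <= x^-1 by lra.
rewrite normrM (@ger0_norm _ (expR _)) ?expR_ge0//.
apply: (le_trans (ler_wpM2r (expR_ge0 _) (HC _ y1))).
rewrite -!mulrA ler_wpM2l// expRN.
rewrite ler_pdivrMr ?expR_gt0//.
have xx : x ^+ 2 * (x^-1) ^+ d.+2 = (x^-1) ^+ d.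
  by rewrite -(add2n d) exprD mulrA -exprMn divff ?gt_eqF// expr1n mul1r.
rewrite -xx [leRHS]mulrAC [leRHS]mulrC ler_wpM2l ?sqr_ge0//.
(* The term of order d + 2 of the exponential series at 1/x: d powers control the polynomial, the
   other two give x^2. *)
have := expR_ge1Dxn d.+1 y0.
have F0 : 0 < (d.+2)`!%:R :> R by rewrite ltr0n fact_gt0.
rewrite -(ler_pM2l F0) mulrDr mulr1 mulrCA divff ?gt_eqF// mulr1 => h.
by apply: le_trans h; rewrite lerDr ltW.
Qed.

Lemma is_derive_quadratic (f : R -> R) (C : R) : 0 <= C ->
  (forall x, x <= 1 -> `|f x| <= C * x ^+ 2) -> is_derive 0 (1 : R) f 0.
Proof.
move=> C0 H; have f0 : f 0 = 0.
  by apply/normr0_eq0/le_anti; rewrite normr_ge0 andbT (le_trans (H _ _))// expr0n mulr0.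
have c : f z / z @[z --> (0 : R)] --> (0 : R).
  apply/cvgrPdist_le => e e0.
  have C1 : 0 < C + 1 by lra.
  near=> z; rewrite sub0r normrN.
  have [->|z0] := eqVneq z 0; first by rewrite invr0 mulr0 normr0 ltW.
  rewrite normrM normfV ler_pdivrMr ?normr_gt0//.
  apply: (le_trans (H _ _)).
    apply: le_trans (ler_norm z) _.
    by near: z; exact: (@nbhs0_le R R 1 ltr01).
  rewrite -(@real_normK _ z) ?num_real// expr2 mulrA ler_wpM2r//.
  have : `|z| <= e / (C + 1) by near: z; exact: (@nbhs0_le R R _ (divr_gt0 e0 C1)).
  rewrite ler_pdivlMr// => h; apply: le_trans h.
  by rewrite mulrC ler_wpM2l// lerDl.
(* At z = 0 the slope f z / z equals 0 by the convention on the inverse of 0, which is exactly the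
   value of the derivative. *)
apply/is_derive1_caratheodory; exists (fun z => f z / z); split.
- move=> z; rewrite f0 !subr0; have [->|z0] := eqVneq z 0; first by rewrite f0 mulr0.
  by rewrite divfK.
- by rewrite /prop_for /continuous_at [X in _ --> X](_ : _ = 0) //= invr0 mulr0.
by rewrite invr0 mulr0.
Unshelve. all: by end_near.
Qed.

Lemma is_derive_flat n (x : R) : is_derive x (1 : R) (flat n) (flat n.+1 x).
Proof.
have [x0|x0|<-] := ltgtP 0 x.
- have d : is_derive x (1 : R) (fun x => (flat_poly n).[x^-1] * expR (- x^-1))
     (flat n.+1 x).
    have dV : is_derive x (1 : R) (fun x => x^-1) (- x ^- 2).
      have := is_deriveV (f := id) (lt0r_neq0 x0) (is_derive_id x (1 : R)).
      by move=> h; apply: (is_derive_eq h); rewrite /GRing.scale/= mulr1.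
    have d1 := is_derive1_comp (is_derive_poly (flat_poly n) x^-1) dV.
    have d2 := @is_derive1_comp _ expR (fun x => - x^-1) x _ _ (is_derive_expR (- x^-1)) (is_deriveN dV).
    apply: (is_derive_eq (is_deriveM d1 d2)).
    rewrite /flat /flat_of x0 /= /GRing.scale/= hornerM hornerXn hornerD hornerN opprK exprVn.
    ring.
  apply: near_eq_is_derive d; near=> z.
  rewrite /flat /flat_of ifT//.
  by near: z; exact: lt_nbhsr.
- have -> : flat n.+1 x = 0 by rewrite /flat /flat_of ltNge ltW.
  apply: (near_eq_is_derive (f := cst (0 : R))).
  near=> z; rewrite /flat /flat_of ltNge ltW//.
  by near: z; exact: lt_nbhsl.
have -> : flat n.+1 0 = 0 by rewrite /flat /flat_of ltxx.
have [C [C0 HC]] := flat_of_quadratic (flat_poly n).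
exact: is_derive_quadratic C0 HC.
Unshelve. all: by end_near.
Qed.

Lemma flat0E (x : R) : flat 0 x = if 0 < x then expR (- x^-1) else 0.
Proof. by rewrite /flat /flat_of; case: ifP => // _; rewrite hornerC mul1r. Qed.

Lemma flat0_ge0 (x : R) : 0 <= flat 0 x.
Proof. by rewrite flat0E; case: ifP => // _; exact: expR_ge0. Qed.

Lemma flat0_le1 (x : R) : flat 0 x <= 1.
Proof. by rewrite flat0E; case: ifP => // x0; rewrite expR_le1 oppr_le0 invr_ge0 ltW. Qed.

Lemma flat0_le0 (x : R) : x <= 0 -> flat 0 x = 0.
Proof. by rewrite flat0E ltNge => ->. Qed.

Lemma cvg_flat0 (u : nat -> R) : (forall K : R, \forall n \near \oo, K <= u n) ->
  flat 0 (u n) @[n --> \oo] --> (1 : R).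
Proof.
move=> uoo; rewrite -[X in _ --> X](@expR0 R) -oppr0.
apply: (@cvg_trans _ ((expR (- (u n)^-1)) @[n --> \oo])).
  apply: near_eq_cvg; near=> n; rewrite flat0E ifT//.
  by apply: (@lt_le_trans _ _ 1) => //; near: n; exact: uoo.
apply: continuous_cvg; first exact: continuous_expR.
apply: cvgN; apply/cvgrPdist_le => e e0; near=> n.
have h : e^-1 <= u n by near: n; exact: uoo.
have un0 : 0 < u n by apply: lt_le_trans h; rewrite invr_gt0.
by rewrite sub0r normrN gtr0_norm ?invr_gt0// -[leRHS]invrK lef_pV2// posrE invr_gt0.
Unshelve. all: by end_near.
Qed.

End flat_function.

(** * A class of smooth functions stable under the constructions used *)

Section smooth_class.
Context {R : realType}.

(* The constructor [smoothc_comp] carries all the derivatives of the outer function, which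
   makes the class closed under directional derivatives. *)
Inductive smoothc (V : normedModType R) : (V -> R) -> Prop :=
| smoothc_cst (c : R) : smoothc (fun _ => c)
| smoothc_linear (L : V -> R) : linear (L : V -> R^o) -> continuous L -> smoothc L
| smoothc_add f g : smoothc f -> smoothc g -> smoothc (fun x => f x + g x)
| smoothc_mul f g : smoothc f -> smoothc g -> smoothc (fun x => f x * g x)
| smoothc_comp (beta : nat -> R -> R) n f :
    (forall m (x : R), is_derive x (1 : R) (beta m) (beta m.+1 x)) ->
    smoothc f -> smoothc (fun x => beta n (f x)).

Lemma smoothc_differentiable (V : normedModType R) (f : V -> R) p :
  smoothc f -> differentiable (f : V -> R^o) p.
Proof.
elim=> [c|L lL cL|{}f g _ df _ dg|{}f g _ df _ dg|beta n {}f dbeta _ df].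
- exact: differentiable_cst.
- pose LM := GRing.isLinear.Build _ _ _ _ (L : V -> R^o) lL.
  pose LL : {linear V -> R^o} := HB.pack (L : V -> R^o) LM.
  exact: (@linear_differentiable _ _ _ LL).
- exact: differentiableD.
- exact: differentiableM.
- apply: (@differentiable_comp _ _ _ _ f (beta n)) => //.
  by apply/derivable1_diffP; exact: (@ex_derive _ _ _ _ _ _ _ (dbeta n (f p))).
Qed.

Lemma smoothc_derive (V : normedModType R) (f : V -> R) u :
  smoothc f -> smoothc ('D_u (f : V -> R^o)).
Proof.
elim=> [c|L lL cL|{}f g sf Hf sg Hg|{}f g sf Hf sg Hg|beta n {}f dbeta sf Hf].
- rewrite (_ : 'D_u _ = fun _ => 0); first exact: smoothc_cst.
  by apply/funext => p; exact: derive_cst.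
- rewrite (_ : 'D_u _ = fun _ => L u); first exact: smoothc_cst.
  apply/funext => p; exact: (@derive_val _ _ _ _ _ _ _ (is_derive_linear p u lL cL)).
- rewrite (_ : 'D_u _ = fun p => 'D_u (f : V -> R^o) p + 'D_u (g : V -> R^o) p).
    exact: smoothc_add.
  apply/funext => p; apply: (@deriveD _ _ _ f g p u).
    by apply: diff_derivable; exact: smoothc_differentiable.
  by apply: diff_derivable; exact: smoothc_differentiable.
- rewrite (_ : 'D_u _ = fun p => f p * 'D_u (g : V -> R^o) p + g p * 'D_u (f : V -> R^o) p).
    by apply: smoothc_add; exact: smoothc_mul.
  apply/funext => p; apply: (@deriveM _ _ f g p u).
    by apply: diff_derivable; exact: smoothc_differentiable.
  by apply: diff_derivable; exact: smoothc_differentiable.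
- rewrite (_ : 'D_u _ = fun p => beta n.+1 (f p) * 'D_u (f : V -> R^o) p).
    by apply: smoothc_mul => //; exact: smoothc_comp.
  apply/funext => p.
  have dfp := smoothc_differentiable p sf.
  have db := @ex_derive _ _ _ _ _ _ _ (dbeta n (f p)).
  have db' : differentiable (beta n) (f p) by exact/derivable1_diffP.
  rewrite deriveE; last exact: (@differentiable_comp _ _ _ _ f (beta n)).
  rewrite (@diff_comp _ _ _ _ f (beta n))//= deriveE//.
  rewrite diff1E// derive1E (@derive_val _ _ _ _ _ _ _ (dbeta n (f p))).
  exact: mulrC.
Qed.

Lemma smoothc_smooth (V : normedModType R) (f : V -> R) : smoothc f -> smooth f.
Proof.
move=> sf us p; apply: smoothc_differentiable.
elim: us => [//|u us IH] /=; exact: smoothc_derive.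
Qed.

Lemma smoothc_id : smoothc (fun x : R => x).
Proof. by apply: smoothc_linear => // x; exact: cvg_id. Qed.

Fixpoint derivatives (f : R -> R) (n : nat) : R -> R :=
  if n is m.+1 then 'D_1 (derivatives f m : R -> R^o) else f.

Lemma is_derive_derivatives (f : R -> R) : smoothc f ->
  forall n (x : R), is_derive x (1 : R) (derivatives f n) (derivatives f n.+1 x).
Proof.
move=> sf n x.
have sn : smoothc (derivatives f n) by elim: n => [//|n IH] /=; exact: smoothc_derive.
by apply: DeriveDef => //; apply: diff_derivable; exact: smoothc_differentiable.
Qed.

Lemma smoothc_compose (V : normedModType R) (f : R -> R) (g : V -> R) :
  smoothc f -> smoothc g -> smoothc (fun x => f (g x)).
Proof. by move=> sf sg; exact: (@smoothc_comp V _ 0%N g (is_derive_derivatives sf) sg). Qed.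

Lemma smoothc_continuous (V : normedModType R) (f : V -> R) : smoothc f -> continuous f.
Proof. by move=> sf p; exact/differentiable_continuous/smoothc_differentiable. Qed.

Lemma smoothc_cos : smoothc (@cos R).
Proof.
(* Differentiating the cosine advances its argument by pi / 2, so a single formula describes the
   whole tower of derivatives. *)
pose beta n (x : R) := cos (x + (pi / 2) *+ n).
have db m (x : R) : is_derive x (1 : R) (beta m) (beta m.+1 x).
  have d : is_derive x (1 : R) (fun x => x + (pi / 2) *+ m) 1.
    have := is_deriveD (is_derive_id x (1 : R)) (is_derive_cst (((pi / 2) *+ m) : R) x 1).
    by move=> h; apply: (is_derive_eq h); rewrite addr0.
  have := @is_derive1_comp _ cos (fun x => x + (pi / 2) *+ m) x _ _ (is_derive_cos _) d.
  move=> h; apply: (is_derive_eq h); rewrite mulr1 /beta (mulrSr (pi / 2)) addrA.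
  by rewrite cosDpihalf.
have := @smoothc_comp R beta 0%N _ db smoothc_id.
by congr smoothc; apply/funext => x; rewrite /beta mulr0n addr0.
Qed.

Lemma smoothc_sin : smoothc (@sin R).
Proof.
have := smoothc_compose smoothc_cos (smoothc_add smoothc_id (smoothc_cst _ (- (pi / 2)))).
congr smoothc; apply/funext => x; rewrite cosB; first by rewrite cos_pihalf sin_pihalf mulr0 mulr1 add0r.
Qed.

Lemma smoothc_flat : smoothc (@flat R 0).
Proof. exact: (@smoothc_comp R _ 0%N _ (@is_derive_flat R) smoothc_id). Qed.

(** The fundamental theorem is available for integrals from a fixed left endpoint. Around a given x,
    the signed integral from 0 equals such an integral up to a constant, once the endpoint a lies
    below both x and 0. *)
Lemma antiderivative (e : R -> R) : continuous e ->
  exists E : R -> R, forall x : R, is_derive x (1 : R) E (e x).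
Proof.
move=> ce.
pose mu := @lebesgue_measure R.
pose F a x := \int[mu]_(t in `[a, x]) e t.
pose E x := if 0 <= x then F 0 x else - F x 0.
have split a x y : a <= x -> x <= y -> F a y - F a x = F x y.
  move=> ax xy; rewrite /F Rintegral_itvB//; first last.
  - exact: continuous_integrable_itv.
  - by rewrite Rintegral_itv_obnd_cbnd//; apply: (integrableS _ _ _ (continuous_integrable_itv x y ce)) => //; exact: subset_itv_oc_cc.
have EF a x : a < 0 -> a < x -> E x = F a x - F a 0.
  move=> a0 ax; rewrite /E; case: (leP 0 x) => x0; first by rewrite split// ltW.
  by rewrite -(split a x 0) ?ltW// opprB.
exists E => x.
pose a := Num.min x 0 - 1.
have ax : a < x by rewrite /a; case: (leP x 0); lra.
have a0 : a < 0 by rewrite /a; case: (leP x 0); lra.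
have x1 : x < x + 1 by rewrite ltrDl.
have [dF F'] := continuous_FTC1_closed x1 (continuous_integrable_itv a (x + 1) ce) ax (ce x).
apply: (near_eq_is_derive (f := fun x => F a x - F a 0)).
  by near=> z; rewrite (EF a z)//; near: z; exact: lt_nbhsr.
have dFa : is_derive x (1 : R) (F a) (e x).
  by apply: DeriveDef; [exact: dF|rewrite -derive1E; exact: F'].
have := is_deriveB dFa (is_derive_cst (F a 0 : R) x 1).
by move=> h; apply: (is_derive_eq h); rewrite subr0.
Unshelve. all: by end_near.
Qed.

(** Subtracting the mean makes E (x + 1) - E x, which has derivative 0, vanish at x = 0. E is smooth
    because it sits on top of the tower of derivatives of e - m. *)
Lemma periodic_primitive (e : R -> R) : smoothc e -> (forall x, e (x + 1) = e x) ->
  let m := \int[@lebesgue_measure R]_(x in `]0, 1[) e x in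
  exists E : R -> R, [/\ smoothc E, (forall x, E (x + 1) = E x) &
    forall x : R, is_derive x (1 : R) E (e x - m)].
Proof.
move=> se pe m.
have s1 : smoothc (fun x => e x + - m) by apply: smoothc_add => //; exact: smoothc_cst.
have c1 := smoothc_continuous s1.
have [E dE] := antiderivative c1.
exists E; split=> //.
  pose beta n := if n is k.+1 then derivatives (fun x => e x + - m) k else E.
  have db n (x : R) : is_derive x (1 : R) (beta n) (beta n.+1 x).
    case: n => [|n]; [exact: dE|exact: is_derive_derivatives].
  exact: (@smoothc_comp R beta 0%N _ db smoothc_id).
have dD (x : R) : is_derive x (1 : R) (fun x => E (x + 1) - E x) 0.
  have dx : is_derive x (1 : R) (fun x => x + 1) 1.
    have := is_deriveD (is_derive_id x (1 : R)) (is_derive_cst (1 : R) x 1).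
    by move=> h; apply: (is_derive_eq h); rewrite addr0.
  have := is_deriveB (@is_derive1_comp _ E (fun x => x + 1) x _ _ (dE (x + 1)) dx) (dE x).
  by move=> h; apply: (is_derive_eq h); rewrite pe mulr1 subrr.
move=> x; apply/eqP; rewrite -subr_eq0; apply/eqP.
have := @is_derive_0_is_cst _ (fun x => E (x + 1) - E x) x 0 dD; rewrite /= => ->; rewrite add0r.
rewrite -(Rintegral_derivative dE c1 ltr01).
have icc (f : R -> R) : continuous f -> (@lebesgue_measure R).-integrable `]0, 1[ (EFin \o f).
  by move=> cf; apply: (integrableS _ _ _ (continuous_integrable_itv 0 1 cf)) => //; exact: subset_itv_oo_cc.
rewrite RintegralD//; [|by apply: icc; exact: smoothc_continuous|by apply: icc => y; exact: cvg_cst].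
rewrite -/m Rintegral_cst// [X in fine X]lebesgue_measure_itv/= lte_fin ltr01 oppr0 adde0 mulr1.
exact: subrr.
Qed.

End smooth_class.

(** * Test functions concentrated on boxes *)

Section bumps.
Context {R : realType}.
Local Notation V := (kspace R).
Local Notation Y := (R * (R3 R * R3 R))%type.

(** The shift by 1 keeps the bump zero outside [a + 1/(n+1), b - 1/(n+1)], a compact part of the
    open interval; the factor n + 1 makes the bumps tend to the indicator. *)
Definition bump (a b : R) (n : nat) (s : R) : R :=
  flat 0 (n.+1%:R * (s - a) - 1) * flat 0 (n.+1%:R * (b - s) - 1).

Lemma smoothc_bump a b n : smoothc (bump a b n).
Proof.
have sa (c d : R) : smoothc (fun s : R => c * s + d).
  by apply: smoothc_add; [apply: smoothc_mul; [exact: smoothc_cst|exact: smoothc_id]|exact: smoothc_cst].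
have := smoothc_mul
  (smoothc_compose smoothc_flat (sa n.+1%:R (- (n.+1%:R * a) - 1)))
  (smoothc_compose smoothc_flat (sa (- n.+1%:R) (n.+1%:R * b - 1))).
by congr smoothc; apply/funext => s; rewrite /bump; congr (flat 0 _ * flat 0 _); ring.
Qed.

Lemma bump_ge0 a b n s : 0 <= bump a b n s.
Proof. by rewrite mulr_ge0// flat0_ge0. Qed.

Lemma bump_le1 a b n s : bump a b n s <= 1.
Proof. by rewrite /bump -[leRHS]mulr1 ler_pM// ?flat0_ge0 ?flat0_le1. Qed.

Lemma bump_support a b n s : bump a b n s != 0 -> a + n.+1%:R^-1 <= s <= b - n.+1%:R^-1.
Proof.
rewrite mulf_eq0 negb_or => /andP[h1 h2].
have n0 : 0 < n.+1%:R :> R by [].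
have p1 : 0 < n.+1%:R * (s - a) - 1 by rewrite ltNge; apply/negP => /flat0_le0 h; rewrite h eqxx in h1.
have p2 : 0 < n.+1%:R * (b - s) - 1 by rewrite ltNge; apply/negP => /flat0_le0 h; rewrite h eqxx in h2.
have q (c : R) : 0 < n.+1%:R * c - 1 -> n.+1%:R^-1 <= c.
  by rewrite subr_gt0 => h; rewrite -[leLHS]mulr1 ler_pdivrMl// ltW.
have := q _ p1; have := q _ p2.
by move: (n.+1%:R^-1) => N h3 h4; apply/andP; split; lra.
Qed.

Lemma bump_itv a b n s : bump a b n s != 0 -> a < s < b.
Proof.
move=> /bump_support; have n0 : 0 < n.+1%:R^-1 :> R by rewrite invr_gt0.
move: (n.+1%:R^-1) n0 => N n0 /andP[h1 h2].
by apply/andP; split; lra.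
Qed.

Lemma cvg_bump a b s : bump a b n s @[n --> \oo] --> (\1_`]a, b[ s : R).
Proof.
rewrite indicE; have [/andP[sa sb]|nab] := boolP (a < s < b).
  rewrite mem_set/=; last by rewrite in_itv/= sa sb.
  rewrite -[X in _ --> X](mulr1 1).
  have K (c : R) : 0 < c -> flat 0 (n.+1%:R * c - 1) @[n --> \oo] --> (1 : R).
    move=> c0; apply: cvg_flat0 => M.
    have := nbhs_infty_ger ((M + 1) / c); apply: filterS => n /= h.
    rewrite lerBrDr -ler_pdivrMr//; apply: (le_trans h).
    by rewrite ler_nat.
  by apply: cvgM; apply: K; lra.
rewrite memNset/=; last by rewrite in_itv/=; exact/negP.
rewrite (_ : (fun n => _) = fun _ => 0); first exact: cvg_cst.
by apply/funext => n; apply/eqP; apply: contraNT nab => /bump_itv.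
Qed.

Definition bump3 (l h : R3 R) n (v : R3 R) : R :=
  bump l.1.1 h.1.1 n v.1.1 * bump l.1.2 h.1.2 n v.1.2 * bump l.2 h.2 n v.2.

Definition bump7 (l h : Y) n (y : Y) : R :=
  bump l.1 h.1 n y.1 * (bump3 l.2.1 h.2.1 n y.2.1 * bump3 l.2.2 h.2.2 n y.2.2).

Definition box3 (l h : R3 R) : set (R3 R) :=
  (`]l.1.1, h.1.1[ `*` `]l.1.2, h.1.2[) `*` `]l.2, h.2[.

Definition box7 (l h : Y) : set Y :=
  `]l.1, h.1[ `*` (box3 l.2.1 h.2.1 `*` box3 l.2.2 h.2.2).

Lemma indicX (A B : Type) (S : set A) (S' : set B) p :
  \1_(S `*` S') p = \1_S p.1 * \1_S' p.2 :> R.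
Proof.
by case: p => a b; rewrite !indicE in_setX /=; case: (_ \in _); case: (_ \in _); rewrite ?(mulr1, mulr0).
Qed.

Lemma cvg_bump3 l h v : bump3 l h n v @[n --> \oo] --> (\1_(box3 l h) v : R).
Proof. by rewrite /box3 !indicX; apply: cvgM; [apply: cvgM|]; exact: cvg_bump. Qed.

Lemma cvg_bump7 l h y : bump7 l h n y @[n --> \oo] --> (\1_(box7 l h) y : R).
Proof.
have -> : \1_(box7 l h) y = \1_`]l.1, h.1[ y.1 *
    (\1_(box3 l.2.1 h.2.1) y.2.1 * \1_(box3 l.2.2 h.2.2) y.2.2) :> R.
  by rewrite /box7 indicX; congr (_ * _); rewrite indicX.
apply: cvgM; first exact: cvg_bump.
by apply: cvgM; exact: cvg_bump3.
Qed.

Let mul_neq0 (a b : R) : a * b != 0 -> a != 0 /\ b != 0.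
Proof. by rewrite mulf_eq0 negb_or => /andP[]. Qed.

Lemma bump3_box l h n v : bump3 l h n v != 0 -> box3 l h v.
Proof.
move=> /mul_neq0[/mul_neq0[h1 h2] h3].
by split; [split|]; rewrite /= in_itv/=; [exact: bump_itv h1|exact: bump_itv h2|exact: bump_itv h3].
Qed.

Lemma bump7_neq0 l h n y : bump7 l h n y != 0 ->
  bump l.1 h.1 n y.1 != 0 /\ box3 l.2.1 h.2.1 y.2.1 /\ box3 l.2.2 h.2.2 y.2.2.
Proof.
move=> /mul_neq0[h1 /mul_neq0[h2 h3]].
by split=> //; split; apply: bump3_box; [exact: h2|exact: h3].
Qed.

Lemma bump7_le1 l h n y : `|bump7 l h n y| <= 1.
Proof.
have b (a c s : R) : `|bump a c n s| <= 1 by rewrite ger0_norm ?bump_ge0 ?bump_le1.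
have b2 (x z : R) : `|x| <= 1 -> `|z| <= 1 -> `|x * z| <= 1.
  by move=> x1 z1; rewrite normrM -[leRHS]mulr1 ler_pM.
have b3 (a c v : R3 R) : `|bump3 a c n v| <= 1.
  by apply: (b2); [apply: (b2); exact: b|exact: b].
by apply: (b2); [exact: b|apply: (b2); exact: b3].
Qed.

(** The product E(tau) b(t, x, w) written in the original variables, with w recovered from v by the
    inverse rotation. *)
Definition rotated_test (E : R -> R) (l h : Y) n (p : V) : R :=
  E p.1.2 * bump7 l h n (p.1.1, (p.2.1, larmor (- p.1.2) p.2.2)).

Lemma rotated_test_orbit E l h n y tau :
  rotated_test E l h n (orbit_point y tau) = E tau * bump7 l h n y.
Proof. by rewrite /rotated_test /= larmorK; case: y => ? []. Qed.

Lemma smoothc_rotated_test E l h n : smoothc E -> smoothc (rotated_test E l h n).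
Proof.
move=> sE.
have lin (L : V -> R) : (forall a x y, L (a *: x + y) = a * L x + L y) ->
  continuous L -> smoothc L by move=> H; exact: smoothc_linear.
have st : smoothc (fun p : V => p.1.1).
  by apply: lin => [//|p]; apply: (@continuous_comp _ _ _ fst fst); exact: cvg_fst.
have stau : smoothc (fun p : V => p.1.2).
  by apply: lin => [//|p]; apply: (@continuous_comp _ _ _ fst snd); [exact: cvg_fst|exact: cvg_snd].
have c21 : continuous (fun p : V => p.2.1).
  by move=> p; apply: (@continuous_comp _ _ _ snd fst); [exact: cvg_snd|exact: cvg_fst].
have c22 : continuous (fun p : V => p.2.2).
  by move=> p; apply: (@continuous_comp _ _ _ snd snd); exact: cvg_snd.
have c3 (g : V -> R3 R) : continuous g -> [/\ continuous (fun p => (g p).1.1),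
    continuous (fun p => (g p).1.2) & continuous (fun p => (g p).2)].
  move=> cg; have cg1 : continuous (fun p => (g p).1).
    by move=> p; apply: (@continuous_comp _ _ _ g fst); [exact: cg|exact: cvg_fst].
  split=> p.
  - by apply: (@continuous_comp _ _ _ (fun p => (g p).1) fst); [exact: cg1|exact: cvg_fst].
  - by apply: (@continuous_comp _ _ _ (fun p => (g p).1) snd); [exact: cg1|exact: cvg_snd].
  - by apply: (@continuous_comp _ _ _ g snd); [exact: cg|exact: cvg_snd].
have [cx1 cx2 cx3] := c3 _ c21; have [cv1 cv2 cv3] := c3 _ c22.
have sx1 := lin (fun p : V => p.2.1.1.1) (fun _ _ _ => erefl) cx1.
have sx2 := lin (fun p : V => p.2.1.1.2) (fun _ _ _ => erefl) cx2.
have sx3 := lin (fun p : V => p.2.1.2) (fun _ _ _ => erefl) cx3.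
have sv1 := lin (fun p : V => p.2.2.1.1) (fun _ _ _ => erefl) cv1.
have sv2 := lin (fun p : V => p.2.2.1.2) (fun _ _ _ => erefl) cv2.
have sv3 := lin (fun p : V => p.2.2.2) (fun _ _ _ => erefl) cv3.
have sth : smoothc (fun p : V => 2 * pi * - p.1.2).
  have := smoothc_mul (smoothc_cst V (- (2 * pi))) stau.
  by congr smoothc; apply/funext => p; rewrite mulNr mulrN.
have sc := smoothc_compose smoothc_cos sth.
have ss := smoothc_compose smoothc_sin sth.
have sw2 := smoothc_add (smoothc_mul sc sv2) (smoothc_mul ss sv3).
have sw3 := smoothc_add (smoothc_mul sc sv3) (smoothc_mul (smoothc_cst V (-1)) (smoothc_mul ss sv2)).
have B a b (c : V -> R) : smoothc c -> smoothc (fun p => bump a b n (c p)).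
  exact: smoothc_compose (smoothc_bump a b n).
have := smoothc_mul (smoothc_compose sE stau)
  (smoothc_mul (B l.1 h.1 _ st)
  (smoothc_mul
    (smoothc_mul (smoothc_mul (B l.2.1.1.1 h.2.1.1.1 _ sx1) (B l.2.1.1.2 h.2.1.1.2 _ sx2)) (B l.2.1.2 h.2.1.2 _ sx3))
    (smoothc_mul (smoothc_mul (B l.2.2.1.1 h.2.2.1.1 _ sv1) (B l.2.2.1.2 h.2.2.1.2 _ sw2)) (B l.2.2.2 h.2.2.2 _ sw3)))).
by congr smoothc; apply/funext => p; rewrite mulN1r.
Qed.

Lemma rotated_test_function T (E : R -> R) l h n N : smoothc E -> (forall x, E (x + 1) = E x) ->
  0 <= l.1 -> h.1 <= T -> box3 l.2.1 h.2.1 `<=` cube3 N -> box3 l.2.2 h.2.2 `<=` cube3 N ->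
  test_function T (rotated_test E l h n).
Proof.
move=> sE pE l0 hT HN1 HN2; split; first exact/smoothc_smooth/smoothc_rotated_test.
  move=> t tau z; rewrite /rotated_test /= pE.
  by rewrite -[in LHS](larmorD1 (- (tau + 1))) opprD subrK.
pose d : R := n.+1%:R^-1.
have d0 : 0 < d by rewrite invr_gt0.
pose B : set R := `[- (2 * `|N|), 2 * `|N|]%classic.
pose B3 : set (R3 R) := (B `*` B) `*` B.
have cB : compact B by exact: segment_compact.
have cB3 : compact B3 by do 2 apply: compact_setX => //.
(* The margin d of the bump keeps the support away from the times 0 and T. A cube for w gives one of
   twice the side for v, whatever tau. *)
exists ((`[l.1 + d, h.1 - d]%classic : set R) `*` (B3 `*` B3)); split.
- apply: compact_setX; first exact: segment_compact.
  exact: compact_setX.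
- move=> [t z] [/= + _]; rewrite !in_itv/= => /andP[h1 h2].
  by split => //=; rewrite ?in_itv/=; apply/andP; split; lra.
move=> t tau z; apply: contra_notP => /eqP; rewrite mulf_eq0 negb_or => /andP[_].
move=> /bump7_neq0[/= /bump_support tb [/HN1 xN /HN2 wN]].
have NN : N <= `|N| by exact: ler_norm.
have cB3' (v : R3 R) : cube3 (2 * N) v -> B3 v.
  move=> /cube3P[h1 h2 h3].
  by split; [split|]; rewrite /B/= in_itv/= -ler_norml; lra.
split; first by rewrite /= in_itv.
split => /=; apply: cB3'.
  by rewrite -(larmor0 z.1); exact: larmor_cube3.
by rewrite -(larmorNK tau z.2); exact: larmor_cube3.
Qed.

End bumps.

(** * Uniqueness of the decomposition *)

Section determining_classes.
Context d0 (Om : measurableType d0) (R : realType).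
Variable mu : {measure set Om -> \bar R}.
Variable w : Om -> R.
Hypothesis iw : mu.-integrable setT (EFin \o w).

Definition vanishing (A : set Om) := (\int[mu]_(x in A) (w x)%:E = 0)%E.

(* The side set [D] lets generators be combined one coordinate at a time, without
   computing a generating family of the product sigma-algebra. *)
Definition determining d (X : measurableType d) (kap : Om -> X) (G : set (set X)) :=
  [/\ measurable_fun setT kap, G `<=` measurable &
  forall D, measurable D -> (forall A, G A -> vanishing (D `&` kap @^-1` A)) ->
    forall A, measurable A -> vanishing (D `&` kap @^-1` A)].

Let iwS A : measurable A -> mu.-integrable A (EFin \o w).
Proof. by move=> mA; exact: integrableS iw. Qed.

(** A Dynkin class argument. Since w is integrable, [vanishing] passes to disjoint unions; the
    member [setT] of G gives it for D itself, whence for complements by subtraction. *)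
Lemma determining_pi_system d (X : measurableType d) (kap : Om -> X) (G : set (set X)) :
  measurable_fun setT kap -> @measurable _ X = <<s G >> -> setI_closed G -> G setT ->
  determining kap G.
Proof.
move=> mk mG GI GT.
have mpre A : measurable A -> measurable (kap @^-1` A).
  by move=> mA; rewrite -[X in measurable X]setTI; exact: mk.
split=> //; first by move=> A GA; rewrite mG; exact: sub_sigma_algebra.
move=> D mD H A mA.
apply: (@dynkin_induction _ X G (fun A => vanishing (D `&` kap @^-1` A))) => //.
- exact: H.
- move=> S mS vS.
  have mDS : measurable (D `&` kap @^-1` S) by apply: measurableI => //; exact: mpre.
  have mDCS : measurable (D `&` kap @^-1` (~` S)) by apply: measurableI => //; apply: mpre; exact: measurableC.
  have DE : (D `&` kap @^-1` S) `|` (D `&` kap @^-1` (~` S)) = D.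
    by rewrite -setIUr -preimage_setU setUv preimage_setT setIT.
  have := H _ GT; rewrite preimage_setT setIT /vanishing -{1}DE.
  rewrite integral_setU_EFin//.
  + by rewrite [X in (X + _)%E]vS add0e.
  + by rewrite DE; apply/measurable_EFinP; apply: measurable_int; exact: iwS.
  + by apply/disj_setPS => x [[_ /= Sx] [_ /=]].
- move=> F mF tF vF; rewrite /vanishing preimage_bigcup setI_bigcupr.
  rewrite integral_bigcup.
  + by apply: eseries0 => i _ _; exact: vF.
  + apply/trivIsetP => i j _ _ ij; apply/seteqP; split=> // x [[_ /= Fi] [_ /= Fj]].
    move/trivIsetP : tF => /(_ i j Logic.I Logic.I ij) E.
    by have : (F i `&` F j) (kap x) by []; rewrite E.
  + by move=> i; apply: measurableI => //; exact: mpre.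
  + apply: iwS; rewrite -setI_bigcupr -preimage_bigcup; apply: measurableI => //.
    by apply: mpre; exact: bigcupT_measurable.
- by rewrite -mG.
Qed.

(** The first factor is freed with the constraint on the second put into the side set, then the
    roles are exchanged. Measurable rectangles then form a generating pi-system. *)
Lemma determining_prod d1 d2 (X : measurableType d1) (Y : measurableType d2)
    (k1 : Om -> X) (k2 : Om -> Y) (G1 : set (set X)) (G2 : set (set Y)) :
  determining k1 G1 -> determining k2 G2 ->
  determining (fun x => (k1 x, k2 x)) [set A `*` B | A in G1 & B in G2].
Proof.
move=> [mk1 mG1 H1] [mk2 mG2 H2].
have mk : measurable_fun setT (fun x => (k1 x, k2 x)) by exact: measurable_fun_pair.
have mp1 A : measurable A -> measurable (k1 @^-1` A).
  by move=> mA; rewrite -[X in measurable X]setTI; exact: mk1.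
have mp2 A : measurable A -> measurable (k2 @^-1` A).
  by move=> mA; rewrite -[X in measurable X]setTI; exact: mk2.
split=> //.
  by move=> _ [A GA [B GB <-]]; apply: measurableX; [exact: mG1|exact: mG2].
move=> D mD H.
have E1 A B : D `&` (fun x => (k1 x, k2 x)) @^-1` (A `*` B) = (D `&` k2 @^-1` B) `&` k1 @^-1` A.
  by apply/seteqP; split=> x /=; [move=> [? [? ?]]|move=> [[? ?] ?]].
have E2 A B : D `&` (fun x => (k1 x, k2 x)) @^-1` (A `*` B) = (D `&` k1 @^-1` A) `&` k2 @^-1` B.
  by rewrite E1 -!setIA (setIC (k2 @^-1` B)).
have step1 A B : measurable A -> G2 B -> vanishing (D `&` (fun x => (k1 x, k2 x)) @^-1` (A `*` B)).
  move=> mA GB; rewrite E1; apply: H1 => //.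
    by apply: measurableI => //; apply: mp2; exact: mG2.
  by move=> A' GA'; rewrite -E1; apply: H; exists A' => //; exists B.
have step2 A B : measurable A -> measurable B -> vanishing (D `&` (fun x => (k1 x, k2 x)) @^-1` (A `*` B)).
  move=> mA mB; rewrite E2; apply: H2 => //.
    by apply: measurableI => //; exact: mp1.
  by move=> B' GB'; rewrite -E2; exact: step1.
pose G : set (set (X * Y)) := [set A `*` B | A in measurable & B in measurable].
have GI : setI_closed G.
  move=> _ _ [A mA [B mB <-]] [A' mA' [B' mB' <-]].
  exists (A `&` A'); first exact: measurableI.
  exists (B `&` B'); first exact: measurableI.
  by rewrite setXI.
have GT : G setT by exists setT => //; exists setT => //; rewrite setXTT.
have [_ _ H3] := @determining_pi_system _ (X * Y)%type (fun x => (k1 x, k2 x)) G mk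
  (measurable_prod_measurableType X Y) GI GT.
apply: H3 => // _ [A mA [B mB <-]].
exact: step2.
Qed.

(** [setT] is added because [determining_pi_system] asks for it. As all rays point the same way,
    only the lower corners of boxes have to vary. *)
Definition upper_rays : set (set R) := [set A | A = setT \/ exists x, A = `]x, +oo[%classic].

Lemma determining_rays (kap : Om -> measurableTypeR R) :
  measurable_fun setT kap -> determining kap (upper_rays : set (set (measurableTypeR R))).
Proof.
move=> mk; apply: determining_pi_system => //.
- apply/seteqP; split.
    have := @RGenOInfty.measurableE R => ->.
    apply: smallest_sub; first exact: smallest_sigma_algebra.
    by move=> A [x ->]; apply: sub_sigma_algebra; right; exists x.
  apply: smallest_sub; first exact: sigma_algebra_measurable.
  by move=> A [->|[x ->]]; [exact: measurableT|exact: measurable_itv].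
- move=> A B [->|[x ->]]; first by rewrite setTI.
  move=> [->|[y ->]]; first by rewrite setIT; right; exists x.
  right; exists (Num.max x y); apply/seteqP; split=> z /=; rewrite !in_itv/= !andbT gt_max.
    by move=> [-> ->].
  by move=> /andP[].
- by left.
Qed.

End determining_classes.

(** * A function orthogonal to all products vanishes *)

Section separation.
Context {R : realType}.
Variable T : R.
Hypothesis T_gt0 : 0 < T.
Local Notation leb := (@lebesgue_measure R).
Local Notation mR := (measurableTypeR R).
Local Notation I := (`]0%R, 1%R[%classic : set R).
Local Notation Y := (mR * mR6 R)%type.
Local Notation strip := (mR * mR6 R * mR)%type.
Local Notation sleb := (@sleb R).

Section periodic_bump.
Variable a : R.
Hypothesis a01 : 0 <= a <= 1.

(* A product of two antiperiodic factors: 1-periodic, and positive exactly on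
   [`]a, 1[] within a period. *)
Definition arc (t : R) : R := sin (pi * (t - a)) * sin (pi * (1 - t)).

Definition arc_bump (n : nat) (t : R) : R := flat 0 (n.+1%:R * arc t).

Lemma arcD1 t : arc (t + 1) = arc t.
Proof.
rewrite /arc (_ : pi * (t + 1 - a) = pi * (t - a) + pi); last by ring.
rewrite (_ : pi * (1 - t) = pi * (1 - (t + 1)) + pi); last by ring.
by rewrite !sinDpi mulNr mulrN.
Qed.

Lemma arc_gt0 t : I t -> (0 < arc t) = (a < t).
Proof.
rewrite /= in_itv/= => /andP[t0 t1]; have p0 := @pi_gt0 R.
move: a01 => /andP[a0 a1].
have s1 : 0 < sin (pi * (1 - t)).
  by apply: sin_gt0_pi; apply/andP; split; nra.
rewrite /arc pmulr_lgt0//; case: (ltP a t) => ta.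
  by apply: sin_gt0_pi; apply/andP; split; nra.
apply/negbTE; rewrite -leNgt -oppr_ge0 -sinN.
have [->|ta'] := eqVneq t a; first by rewrite subrr mulr0 oppr0 sin0.
have ta'' : t < a by rewrite lt_neqAle ta' ta.
by apply/ltW/sin_gt0_pi; apply/andP; split; nra.
Qed.

Lemma smoothc_arc_bump n : smoothc (arc_bump n).
Proof.
have sa (c d : R) : smoothc (fun s : R => c * s + d).
  by apply: smoothc_add; [apply: smoothc_mul; [exact: smoothc_cst|exact: smoothc_id]|exact: smoothc_cst].
have s1 := smoothc_compose smoothc_sin (sa pi (- (pi * a))).
have s2 := smoothc_compose smoothc_sin (sa (- pi) pi).
have := smoothc_compose smoothc_flat (smoothc_mul (smoothc_cst R n.+1%:R) (smoothc_mul s1 s2)).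
congr smoothc; apply/funext => t; rewrite /arc_bump /arc; congr (flat 0 (_ * (sin _ * sin _))); ring.
Qed.

Lemma arc_bumpD1 n t : arc_bump n (t + 1) = arc_bump n t.
Proof. by rewrite /arc_bump arcD1. Qed.

Lemma arc_bump_le1 n t : `|arc_bump n t| <= 1.
Proof. by rewrite ger0_norm ?flat0_ge0 ?flat0_le1. Qed.

Lemma cvg_arc_bump t : I t -> arc_bump n t @[n --> \oo] --> (\1_`]a, 1[ t : R).
Proof.
move=> It; rewrite indicE; have [at_|ta] := ltP a t.
  rewrite mem_set/=; last by move: It; rewrite /= !in_itv/= at_ => /andP[].
  have c0 : 0 < arc t by rewrite arc_gt0.
  apply: cvg_flat0 => M.
  have := nbhs_infty_ger (M / arc t); apply: filterS => n /= h.
  by rewrite -ler_pdivrMr// (le_trans h)// ler_nat.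
rewrite memNset/=; last by rewrite in_itv/= => /andP[]; rewrite ltNge ta.
rewrite (_ : (fun n => _) = fun _ => 0); first exact: cvg_cst.
apply/funext => n; apply: flat0_le0; rewrite pmulr_rle0//.
by rewrite leNgt arc_gt0// -leNgt.
Qed.

End periodic_bump.

Variable W : strip -> R.
Hypothesis mW : measurable_fun setT W.
Hypothesis WI : forall y s, ~ I s -> W (y, s) = 0.
Hypothesis WT : forall (y : Y) s, ~ `]0, T[%classic y.1 -> W (y, s) = 0.
Hypothesis Woo : (\int[sleb]_q (W q ^+ 2)%:E < +oo)%E.

(** The conditions under which [rotated_test_function] makes the bumps of the box into test
    functions. *)
Definition admissible (N : R) (l h : Y) :=
  [/\ 0 <= l.1, h.1 <= T, box3 l.2.1 h.2.1 `<=` cube3 N & box3 l.2.2 h.2.2 `<=` cube3 N].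

Hypothesis Wker : forall (E E' : R -> R) N l h n, admissible N l h ->
  smoothc E -> (forall x, E (x + 1) = E x) ->
  (forall x : R, is_derive x (1 : R) E (E' x)) ->
  \int[sleb]_q (W q * ((E' q.2 * bump7 l h n q.1) * \1_I q.2)) = 0.
Hypothesis Wim : forall N l h n, admissible N l h ->
  \int[sleb]_q (W q * (bump7 l h n q.1 * \1_I q.2)) = 0.

Let WI1 : (\int[sleb]_q ((W q * \1_I q.2) ^+ 2)%:E < +oo)%E.
Proof.
rewrite (eq_integral (fun q => (W q ^+ 2)%:E))// => -[y s] _ /=.
rewrite indicE; have [Is|nIs] := pselect (I s); last by rewrite WI// mul0r.
by rewrite mem_set// mulr1.
Qed.

Lemma measurable_bump7 l h n : measurable_fun setT (fun q : strip => bump7 l h n q.1).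
Proof.
have mb (a b : R) : measurable_fun setT (bump a b n).
  by apply: continuous_measurable_fun; exact: smoothc_continuous (smoothc_bump a b n).
have mc (f : strip -> R) (a b : R) : measurable_fun setT f -> measurable_fun setT (fun q => bump a b n (f q)).
  by move=> mf; exact: (measurableT_comp (mb a b) mf).
have m3 (f : strip -> R3 R) l' h' : measurable_fun setT (f : strip -> mR3 R) ->
   measurable_fun setT (fun q => bump3 l' h' n (f q)).
  move=> mf; apply: measurable_funM; [apply: measurable_funM|]; apply: mc.
  - by do 2 apply: measurableT_comp => //.
  - by do 2 apply: measurableT_comp => //.
  - by apply: measurableT_comp => //.
apply: measurable_funM; first by apply: mc; apply: measurableT_comp.
by apply: measurable_funM; apply: m3; do 2 apply: measurableT_comp => //.
Qed.

(** The half-side N + T is large enough for the space and velocity coordinates and also for the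
    times of ]0, T[. *)
Lemma admissible_cube N l h : admissible N l h -> 0 <= N -> box7 l h `<=` cube7 (N + T).
Proof.
move=> [l0 hT HN1 HN2] N0 [t [x w]] [/= tlh [/= /HN1 xN /HN2 wN]].
have c v : cube3 N v -> cube3 (N + T) v.
  have NT : N <= N + T by rewrite lerDl ltW.
  by move=> /cube3P[h1 h2 h3]; apply/cube3P; split; apply: le_trans NT.
split; last by split; exact: c.
by move: tlh; rewrite /= !in_itv/= => /andP[? ?]; apply/andP; split; lra.
Qed.

Lemma bump7_cube N l h n y : admissible N l h -> 0 <= N -> `|bump7 l h n y| <= \1_(cube7 (N + T)) y.
Proof.
move=> lh N0; rewrite indicE; have [yN|yN] := pselect (cube7 (N + T) y).
  by rewrite mem_set// bump7_le1.
rewrite memNset//; have [->|nz] := eqVneq (bump7 l h n y) 0; first by rewrite normr0.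
have [h1 [h2 h3]] := bump7_neq0 nz.
case: yN; apply: (admissible_cube lh N0); split=> //.
by rewrite /= in_itv/=; exact: bump_itv h1.
Qed.

Lemma strip_orthogonal (e : R -> R) N l h n : 0 <= N -> admissible N l h ->
  smoothc e -> (forall x, e (x + 1) = e x) ->
  \int[sleb]_q (W q * ((e q.2 * bump7 l h n q.1) * \1_I q.2)) = 0.
Proof.
move=> N0 lh se pe.
have [E [sE pE dE]] := periodic_primitive se pe.
set m := \int[_]_(x in _) _ in dE.
have ker := Wker n lh sE pE dE.
have im := Wim n lh.
have me : measurable_fun setT (fun q : strip => e q.2 - m).
  apply: measurable_funB => //; apply: measurableT_comp => //.
  by apply: continuous_measurable_fun; exact: smoothc_continuous.
have [C C0 HC] : exists2 C : R, 0 <= C & forall t, I t -> `|e t - m| <= C.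
  have cn : {within `[0, 1], continuous (fun x => `|e x - m|)}.
    apply: continuous_subspaceT => x; apply: cvg_norm; apply: cvgB; last exact: cvg_cst.
    exact: smoothc_continuous.
  have [c _ Hc] := EVT_max (@ler01 R) cn.
  by exists `|e c - m| => // t It; apply: Hc; exact: subset_itv_oo_cc.
have mb := measurable_bump7 l h n.
have i1 : sleb.-integrable setT (EFin \o (fun q => W q * (((e q.2 - m) * bump7 l h n q.1) * \1_I q.2))).
  apply: (@strip_integrable _ _ _ leb7 (cube7 (N + T)) C (measurable_cube7 _) (leb7_cube7 _) C0 W
     (fun q => (e q.2 - m) * bump7 l h n q.1)) => //; first exact: measurable_funM.
  move=> y t It /=; rewrite normrM ler_pM//; first exact: HC.
  exact: bump7_cube.
have i2 : sleb.-integrable setT (EFin \o (fun q => W q * (bump7 l h n q.1 * \1_I q.2))).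
  apply: (@strip_integrable _ _ _ leb7 (cube7 (N + T)) 1 (measurable_cube7 _) (leb7_cube7 _) ler01 W
     (fun q => bump7 l h n q.1)) => //.
  by move=> y t It /=; rewrite mul1r; exact: bump7_cube.
transitivity (\int[sleb]_q ((W q * (((e q.2 - m) * bump7 l h n q.1) * \1_I q.2)) +
   m * (W q * (bump7 l h n q.1 * \1_I q.2)))).
  by apply: eq_Rintegral => q _; ring.
rewrite RintegralD//; last exact: (integrableZl measurableT m i2).
by rewrite RintegralZl// ker im mulr0 addr0.
Qed.

(** Dominated convergence, with majorant |W| on a fixed cube over one period. The arc bumps converge
    to the indicator inside the period, and W is zero outside it. *)
Lemma strip_box_null (a : R) N l h : 0 <= a <= 1 -> 0 <= N -> admissible N l h ->
  (\int[sleb]_q (W q * (\1_`]a, 1[ q.2 * \1_(box7 l h) q.1))%:E = 0)%E.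
Proof.
move=> a01 N0 lh.
pose f n q := (W q * ((arc_bump a n q.2 * bump7 l h n q.1) * \1_I q.2))%:E.
have mW1 : measurable_fun setT (fun q : strip => \1_I q.2 : R).
  have mI : measurable (I : set mR) by exact: measurable_itv.
  exact: (measurableT_comp (measurable_indic mI)).
have me n : measurable_fun setT (fun q : strip => arc_bump a n q.2).
  have ma : measurable_fun setT (arc_bump a n).
    by apply: continuous_measurable_fun; exact: smoothc_continuous (smoothc_arc_bump a n).
  exact: (measurableT_comp ma).
have mf n : measurable_fun setT (f n).
  apply/measurable_EFinP; apply: measurable_funM => //; apply: measurable_funM => //.
  by apply: measurable_funM => //; exact: measurable_bump7.
have mc7 := measurable_cube7 (N + T).
have mc1 : measurable_fun setT (fun q : strip => \1_(cube7 (N + T)) q.1 : R).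
  exact: (measurableT_comp (measurable_indic mc7)).
have i1 : sleb.-integrable setT (EFin \o (fun q => W q * (\1_(cube7 (N + T)) q.1 * \1_I q.2))).
  apply: (@strip_integrable _ _ _ leb7 (cube7 (N + T)) 1 mc7 (leb7_cube7 _) ler01 W
     (fun q => \1_(cube7 (N + T)) q.1)) => //.
  by move=> y t It /=; rewrite mul1r ger0_norm.
have dom n q : (`|f n q| <= `|(W q * (\1_(cube7 (N + T)) q.1 * \1_I q.2))%:E|)%E.
  rewrite /= lee_fin 2!(normrM (W q)) ler_wpM2l// 2!(normrM _ (\1_I q.2)) ler_wpM2r//.
  rewrite normrM -[leRHS]mul1r; apply: ler_pM => //; first exact: arc_bump_le1.
  by apply: (le_trans (bump7_cube _ _ lh N0)); exact: ler_norm.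
have fn0 n : (\int[sleb]_q f n q = 0)%E.
  have H := strip_orthogonal n N0 lh (smoothc_arc_bump a n) (arc_bumpD1 a n).
  have fi : sleb.-integrable setT (f n).
    by apply: (le_integrable measurableT (mf n) _ i1) => q _; exact: dom.
  by rewrite -[LHS]fineK; [congr EFin|exact: (integrable_fin_num measurableT fi)].
have cf q : f n q @[n --> \oo] --> (W q * (\1_`]a, 1[ q.2 * \1_(box7 l h) q.1))%:E.
  case: q => y s; apply/fine_cvgP; split; first exact: nearW.
  have [Is|nIs] := pselect (I s); last first.
    rewrite WI// mul0r (_ : _ \o _ = fun _ => 0); first exact: cvg_cst.
    by apply/funext => n; rewrite /= WI// mul0r.
  rewrite (_ : _ \o _ = fun n => W (y, s) * (arc_bump a n s * bump7 l h n y)); last first.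
    by apply/funext => n; rewrite /= indicE (mem_set Is) mulr1.
  apply: cvgM; first exact: cvg_cst.
  by apply: cvgM; [exact: cvg_arc_bump|exact: cvg_bump7].
have mlim : measurable_fun setT (fun q => (W q * (\1_`]a, 1[ q.2 * \1_(box7 l h) q.1))%:E).
  by apply: (emeasurable_fun_cvg f) => // q _; exact: cf.
have ig := integrable_abse i1.
have [_ _ D] := @dominated_convergence _ _ _ sleb setT measurableT f _ _ mf mlim
  (aeW _ (fun q _ => cf q)) ig (aeW _ (fun q n _ => dom n q)).
have := cvg_lim (@ereal_hausdorff R) D => <-.
by apply: lim_near_cst => //; apply: nearW => n; exact: fn0.
Qed.

Lemma upper_ray_itv (A : set R) (a b : R) : a <= b -> upper_rays A ->
  exists l, [/\ a <= l, l <= b & A `&` `]a, b[ = `]l, b[%classic].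
Proof.
move=> ab [->|[x ->]].
  by exists a; split => //; rewrite setTI.
(* The endpoint x clamped to [a, b]; a ray starting beyond b leaves the empty interval ]b, b[. *)
exists (Num.min (Num.max x a) b); split.
- by rewrite le_min ab andbT le_max lexx orbT.
- by rewrite ge_min lexx orbT.
apply/seteqP; split => z /=; rewrite !in_itv/= andbT gt_min gt_max.
  by move=> [xz /andP[az zb]]; rewrite xz az zb.
by move=> /andP[/orP[/andP[-> ->]|bz] zb] //; move: (lt_trans bz zb); rewrite ltxx.
Qed.

Lemma upper_ray3 (A B C : set R) (N : R) : 0 <= N ->
  upper_rays A -> upper_rays B -> upper_rays C ->
  exists l : R3 R, ((A `*` B) `*` C) `&` box3 (- N, - N, - N) (N, N, N) = box3 l (N, N, N) /\
    box3 l (N, N, N) `<=` cube3 N.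
Proof.
move=> N0 rA rB rC; have NN : - N <= N by lra.
have [a [aN _ EA]] := upper_ray_itv NN rA.
have [b [bN _ EB]] := upper_ray_itv NN rB.
have [c [cN _ EC]] := upper_ray_itv NN rC.
exists (a, b, c); rewrite /box3 /= -EA -EB -EC; split.
  by apply/seteqP; split=> -[[x y] z] /=; tauto.
move=> [[x y] z] [[/= [_ xN] [_ yN]] [_ zN]]; split; [split|] => /=;
  exact: subset_itv_oo_cc.
Qed.

Lemma strip_cube_ae0 N : 0 <= N ->
  \forall q \ae sleb, (box7 (0, ((- N, - N, - N), (- N, - N, - N))) (T, ((N, N, N), (N, N, N))) `*` I) q -> W q = 0.
Proof.
move=> N0; set c := (N, N, N) : R3 R; set l := (0, _); set h := (T, _); set B := _ `*` _.
have adm l' : 0 <= l'.1 -> box3 l'.2.1 c `<=` cube3 N -> box3 l'.2.2 c `<=` cube3 N ->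
  admissible N l' h by split=> //=.
have NN : - N <= N by lra.
have cubeN : box3 (- N, - N, - N) c `<=` cube3 N.
  by move=> [[x y] z] [[/= xN yN] zN]; split; [split|] => /=; exact: subset_itv_oo_cc.
have lh : admissible N l h by exact: adm.
have mI : measurable (I : set mR) by exact: measurable_itv.
have mi (a b : R) : measurable (`]a, b[%classic : set mR) by exact: measurable_itv.
have mbox7 l' h' : measurable (box7 l' h' : set Y).
  by apply: measurableX => //; apply: measurableX; (apply: measurableX; first exact: measurableX).
have mB : measurable (B : set strip) by exact: measurableX.
(* W is only square integrable; cutting it to a bounded box makes it integrable, as the determining
   classes require. *)
pose V q := W q * (\1_(box7 l h) q.1 * \1_I q.2).
have iV : sleb.-integrable setT (EFin \o V).
  apply: (@strip_integrable _ _ _ leb7 (cube7 (N + T)) 1 (measurable_cube7 _) (leb7_cube7 _) ler01 W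
     (fun q => \1_(box7 l h) q.1)) => //; first exact: (measurableT_comp (measurable_indic (mbox7 _ _))).
  move=> y t It /=; rewrite mul1r ger0_norm// !indicE ler_nat.
  have [yB|yB] := pselect (box7 l h y); last by rewrite memNset.
  by rewrite !mem_set//; exact: admissible_cube lh N0 _ yB.
have mt : measurable_fun setT (fun q : strip => q.1.1) by apply: measurableT_comp.
have mx : measurable_fun setT (fun q : strip => q.1.2.1) by do 2 apply: measurableT_comp => //.
have mw : measurable_fun setT (fun q : strip => q.1.2.2) by do 2 apply: measurableT_comp => //.
have d3 (g : strip -> mR3 R) : measurable_fun setT g ->
    determining sleb V (fun q => ((g q).1.1, (g q).1.2, (g q).2))
      [set A `*` C | A in [set A `*` C | A in @upper_rays R & C in @upper_rays R] & C in @upper_rays R].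
  move=> mg; apply: (determining_prod iV).
    by apply: (determining_prod iV); apply: (determining_rays iV); do 2 apply: measurableT_comp => //.
  by apply: (determining_rays iV); apply: measurableT_comp.
have [_ _ D] := determining_prod iV
  (determining_prod iV (determining_rays iV mt) (determining_prod iV (d3 _ mx) (d3 _ mw)))
  (determining_rays iV (@measurable_snd _ _ Y mR)).
have VE E : measurable E -> (\int[sleb]_(q in E) (V q)%:E = 0)%E.
  move=> mE.
  have := D setT measurableT _ E mE; rewrite /vanishing setTI.
  (* The coordinate maps reassemble to the identity of the strip. *)
  rewrite (_ : _ @^-1` E = E); last first.
    by apply/seteqP; split=> -[[t [[[x1 x2] x3] [[v1 v2] v3]]] s].
  (* A generator is a product of eight rays, for t, the three components of x, those of w, and tau.
     Inside the support of V it is an admissible box times an interval ]a, 1[. *)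
  apply=> _ [_ [A1 r1 [_ [_ [_ [A2 r2 [A3 r3 <-]] [A4 r4 <-]] [_ [_ [A5 r5 [A6 r6 <-]] [A7 r7 <-]] <-]] <-]] [A8 r8 <-]].
  have [a [a0 a1 Ea]] := upper_ray_itv ler01 r8.
  have [t [t0 tT Et]] := upper_ray_itv (ltW T_gt0) r1.
  have [lx [Ex Nx]] := upper_ray3 N0 r2 r3 r4.
  have [lw [Ew Nw]] := upper_ray3 N0 r5 r6 r7.
  have lh' : admissible N (t, (lx, lw)) h by exact: adm.
  have a01 : 0 <= a <= 1 by rewrite a0 a1.
  rewrite -[RHS](strip_box_null a01 N0 lh') setTI integral_mkcond.
  apply: eq_integral => -[[s [x w]] tau] _; rewrite patchE /V /=.
  have eqI (Z : Type) (A A' A'' : set Z) : A `&` A' = A'' -> forall z, A'' z <-> A z /\ A' z by move=> <-.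
  have {Ea} Ha := eqI _ _ _ _ Ea tau; have {Et} Ht := eqI _ _ _ _ Et s.
  have {Ex} Hx := eqI _ _ _ _ Ex x; have {Ew} Hw := eqI _ _ _ _ Ew w.
  have [[Q1 Q2]|nQ] := pselect (`]a, 1[%classic tau /\ box7 (t, (lx, lw)) h (s, (x, w))).
    have [Q3 [Q4 Q5]] := Q2.
    have [P8 Itau] := Ha.1 Q1; have [P1 Is] := Ht.1 Q3.
    have [P2 Bx] := Hx.1 Q4; have [P5 Bw] := Hw.1 Q5.
    rewrite mem_set; last by move: P2 P5 => -[[? ?] ?] [[? ?] ?].
    by rewrite !indicE !(mem_set Q1) !(mem_set Q2) !(mem_set Itau) mem_set.
  have -> : \1_`]a, 1[ tau * \1_(box7 (t, (lx, lw)) h) (s, (x, w)) = 0 :> R.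
    rewrite !indicE; have [h1|h1] := pselect (`]a, 1[%classic tau); last by rewrite memNset ?mul0r.
    have [h2|h2] := pselect (box7 (t, (lx, lw)) h (s, (x, w))); first by case: nQ.
    by rewrite (memNset h2) mulr0.
  rewrite mulr0; case: ifPn => //; rewrite inE => -[[P1 [[[P2 P3] P4] [[P5 P6] P7]]] P8].
  rewrite (_ : _ * _ = 0)// !indicE.
  have [Itau|nI] := pselect (I tau); last by rewrite (memNset nI) !mulr0.
  have [[Ts [Bx Bw]]|nB] := pselect (box7 l h (s, (x, w))); last by rewrite memNset// mul0r mulr0.
  case: nQ; split; first by apply/Ha.
  by split; [apply/Ht|split; [apply/Hx|apply/Hw]].
have V0 : \forall q \ae sleb, setT q -> (V q)%:E = 0%E.
  apply: (integral_ae_eq measurableT iV) => // E _ mE.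
  by rewrite VE// integral0_eq.
apply: filterS V0 => q Vq Bq; have {Vq} := Vq Logic.I.
move: Bq => [Bq1 Bq2]; rewrite /V !indicE !mem_set// !mulr1.
by case.
Qed.

(** The cubes of integer half-side exhaust the phase space, and a countable union of null sets is
    null. *)
Lemma strip_ae0 : \forall q \ae sleb, W q = 0.
Proof.
have : \forall q \ae sleb, forall k : nat,
    (box7 (0, ((- k%:R, - k%:R, - k%:R), (- k%:R, - k%:R, - k%:R)))
       (T, ((k%:R, k%:R, k%:R), (k%:R, k%:R, k%:R))) `*` I) q -> W q = 0.
  by apply: ae_foralln => k; exact: strip_cube_ae0.
apply: (@filterS _ _ (ae_filter_ringOfSetsType (sleb : {measure set strip -> \bar R}))) => -[[t [x v]] s] H.
have [Is|nIs] := pselect (I s); last exact: WI.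
have [tT|ntT] := pselect (`]0%R, T[%classic t); last exact: WT.
pose b (v : R3 R) : R := `|v.1.1| + `|v.1.2| + `|v.2|.
pose k := (Num.truncn (b x + b v)).+1.
have kb : b x + b v < k%:R by exact: truncnS_gt.
have bx v' : 0 <= b v' by rewrite !addr_ge0.
have c v' : b v' < k%:R -> box3 (- k%:R, - k%:R, - k%:R) (k%:R, k%:R, k%:R) v'.
  have := normr_ge0 v'.1.1; have := normr_ge0 v'.1.2; have := normr_ge0 v'.2.
  by move=> h1 h2 h3; rewrite /b => hb; split; [split|];
    rewrite /= in_itv/= -ltr_norml; lra.
apply: (H k); split=> //; split => //; split; apply: c.
- by have := bx v; lra.
- by have := bx x; lra.
Qed.

End separation.

Section almost_everywhere.
Context {R : realType}.
Local Notation leb := (@lebesgue_measure R).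
Local Notation mR := (measurableTypeR R).

Lemma mpres_ae d1 d2 (X : measurableType d1) (Y : measurableType d2)
    (mu : {measure set X -> \bar R}) (nu : {measure set Y -> \bar R})
    (phi : X -> Y) (P : Y -> Prop) :
  mpres mu nu phi -> (\forall y \ae nu, P y) -> \forall x \ae mu, P (phi x).
Proof.
move=> [mphi E] [A [mA A0 PA]]; exists (phi @^-1` A); split.
- by rewrite -[X in measurable X]setTI; exact: mphi.
- by apply: (etrans (E _ mA)).
- by move=> x Px; exact: PA.
Qed.

Lemma ae_prod_snd d1 d2 (X : measurableType d1) (Y : measurableType d2)
    (m1 : {sigma_finite_measure set X -> \bar R})
    (m2 : {sigma_finite_measure set Y -> \bar R}) (P : Y -> Prop) :
  (\forall y \ae m2, P y) -> \forall p \ae (m1 \x m2)%E, P p.2.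
Proof.
move=> [A [mA A0 PA]]; exists (setT `*` A); split.
- exact: measurableX.
- apply: (etrans (product_measure1E m1 m2 (@measurableT _ X) mA)).
  by rewrite [X in (_ * X)%E]A0 mule0.
- by move=> p Pp; split => //; exact: PA.
Qed.

Lemma ae_neq_nat : \forall s \ae leb, forall n : nat, s <> n%:R.
Proof.
apply: ae_foralln => n; exists [set n%:R]; split.
- exact: measurable_set1.
- exact: lebesgue_measure_set1.
- by move=> s /= /contrapT.
Qed.

End almost_everywhere.

Section uniqueness.
Context {R : realType}.
Variable T : R.
Hypothesis T_gt0 : 0 < T.
Local Notation leb := (@lebesgue_measure R).
Local Notation mR := (measurableTypeR R).
Local Notation V := (kspace R).
Local Notation I := (`]0%R, 1%R[%classic : set R).
Local Notation strip := (mR * mR6 R * mR)%type.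
Local Notation leb8 := (@leb8 R).
Local Notation sleb := (@sleb R).
Local Notation M := ((2 * pi) *: vec1 : R3 R).

Lemma integrable_pairing (g psi : mkspace R -> R) (C N : R) :
  LinfLinfL2 T g -> measurable_fun setT psi -> 0 <= C ->
  (forall y tau, I tau -> `|psi (orbit_point y tau)| <= C * \1_(cube7 N) y) ->
  leb8.-integrable (kdom_period T) (EFin \o (fun p => g p * psi p)).
Proof.
move=> gL mpsi C0 psiC; have mkp := @measurable_kdom_period R T.
have mg : measurable_fun (kdom_period T) g.
  by case: gL => mg _ _; apply: measurable_funS mg; [exact: measurable_kdom|exact: kdom_period_sub].
apply/(integrable_mkcond _ mkp); rewrite restrict_EFin.
apply/(mpres_integrable (@mpres_straight R)).
  apply/measurable_EFinP; apply/(measurable_restrictT _ _).1 => //.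
  by apply: measurable_funM => //; exact: measurable_funTS.
have mst := (@mpres_straight R).1.
have slI : (\int[sleb]_q ((slab T g q * \1_I q.2) ^+ 2)%:E < +oo)%E.
  have := slab_sq_lty T_gt0 gL; rewrite (eq_integral (fun q => ((slab T g q * \1_I q.2) ^+ 2)%:E))//.
  move=> [y s] _; rewrite indicE; have [Is|nIs] := pselect (I s); last by rewrite slab_eq0// mul0r.
  by rewrite mem_set// mulr1.
have := @strip_integrable _ _ _ leb7 (cube7 N) C (measurable_cube7 _) (leb7_cube7 _) C0
  (slab T g) (psi \o straight) (measurable_slab gL) (measurableT_comp mpsi mst) slI psiC.
apply: eq_integrable => // -[y s] _; congr EFin; rewrite /= /slab /= !patchE.
case: ifPn => [|_]; last by rewrite mul0r.
by rewrite inE => -[[_ Is] _]; rewrite indicE mem_set// mulr1.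
Qed.

Lemma transport_product phi (E E' : R -> R) (b : R) y : test_function T phi ->
  (forall tau, phi (orbit_point y tau) = E tau * b) ->
  (forall x : R, is_derive x (1 : R) E (E' x)) ->
  forall tau, transport phi (orbit_point y tau) = E' tau * b.
Proof.
move=> tphi phiE dE tau.
have d := is_derive_orbit (test_differentiable tphi (orbit_point y tau)).
rewrite -(@derive_val _ _ _ _ _ _ _ d).
have -> : phi \o orbit_point y = b \*: (E : R -> R^o) by apply/funext => s; rewrite /= phiE mulrC.
have dEt := dE tau.
by rewrite derive_val /= -[LHS]/(b * _) mulrC.
Qed.

Lemma ker_pairing g phi : transport_ker T M g -> test_function T phi ->
  \int[leb8]_(p in kdom_period T) (g p * transport phi p) = 0.
Proof.
move=> [_ kg] tphi; have := kg _ tphi; rewrite Rintegral_transport//.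
under eq_Rintegral do rewrite /cst mul0r.
rewrite Rintegral_cst ?mul0r; last exact: measurable_kdom_period.
by move=> /esym/eqP; rewrite oppr_eq0 => /eqP.
Qed.

(** A test function constant along the characteristics is killed by the transposed operator, so its
    pairing with an element of the range vanishes whatever the primitive u. *)
Lemma im_pairing h phi : transport_im T M h -> test_function T phi ->
  (forall p, transport phi p = 0) ->
  \int[leb8]_(p in kdom_period T) (h p * phi p) = 0.
Proof.
move=> [_ [u uL ku]] tphi phi0; rewrite (ku _ tphi) Rintegral_transport//.
under eq_Rintegral do rewrite phi0 mulr0.
by rewrite Rintegral_cst ?mul0r ?oppr0//; exact: measurable_kdom_period.
Qed.

Lemma Rintegral_pairingB (g g' psi : mkspace R -> R) (C N : R) :
  LinfLinfL2 T g -> LinfLinfL2 T g' -> measurable_fun setT psi -> 0 <= C ->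
  (forall y tau, I tau -> `|psi (orbit_point y tau)| <= C * \1_(cube7 N) y) ->
  \int[leb8]_(p in kdom_period T) ((g \- g') p * psi p) =
  \int[leb8]_(p in kdom_period T) (g p * psi p) - \int[leb8]_(p in kdom_period T) (g' p * psi p).
Proof.
move=> gL g'L mpsi C0 psiC; have mkp := @measurable_kdom_period R T.
rewrite -RintegralB//; [|exact: integrable_pairing psiC|exact: integrable_pairing psiC].
by apply: eq_Rintegral => p _; rewrite -mulrBl.
Qed.

(* A class vanishing on the first period vanishes for all tau > 0; in the
   straightened coordinates the unit translation of tau acts on the last factor
   alone. *)
Lemma ae_eq0_period (w : mkspace R -> R) :
  (\forall p \ae leb8, kdom T p -> w ((p.1.1, p.1.2 + 1), p.2) = w p) ->
  (\forall q \ae sleb, slab T w q = 0) ->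
  \forall p \ae leb8, kdom T p -> w p = 0.
Proof.
move=> pw w0.
have sT : mpres sleb sleb (fun q => (q.1, q.2 + -1)).
  apply: (@mpres_skew _ _ _ _ _ _ _ leb7 leb leb (fun q : strip => q.2 + -1 : mR)).
    by apply: measurable_funD.
  by move=> y; exact: mpres_shift.
have H n : \forall q \ae sleb, kdom T (straight q) -> n%:R < q.2 < n.+1%:R -> w (straight q) = 0.
  elim: n => [|n IHn].
    apply: filterS w0 => -[y s] + [[/= yT _] _] Is.
    have {}Is : (s : R) \in `]0%R, 1%R[ by rewrite in_itv.
    by rewrite slabE.
  have pw' := mpres_ae sT (mpres_ae (@mpres_straight R) pw).
  have IHn' := mpres_ae sT IHn.
  apply: filterS2 pw' IHn' => -[y s] /= pws ws [[/= yT s0] _] /andP[n1 n2].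
  have n0 : (0 : R) <= n%:R by [].
  have k : kdom T (straight (y, s - 1)).
    by split => //; split => //=; rewrite in_itv/= andbT; move: n1; rewrite -natr1; lra.
  have := pws k; rewrite /= subrK -[in larmor _ _]larmorD1 subrK => ->.
  apply: ws => //; move: n1 n2; rewrite -!natr1 => n1 n2; apply/andP; split; lra.
(* Integer values of tau lie in none of the open unit intervals; they form a null set. *)
have U : \forall q \ae sleb, kdom T (straight q) -> w (straight q) = 0.
  apply: filterS2 (ae_foralln H) (ae_prod_snd leb7 (@ae_neq_nat R)) => -[y s] /= Hq sn kq.
  have s0 : 0 < s by move: kq => -[[_ /=]]; rewrite in_itv/= andbT.
  apply: (Hq (Num.truncn s)) => //; have := truncn_itv (ltW s0) => /andP[h1 ->].
  by rewrite andbT lt_neqAle h1 andbT; apply/eqP => /esym; exact: sn.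
by apply: filterS (mpres_ae (@mpres_unstraight R) U) => p; rewrite unstraightK.
Qed.

(** Kernel and range are defined by integral relations, so differences are formed at the level of
    pairings, each being integrable against a test function. *)
Lemma ker_im_disjoint g g' h h' :
  transport_ker T M g -> transport_ker T M g' ->
  transport_im T M h -> transport_im T M h' ->
  ae_eq leb8 (kdom T) (g' \- g) (h \- h') -> same_class T g' g.
Proof.
move=> kg kg' ih ih' E.
have gL := kg.1; have g'L := kg'.1; have hL := ih.1; have h'L := ih'.1.
have mkp := @measurable_kdom_period R T.
pose w := g' \- g; have wL : LinfLinfL2 T w by exact: LinfLinfL2B.
have wL' : LinfLinfL2 T (h \- h') by exact: LinfLinfL2B.
have mX (u : mkspace R -> R) : LinfLinfL2 T u -> measurable_fun (kdom_period T) u.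
  by case=> mu _ _; apply: measurable_funS mu; [exact: measurable_kdom|exact: kdom_period_sub].
have mw := mX _ wL; have mw' := mX _ wL'.
have slE q : kdom_period T (straight q) -> w (straight q) = slab T w q.
  by move: q => [y s] kq; rewrite slabE//; case: kq => -[].
suff w0 : \forall q \ae sleb, slab T w q = 0.
  have [_ pw _] := wL; have := ae_eq0_period pw w0; apply: filterS => p wp kp.
  by apply/eqP; rewrite -subr_eq0; apply/eqP; exact: wp.
apply: (strip_ae0 T_gt0 (measurable_slab wL) (@slab_eq0 _ T w) _ (slab_sq_lty T_gt0 wL)).
- by move=> y s nyT; rewrite /slab /= patchE memNset// => -[[/nyT]].
- move=> E1 E1' N l h0 n [l0 hT HN1 HN2] sE pE dE.
  have tphi := rotated_test_function n sE pE l0 hT HN1 HN2.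
  set phi := rotated_test _ _ _ _ in tphi.
  have [C [N' [C0 _ psiC]]] := test_strip tphi.
  have mt := measurable_transport tphi.
  have := Rintegral_pairingB g'L gL mt C0 psiC.
  rewrite (ker_pairing kg tphi) (ker_pairing kg' tphi) subr0 (@Rintegral_straight _ _ w (transport phi) (slab T w))//.
  + move=> w0; rewrite -[RHS]w0; apply: eq_Rintegral => -[y s] _; congr (_ * (_ * _)); apply/esym.
    have phiE tau := rotated_test_orbit E1 l h0 n y tau.
    exact: (transport_product tphi phiE dE).
  + by move=> y tau; exact: transport_time.
- move=> N l h0 n [l0 hT HN1 HN2].
  have tphi := rotated_test_function n (smoothc_cst R 1) (fun=> erefl) l0 hT HN1 HN2.
  set phi := rotated_test _ _ _ _ in tphi.
  have [C [N' [C0 psiC _]]] := test_strip tphi.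
  have mt := measurable_test tphi.
  have phiE y tau : phi (orbit_point y tau) = 1 * bump7 l h0 n y.
    exact: rotated_test_orbit.
  have phi0 p : transport phi p = 0.
    rewrite -(unstraightK p) -[straight _]/(orbit_point (unstraight p).1 (unstraight p).2).
    have d0 (x : R) : is_derive x (1 : R) (fun=> 1 : R) ((fun=> 0) x) by exact: is_derive_cst.
    by rewrite (transport_product tphi (phiE _) d0) mul0r.
  have := Rintegral_pairingB hL h'L mt C0 psiC.
  rewrite (im_pairing ih tphi phi0) (im_pairing ih' tphi phi0) subr0 => w0; rewrite -[RHS]w0.
  transitivity (\int[leb8]_(p in kdom_period T) (w p * phi p)).
    rewrite (@Rintegral_straight _ _ w phi (slab T w))//.
    + apply: eq_Rintegral => -[y s] _; congr (_ * (_ * _)).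
      by have := phiE y s; rewrite mul1r => ->.
      + by move=> y tau; exact: test_time.
  (* The range controls the pairing of [h \- h']; the hypothesis [E] transfers it to [w], which is
     [g' \- g]. *)
  rewrite /Rintegral; congr fine; apply: ae_eq_integral => //.
  + by apply/measurable_EFinP/measurable_funM => //; exact: measurable_funTS.
  + by apply/measurable_EFinP/measurable_funM => //; exact: measurable_funTS.
  by apply: filterS E => p wp kp; congr (EFin (_ * _)); apply/wp/kdom_period_sub.
Qed.

End uniqueness.

Theorem lemmaB1 (R : realType) (T : R) (T_gt0 : 0 < T) :
  let M : R3 R := (2 * pi) *: vec1 in
  direct_sum T (LinfLinfL2 T) (transport_ker T M) (transport_im T M).
Proof.
split=> [f []//|f []//|f fL].
have gk := mean_part_ker T_gt0 fL; have hi := remainder_im T_gt0 fL.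
exists (mean_part T f), (f \- mean_part T f); split=> //.
  by apply: aeW => p _ /=; rewrite addrC subrK.
move=> g' h' gk' hi' fE.
have gE : same_class T g' (mean_part T f).
  apply: (ker_im_disjoint T_gt0 gk gk' hi hi').
  by apply: filterS fE => p fp kp; rewrite /= fp//=; ring.
split=> //; apply: filterS2 fE gE => p fp gp kp.
by rewrite /= fp//= gp//; ring.
Qed.
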